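(* Let $n\ge 1$, and let $D$ and $D'$ be $n$-component virtual link diagrams of the same welded link (i.e. $D$ and $D'$ are related by a finite sequence of welded Reidemeister moves). Let $\mathbf{p}$ and $\mathbf{p}'$ be base point systems of $D$ and $D'$, respectively. Then, for any sequence $I$ of indices in $\{1,\ldots,n\}$, $$\mu_{(D,\mathbf{p})}(I)\equiv\mu_{(D',\mathbf{p}')}(I)\pmod{\Delta_{(D,\mathbf{p})}(I)}\quad\text{and}\quad \Delta_{(D,\mathbf{p})}(I)=\Delta_{(D',\mathbf{p}')}(I).$$
   Context: Virtual link diagrams. An $n$-component virtual link diagram is the image of an immersion of $n$ ordered and oriented circles into the plane whose only singularities are transverse double points, each of which is either a classical crossing (with over/under information) or a virtual crossing (without). Diagrams are considered up to isotopy of the plane. The sign of a classical crossing is the usual sign of an oriented crossing. Welded Reidemeister moves: R1, R2, R3 are the usual Reidemeister moves on classical crossings; V1, V2, V3 are the same moves with all crossings virtual; V4 is the version of R3 in which a strand meeting two other strands only in virtual crossings is moved across the classical crossing of these two strands; OC (over-crossings commute) is the version of R3 in which a strand passing over two other strands (at two classical crossings) is moved across the virtual crossing of these two strands. All orientations of strands are allowed. A welded link is an equivalence class of virtual link diagrams under finite sequences of these moves. Base points and arcs. A base point system of $D$ is $\mathbf{p}=(p_1,\ldots,p_n)$, with $p_i$ a point of the $i$th component away from all crossings. The classical under-crossings and the base points divide $D$ into segments (which may pass through classical over-crossings and virtual crossings), called arcs of $(D,\mathbf{p})$. Let $a_{i1}$ be the outgoing arc from $p_i$ and let $a_{i2},\ldots,a_{i\,m_i+1}$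 be the other arcs of the $i$th component in order along the orientation. For $1\le j\le m_i$, let $u_{ij}$ be the arc of $(D,\mathbf p)$ containing the over-strand at the classical crossing separating $a_{ij}$ and $a_{i\,j+1}$, let $\varepsilon_{ij}\in\{\pm1\}$ be the sign of this crossing, and put $v_{ij}=u_{i1}^{\varepsilon_{i1}}u_{i2}^{\varepsilon_{i2}}\cdots u_{ij}^{\varepsilon_{ij}}$ ($v_{i0}=1$). Milnor numbers. Let $A=\langle\alpha_1,\ldots,\alpha_n\rangle$ be the free group of rank $n$ and $\overline{A}$ the free group on the set of arcs $\{a_{ij}\}$. Homomorphisms $\eta_q=\eta_q(D,\mathbf{p}):\overline{A}\to A$ ($q\ge1$) are defined inductively by $\eta_1(a_{ij})=\alpha_i$, $\eta_{q+1}(a_{i1})=\alpha_i$, and $\eta_{q+1}(a_{ij})=\eta_q(v_{i\,j-1}^{-1})\,\alpha_i\,\eta_q(v_{i\,j-1})$ for $2\le j\le m_i+1$. Let $w_i$ be the sum of the signs of all classical self-crossings of the $i$th component, and let $l_i=a_{i1}^{-w_i}v_{im_i}$ (the $i$th preferred longitude). The Magnus expansion is the homomorphism $E$ from $A$ to the units of the ring $\mathbb{Z}\langle\langle X_1,\ldots,X_n\rangle\rangle$ of formal power series in non-commuting variables with $E(\alpha_i)=1+X_i$. For a sequence $j_1\ldots j_s i$ ($s\ge1$) of indices in $\{1,\ldots,n\}$, the Milnor number $\mu_{(D,\mathbf{p})}(j_1\ldots j_s i)\in\mathbb{Z}$ is the coefficient of $X_{j_1}\cdots X_{j_s}$ in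 $E(\eta_q(l_i))$ for any $q>s$; this does not depend on the choice of $q>s$. Sequences are understood to have length at least $2$. Indeterminacy. $\Delta_{(D,\mathbf{p})}(i_1\ldots i_r)\ge 0$ is the greatest common divisor of all $\mu_{(D,\mathbf{p})}(j_1\ldots j_s)$, where $j_1\ldots j_s$ ($2\le s<r$) is obtained from $i_1\ldots i_r$ by removing at least one index and permuting the remaining indices cyclically; $\Delta_{(D,\mathbf{p})}(i_1i_2)=0$. (The gcd of zeros is $0$, and congruence modulo $0$ is equality.) *)

(* Defs.v *)
From HB Require Import structures.
From mathcomp Require Import all_boot all_order all_algebra.
From mathcomp Require Import all_classical all_reals all_analysis.
From Stdlib Require Import Relations.

Set Implicit Arguments.
Unset Strict Implicit.
Unset Printing Implicit Defensive.

Import Order.TTheory GRing.Theory Num.Theory.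
Import numFieldNormedType.Exports.

Local Open Scope classical_set_scope.
Local Open Scope ring_scope.

(* The letter (x, false) stands for x and (x, true) for its inverse; a group
   element is a word without adjacent mutually inverse letters. *)
Section FreeGroup.
Variable T : choiceType.
Local Notation letter := (T * bool)%type.
Implicit Types (x y : letter) (u v w : seq letter).

Definition flip x : letter := (x.1, ~~ x.2).
Arguments flip : simpl never.

Definition reduced w := sorted (fun x y => y != flip x) w.

Record freeGroup := FreeGroup { fgword : seq letter; _ : reduced fgword }.

HB.instance Definition _ := [isSub for fgword].
HB.instance Definition _ := [Choice of freeGroup by <:].

Definition reduce_cons x w :=
  if w is y :: w' then if y == flip x then w' else x :: w else [:: x].

Definition reduce w := foldr reduce_cons [::] w.

Lemma flipK : involutive flip.
Proof. by case=> a b; rewrite /flip /= negbK. Qed.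

Lemma reduced_behead x w : reduced (x :: w) -> reduced w.
Proof. exact: path_sorted. Qed.

Lemma reduced_cons x w : reduced w -> reduced (reduce_cons x w).
Proof.
case: w => [|y w] //= yw; case: ifP => [_|/negbT neq]; first exact: path_sorted yw.
by rewrite /reduced /= neq.
Qed.

Lemma reduce_reduced w : reduced (reduce w).
Proof. by elim: w => //= x w; apply: reduced_cons. Qed.

Lemma reduce_id w : reduced w -> reduce w = w.
Proof.
elim: w => //= x w IH xw; rewrite IH; last exact: path_sorted xw.
by case: w xw {IH} => //= y w /andP[/negPf-> _].
Qed.

Lemma reduce_consK x w : reduced w -> reduce_cons x (reduce_cons (flip x) w) = w.
Proof.
case: w => [|y w]; first by rewrite /reduce_cons eqxx.
rewrite {2}/reduce_cons flipK; case: (eqVneq y x) => [->|_ _]; last first.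
  by rewrite /reduce_cons eqxx.
case: w => // z w /andP[/negPf zx _]; by rewrite /reduce_cons zx.
Qed.

Lemma reduce_cat u v : reduce (u ++ v) = foldr reduce_cons (reduce v) u.
Proof. exact: foldr_cat. Qed.

Lemma foldr_reduced u v : reduced v -> reduced (foldr reduce_cons v u).
Proof. by move=> rv; elim: u => //= x u; apply: reduced_cons. Qed.

Lemma foldr_reduce_cons x u v : reduced v ->
  foldr reduce_cons v (reduce_cons x u) = reduce_cons x (foldr reduce_cons v u).
Proof.
move=> rv; case: u => [|y u] //=.
case: eqP => [->|//]; rewrite reduce_consK //; exact: foldr_reduced.
Qed.

Lemma reduce_catl u v : reduce (reduce u ++ v) = reduce (u ++ v).
Proof.
rewrite !reduce_cat; elim: u => //= x u IH.
by rewrite foldr_reduce_cons ?IH //; apply: reduce_reduced.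
Qed.

Lemma reduce_catr u v : reduce (u ++ reduce v) = reduce (u ++ v).
Proof. by rewrite !reduce_cat reduce_id //; apply: reduce_reduced. Qed.

Definition winv w := rev (map flip w).

Lemma reduce_winv w : reduce (winv w ++ w) = [::].
Proof.
elim: w => //= x w IH.
have := reduce_consK (flip x) (reduce_reduced w); rewrite flipK => xK.
by rewrite /winv /= rev_cons cat_rcons reduce_cat /= xK -reduce_cat.
Qed.

Lemma winvK : involutive winv.
Proof. by move=> w; rewrite /winv map_rev revK mapK //; apply: flipK. Qed.

Definition fg_of w := FreeGroup (reduce_reduced w).
Definition fg_one := fg_of [::].
Definition fg_mul a b := fg_of (fgword a ++ fgword b).
Definition fg_inv a := fg_of (winv (fgword a)).
Definition fg_gen (t : T) := fg_of [:: (t, false)].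

Lemma fgwordK a : reduce (fgword a) = fgword a.
Proof. by case: a => w rw; apply: reduce_id. Qed.

Fact fg_mulA : associative fg_mul.
Proof. by move=> a b c; apply/val_inj; rewrite /= reduce_catr reduce_catl catA. Qed.
Fact fg_mul1 : left_id fg_one fg_mul.
Proof. by move=> a; apply/val_inj; apply: fgwordK. Qed.
Fact fg_mulr1 : right_id fg_one fg_mul.
Proof. by move=> a; apply/val_inj; rewrite /= cats0 fgwordK. Qed.
Fact fg_mulV : left_inverse fg_one fg_inv fg_mul.
Proof. by move=> a; apply/val_inj; rewrite /= reduce_catl reduce_winv. Qed.
Fact fg_mulrV : right_inverse fg_one fg_inv fg_mul.
Proof.
move=> a; apply/val_inj; rewrite /= reduce_catr.
by rewrite -{1}[fgword a]winvK reduce_winv.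
Qed.

HB.instance Definition _ :=
  isGroup.Build freeGroup fg_mulA fg_mul1 fg_mulr1 fg_mulV fg_mulrV.

Lemma big_reduce (M : Type) (idx : M) (op : Monoid.law idx) (e : letter -> M) :
  (forall x, op (e x) (e (flip x)) = idx) ->
  forall w, \big[op/idx]_(x <- reduce w) e x = \big[op/idx]_(x <- w) e x.
Proof.
move=> eV; elim=> //= x w IH; rewrite big_cons -IH.
case: (reduce w) => [|y v] /=; first by rewrite !big_cons !big_nil.
case: eqP => [->|_]; last by rewrite big_cons.
by rewrite big_cons Monoid.mulmA [X in SemiGroup.Law.sort _ X _]eV; symmetry; apply: Monoid.mul1m.
Qed.

End FreeGroup.

Section FreeLift.
Variables (T : choiceType) (G : groupType).
Local Open Scope group_scope.

Definition fg_lift (f : T -> G) (a : freeGroup T) : G :=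
  \prod_(x <- fgword a) (if x.2 then (f x.1)^-1 else f x.1).

Lemma fg_lift_gen f t : fg_lift f (fg_gen t) = f t.
Proof. by rewrite /fg_lift /= big_seq1. Qed.

Lemma fg_liftM f : {morph fg_lift f : a b / a * b >-> a * b}.
Proof.
move=> a b; rewrite /fg_lift /= big_reduce ?big_cat //.
by case=> t [] /=; rewrite ?mulVg ?mulgV.
Qed.

End FreeLift.

Definition expgz (G : groupType) (x : G) (k : int) : G :=
  match k with Posz m => (x ^+ m)%g | Negz m => (x ^- m.+1)%g end.

(* A series is given by its coefficients: f [:: j1; ...; js] is that of
   X_j1 ... X_js. *)
Definition ncseries (n : nat) := seq 'I_n -> int.

HB.instance Definition _ n := GRing.Zmodule.on (ncseries n).

Section NcSeries.
Variable n : nat.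
Implicit Types (f g h : ncseries n) (w : seq 'I_n).

Definition nc_one : ncseries n := fun w => (w == [::])%:R.

Definition nc_var (i : 'I_n) : ncseries n := fun w => (w == [:: i])%:R.

Definition nc_mul f g : ncseries n :=
  fun w => \sum_(k < (size w).+1) f (take k w) * g (drop k w).

Lemma nc_mul_nil f g : nc_mul f g [::] = f [::] * g [::].
Proof. by rewrite /nc_mul big_ord1. Qed.

Lemma nc_mul_cons f g x w : nc_mul f g (x :: w) =
  f [::] * g (x :: w) + nc_mul (fun v => f (x :: v)) g w.
Proof. by rewrite /nc_mul big_ord_recl /=. Qed.

Lemma nc_mul_addl f g h w :
  nc_mul (fun v => f v + g v) h w = nc_mul f h w + nc_mul g h w.
Proof. by rewrite /nc_mul -big_split; apply: eq_bigr => k _; rewrite mulrDl. Qed.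

Lemma nc_mul_scale c f g w : nc_mul (fun v => c * f v) g w = c * nc_mul f g w.
Proof. by rewrite /nc_mul mulr_sumr; apply: eq_bigr => k _; rewrite mulrA. Qed.

Lemma nc_mul0l g w : nc_mul (fun=> 0) g w = 0.
Proof. by rewrite /nc_mul big1 // => k _; rewrite mul0r. Qed.

Fact nc_mulA : associative nc_mul.
Proof.
move=> f g h; apply/funext => w; elim: w f g h => [|x w IH] f g h.
  by rewrite !nc_mul_nil mulrA.
rewrite !nc_mul_cons nc_mul_nil.
under [in RHS]eq_fun do rewrite nc_mul_cons.
rewrite nc_mul_addl nc_mul_scale -[nc_mul (nc_mul _ _) _ _]IH.
by rewrite mulrDr mulrA addrA.
Qed.

Fact nc_mul1 : left_id nc_one nc_mul.
Proof.
move=> f; apply/funext => -[|x w]; first by rewrite nc_mul_nil mul1r.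
by rewrite nc_mul_cons mul1r nc_mul0l addr0.
Qed.

Fact nc_mulr1 : right_id nc_one nc_mul.
Proof.
move=> f; apply/funext => w; elim: w f => [|x w IH] f.
  by rewrite nc_mul_nil mulr1.
by rewrite nc_mul_cons mulr0 add0r IH.
Qed.

Fact nc_mulDl : left_distributive nc_mul (@GRing.add (ncseries n)).
Proof. by move=> f g h; apply/funext => w; apply: nc_mul_addl. Qed.

Fact nc_mulDr : right_distributive nc_mul (@GRing.add (ncseries n)).
Proof.
move=> f g h; apply/funext => w; rewrite [RHS]/GRing.add /=.
by rewrite /nc_mul -big_split; apply: eq_bigr => k _; rewrite mulrDr.
Qed.

Fact nc_1_neq0 : nc_one != 0 :> ncseries n.
Proof. by apply/eqP => /(congr1 (fun f : ncseries n => f [::])). Qed.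

HB.instance Definition _ := GRing.Zmodule_isNzRing.Build (ncseries n)
  nc_mulA nc_mul1 nc_mulr1 nc_mulDl nc_mulDr nc_1_neq0.

Definition nc_unit : {pred ncseries n} :=
  fun f => `[< exists g, g * f = 1 /\ f * g = 1 >].

Definition nc_inv f : ncseries n := xget f [set g | g * f = 1 /\ f * g = 1].

Lemma nc_invP f : nc_unit f -> nc_inv f * f = 1 /\ f * nc_inv f = 1.
Proof. by move=> /asboolP exg; apply: (@xgetPex _ f) exg. Qed.

Fact nc_mulVr : {in nc_unit, left_inverse 1 nc_inv *%R}.
Proof. by move=> f /nc_invP[]. Qed.
Fact nc_mulrV : {in nc_unit, right_inverse 1 nc_inv *%R}.
Proof. by move=> f /nc_invP[]. Qed.
Fact nc_unitP f g : g * f = 1 /\ f * g = 1 -> nc_unit f.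
Proof. by move=> fg; apply/asboolP; exists g. Qed.
Fact nc_inv_out : {in [predC nc_unit], nc_inv =1 id}.
Proof.
move=> f /negP nuf; apply: xgetPN => g fg; apply: nuf.
exact: nc_unitP fg.
Qed.

HB.instance Definition _ := GRing.NzRing_hasMulInverse.Build (ncseries n)
  nc_mulVr nc_mulrV nc_unitP nc_inv_out.

Lemma nc_1DX_unit i : (1 + nc_var i : ncseries n) \is a GRing.unit.
Proof.
pose g : ncseries n := fun w => (-1) ^+ size w * (w == nseq (size w) i)%:R.
have gX x w : g (x :: w) = - (x == i)%:R * g w.
  rewrite /g /= eqseq_cons exprS; case: (x == i); rewrite /= ?mulr0 ?oppr0 ?mul0r //.
  by rewrite mulrA.
have mulE f h w : (f * h : ncseries n) w = nc_mul f h w by [].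
have oneE x : (fun v => (1 + nc_var i : ncseries n) (x :: v)) =
              (fun v => (x == i)%:R * nc_one v).
  apply/funext => v; rewrite [LHS]/GRing.add /= [X in X + _]/GRing.one /=.
  rewrite /nc_one /nc_var /= add0r eqseq_cons.
  by case: (x == i); rewrite ?mul1r ?mul0r.
have one0 : (1 + nc_var i : ncseries n) [::] = 1 by [].
apply/asboolP; exists g; split; apply/funext => w; rewrite mulE.
- elim: w => [|x w IH]; first by rewrite nc_mul_nil.
  have -> : (1 : ncseries n) (x :: w) = 0 by [].
  rewrite nc_mul_cons.
  under [X in nc_mul X _ _]eq_fun do rewrite gX.
  rewrite nc_mul_scale IH.
  have -> : g [::] = 1 by [].
  by rewrite mul1r (congr1 (fun f => f w) (oneE x)) mulNr subrr.
- case: w => [|x w]; first by rewrite nc_mul_nil.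
  have -> : (1 : ncseries n) (x :: w) = 0 by [].
  rewrite nc_mul_cons oneE nc_mul_scale one0 mul1r gX.
  by rewrite nc_mul1 mulNr addNr.
Qed.

Definition magnus_letter (x : 'I_n * bool) : ncseries n :=
  if x.2 then (1 + nc_var x.1)^-1 else 1 + nc_var x.1.

Definition magnus (a : freeGroup 'I_n) : ncseries n :=
  \prod_(x <- fgword a) magnus_letter x.

Lemma magnus_gen i : magnus (fg_gen i) = 1 + nc_var i.
Proof. by rewrite /magnus /= big_seq1. Qed.

Lemma magnusM a b : magnus (a * b)%g = magnus a * magnus b.
Proof.
rewrite /magnus /= big_reduce ?big_cat //.
by case=> i []; rewrite /magnus_letter /= ?mulVr ?mulrV ?nc_1DX_unit.
Qed.

End NcSeries.

Section Diagrams.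
Variables (R : realType) (n : nat).

Local Notation plane := (R * R)%type.

Definition det2 (u v : plane) : R := u.1 * v.2 - u.2 * v.1.

Definition sqnorm (u : plane) : R := u.1 ^+ 2 + u.2 ^+ 2.

(* The circles are R / Z: t stands for its class. *)
Definition same_point (s t : R) : Prop := exists m : int, t = s + m%:~R.

Definition same_site (x y : 'I_n * R) : Prop :=
  x.1 = y.1 /\ same_point x.2 y.2.

(* How a strand goes through a point: Plain away from crossings, Over and Under
   at classical crossings, Virt at virtual crossings. *)
Inductive passage := Plain | Over | Under | Virt.

Definition crosses (c : 'I_n -> R -> plane) (i : 'I_n) (s : R) (k : 'I_n)
    (t : R) : Prop :=
  c i s = c k t /\ ~ same_site (i, s) (k, t).

(* Finiteness follows from the other conditions by compactness. *)
Record vdiagram := VDiagram {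
  curve : 'I_n -> R -> plane;
  info : 'I_n -> R -> passage;
  curve_periodic : forall i t, curve i (t + 1) = curve i t;
  curve_derivable : forall i t, derivable (curve i) t 1;
  curve_C1 : forall i, continuous (derive1 (curve i));
  curve_immersed : forall i t, derive1 (curve i) t != 0;
  curve_transverse : forall i s k t, crosses curve i s k t ->
    det2 (derive1 (curve i) s) (derive1 (curve k) t) != 0;
  curve_double : forall i s k t l u,
    crosses curve i s k t -> crosses curve i s l u -> same_site (k, t) (l, u);
  curve_finite : forall i,
    finite_set [set s | 0 <= s < 1 /\ exists k t, crosses curve i s k t];
  info_periodic : forall i t, info i (t + 1) = info i t;
  info_plain : forall i s,
    info i s <> Plain <-> exists k t, crosses curve i s k t;
  info_crossing : forall i s k t, crosses curve i s k t ->
    [\/ info i s = Over /\ info k t = Under,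
        info i s = Under /\ info k t = Over |
        info i s = Virt /\ info k t = Virt]
}.

Definition tangent (D : vdiagram) (i : 'I_n) (t : R) : plane :=
  derive1 (curve D i) t.

(* Usual sign of a crossing of the over-strand x with the under-strand y. *)
Definition crossing_sign (D : vdiagram) (x y : 'I_n * R) : int :=
  sgz (det2 (tangent D x.1 x.2) (tangent D y.1 y.2)).

Definition plane_diff (f : plane -> plane) (x v : plane) : plane := 'd f x v.

Definition plane_C1 (f : plane -> plane) : Prop :=
  (forall x, differentiable f x) /\
  (forall v : plane, continuous (fun x => plane_diff f x v)).

Definition plane_diffeo (f : plane -> plane) : Prop :=
  plane_C1 f /\ exists g, [/\ plane_C1 g, cancel f g & cancel g f].

(* Only the times in [0, 1] matter; an isotopy over [0, 1] is extended to R by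
   making it stationary outside [0, 1]. *)
Definition plane_isotopy (H : R -> plane -> plane) : Prop :=
  [/\ forall t, plane_diffeo (H t),
      H 0 =1 id,
      continuous (fun tx : R * plane => H tx.1 tx.2) &
      forall v : plane, continuous (fun tx : R * plane => plane_diff (H tx.1) tx.2 v)].

(* Orientation-preserving diffeomorphisms of R / Z, lifted to R. *)
Definition circle_reparam (phi : R -> R) : Prop :=
  [/\ forall t, derivable phi t 1, continuous (derive1 phi),
      forall t, 0 < derive1 phi t & forall t, phi (t + 1) = phi t + 1].

(* A diagram is the image of the immersion, whence the reparametrization. *)
Definition isotopic (D D' : vdiagram) : Prop :=
  exists H : R -> plane -> plane, exists phi : 'I_n -> R -> R,
    [/\ plane_isotopy H,
        forall i, circle_reparam (phi i),
        forall i t, curve D' i (phi i t) = H 1 (curve D i t) &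
        forall i t, info D' i (phi i t) = info D i t].

Record strand := Strand { strand_comp : 'I_n; src : R; tgt : R }.

Definition on_strand (S : strand) (i : 'I_n) (t : R) : Prop :=
  strand_comp S = i /\ exists m : int, src S <= t + m%:~R <= tgt S.

Definition inside_strand (S : strand) (i : 'I_n) (t : R) : Prop :=
  strand_comp S = i /\ exists m : int, src S < t + m%:~R < tgt S.

(* f maps a closed disc of the plane onto the unit disc; D meets the former in
   the strands S j, which are properly embedded or immersed arcs. *)
Definition disc_meets (f : plane -> plane) (D : vdiagram) (k : nat)
    (S : 'I_k -> strand) : Prop :=
  (forall i t, sqnorm (f (curve D i t)) <= 1 <-> exists j, on_strand (S j) i t) /\
  (forall i t, sqnorm (f (curve D i t)) < 1 <->
               exists j, inside_strand (S j) i t).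

(* D and D' coincide outside of a disc, and inside it each of them consists of k
   strands, with the same endpoints. *)
Definition local_change (D D' : vdiagram) (k : nat) (S : 'I_k -> strand) : Prop :=
  [/\ forall j, src (S j) < tgt (S j) < src (S j) + 1,
      forall j l i t, on_strand (S j) i t -> on_strand (S l) i t -> j = l,
      exists2 f, plane_diffeo f & disc_meets f D S /\ disc_meets f D' S &
      forall i t, ~ (exists j, inside_strand (S j) i t) ->
        curve D' i t = curve D i t /\ info D' i t = info D i t].

Definition no_crossing (D : vdiagram) (S : strand) : Prop :=
  forall t, src S <= t <= tgt S -> info D (strand_comp S) t = Plain.

(* R1 and V1: an arc without crossings is replaced by a kink. *)
Definition kink_move (virtual : bool) (D D' : vdiagram) : Prop :=
  exists S : strand,
  [/\ local_change D D' (fun _ : 'I_1 => S),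
      no_crossing D S &
      exists s t,
      [/\ src S < s /\ s < t < tgt S,
          curve D' (strand_comp S) s = curve D' (strand_comp S) t,
          forall u, src S <= u <= tgt S -> info D' (strand_comp S) u <> Plain ->
            u = s \/ u = t &
          info D' (strand_comp S) s = Virt <-> virtual]].

(* R2 and V2: two disjoint arcs are replaced by two arcs which meet twice.
   Planarity forces the two signs to be opposite; this is recorded as part of
   the picture. *)
Definition bigon_move (virtual : bool) (D D' : vdiagram) : Prop :=
  exists S0 S1 : strand,
  let S := (fun j : 'I_2 => if j == ord0 then S0 else S1) in
  [/\ local_change D D' S,
      no_crossing D S0 /\ no_crossing D S1 &
      exists s0 t0 s1 t1 : R,
      [/\ [/\ src S0 < s0 < tgt S0, src S0 < t0 < tgt S0,
              src S1 < s1 < tgt S1 & src S1 < t1 < tgt S1],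
          [/\ s0 <> t0, s1 <> t1,
              curve D' (strand_comp S0) s0 = curve D' (strand_comp S1) s1 &
              curve D' (strand_comp S0) t0 = curve D' (strand_comp S1) t1],
          (forall u, src S0 <= u <= tgt S0 -> info D' (strand_comp S0) u <> Plain ->
             u = s0 \/ u = t0) /\
          (forall u, src S1 <= u <= tgt S1 -> info D' (strand_comp S1) u <> Plain ->
             u = s1 \/ u = t1),
          crossing_sign D' (strand_comp S0, s0) (strand_comp S1, s1) =
            - crossing_sign D' (strand_comp S0, t0) (strand_comp S1, t1) &
          let kind := if virtual then Virt else Over in
          info D' (strand_comp S0) s0 = kind /\ info D' (strand_comp S0) t0 = kind]].

(* Three strands, any two of which cross exactly once: x j k is the parameter
   on the strand j of its crossing with the strand k. *)
Definition triangle (D : vdiagram) (S : 'I_3 -> strand) (x : 'I_3 -> 'I_3 -> R)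
    : Prop :=
  (forall j k, j <> k ->
     src (S j) < x j k < tgt (S j) /\
     curve D (strand_comp (S j)) (x j k) = curve D (strand_comp (S k)) (x k j)) /\
  (forall j u, src (S j) <= u <= tgt (S j) -> info D (strand_comp (S j)) u <> Plain ->
     exists2 k, j <> k & u = x j k).

(* R3 and its versions: along each strand the two crossings are exchanged.
   The strands 0, 1, 2 are such that 0 passes through its crossings with 1 and 2
   as p01 and p02, and 1 passes through its crossing with 2 as p12.
   The signs are unchanged since the endpoints are; this is recorded as part of
   the picture. *)
Definition triangle_move (p01 p02 p12 : passage) (D D' : vdiagram) : Prop :=
  exists S : 'I_3 -> strand,
  local_change D D' S /\
  exists x x' : 'I_3 -> 'I_3 -> R,
  [/\ triangle D S x, triangle D' S x',
      forall j k l, j <> k -> j <> l -> k <> l ->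
        x j k < x j l <-> x' j l < x' j k,
      forall j k, j <> k ->
        info D' (strand_comp (S j)) (x' j k) = info D (strand_comp (S j)) (x j k) /\
        crossing_sign D' (strand_comp (S j), x' j k) (strand_comp (S k), x' k j) =
          crossing_sign D (strand_comp (S j), x j k) (strand_comp (S k), x k j) &
      let o0 := @Ordinal 3 0 isT in
      let o1 := @Ordinal 3 1 isT in
      let o2 := @Ordinal 3 2 isT in
      [/\ info D (strand_comp (S o0)) (x o0 o1) = p01,
          info D (strand_comp (S o0)) (x o0 o2) = p02 &
          info D (strand_comp (S o1)) (x o1 o2) = p12]].

Inductive welded_move (D D' : vdiagram) : Prop :=
| move_R1 of kink_move false D D'
| move_R2 of bigon_move false D D'
| move_R3 of triangle_move Over Over Over D D'
| move_V1 of kink_move true D D'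
| move_V2 of bigon_move true D D'
| move_V3 of triangle_move Virt Virt Virt D D'
| move_V4 of triangle_move Virt Virt Over D D'
| move_OC of triangle_move Over Over Virt D D'.

Definition welded_equivalent : vdiagram -> vdiagram -> Prop :=
  clos_refl_sym_trans vdiagram (fun D D' => isotopic D D' \/ welded_move D D').

Definition base_point_system (D : vdiagram) (p : 'I_n -> R) : Prop :=
  forall i, info D i (p i) = Plain.

Section Milnor.
Variables (D : vdiagram) (p : 'I_n -> R).

(* The under-crossings of the component i, in the order in which they are met
   from the base point; m_i is the length of this list. *)
Definition unders (i : 'I_n) : seq R :=
  sort <=%R (finmap.enum_fset
    (fset_set [set t | p i < t < p i + 1 /\ info D i t = Under])).

(* Indices are shifted by one: Tagged _ j, with j in {0, ..., m_i}, is the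
   arc a_(i,j+1), and nth 0 (unders i) j separates it from a_(i,j+2). *)
Definition diagram_arc : Type := {i : 'I_n & 'I_(size (unders i)).+1}.

Definition mk_arc (i : 'I_n) (j : nat) : diagram_arc :=
  Tagged (fun i => 'I_(size (unders i)).+1) (inord j : 'I_(size (unders i)).+1).

(* The arc containing the point t, p_i < t < p_i + 1, when this point is not an
   under-crossing. *)
Definition arc_at (i : 'I_n) (t : R) : diagram_arc :=
  mk_arc i (count (fun s => s < t) (unders i)).

(* The passage over the under-crossing s of the component i. *)
Definition over_site (i : 'I_n) (s : R) : 'I_n * R :=
  xget (i, s) [set x | [/\ p x.1 < x.2 < p x.1 + 1,
                          curve D x.1 x.2 = curve D i s & info D x.1 x.2 = Over]].

(* u_(i,j+1), epsilon_(i,j+1) and v_(i,j) *)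
Definition over_arc (i : 'I_n) (j : nat) : diagram_arc :=
  let x := over_site i (nth 0 (unders i) j) in arc_at x.1 x.2.

Definition under_sign (i : 'I_n) (j : nat) : int :=
  let s := nth 0 (unders i) j in crossing_sign D (over_site i s) (i, s).

Definition partial_longitude (i : 'I_n) (j : nat) : freeGroup diagram_arc :=
  (\prod_(k < j) expgz (fg_gen (over_arc i k)) (under_sign i k))%g.

(* eta_gen k is eta_(k+1) on the arcs; the two clauses of the inductive
   definition agree since v_(i,0) = 1. *)
Fixpoint eta_gen (k : nat) (a : diagram_arc) : freeGroup 'I_n :=
  if k is k'.+1 then
    let v := fg_lift (eta_gen k') (partial_longitude (tag a) (tagged a)) in
    (v^-1 * fg_gen (tag a) * v)%g
  else fg_gen (tag a).

Definition eta (q : nat) : freeGroup diagram_arc -> freeGroup 'I_n :=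
  fg_lift (eta_gen q.-1).

Definition self_writhe (i : 'I_n) : int :=
  \sum_(j < size (unders i) | (over_site i (nth 0 (unders i) j)).1 == i)
    under_sign i j.

Definition preferred_longitude (i : 'I_n) : freeGroup diagram_arc :=
  (expgz (fg_gen (mk_arc i 0)) (- self_writhe i)
   * partial_longitude i (size (unders i)))%g.

(* mu(j_1 ... j_s i), computed with q = s + 1. *)
Definition milnor_number (J : seq 'I_n) (i : 'I_n) : int :=
  magnus (eta (size J).+1 (preferred_longitude i)) J.

(* Only used for sequences of length at least 2. *)
Definition mu (I : seq 'I_n) : int :=
  if I is x :: I' then milnor_number (belast x I') (last x I') else 0.

(* mask b I is I with the indices at the positions where b is false removed,
   and rot k runs over its cyclic permutations. *)
Definition Delta (I : seq 'I_n) : nat :=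
  \big[gcdn/0%N]_(b : (size I).-tuple bool | (2 <= size (mask b I) < size I)%N)
    \big[gcdn/0%N]_(k < size (mask b I)) `|mu (rot k (mask b I))|%N.

End Milnor.

End Diagrams.

(* Main.v *)
(** A colouring of D in a group G consists of meridians m_i, commuting monodromies
    lam_i, and locally constant functions h i on the components whose jumps at the
    under-crossings are the Wirtinger relations.  Every welded move carries the
    colourings with data (m, lam) to colourings with data (m, m^e lam), where the
    integers e_i do not depend on G.  For R3 this needs a sign relation between the
    crossings of the moved strand, read off from winding numbers of
    (s, t) |-> G s - H t around rectangles.

    For I = J i let G be the unitriangular matrices over Z or Z/d, and let m_k have
    entries 1 above the diagonal at the places where J has the index k.  If the Milnor
    numbers of all proper cyclic subsequences of I vanish in this ring, then the
    preferred longitudes commute with the meridians, so the Milnor data is a colouring.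
    Transferred to D', it is again Milnor data up to conjugation, since the recursion
    for eta_q has a unique fixed point in a nilpotent group, and the Milnor number of I
    is the corner entry of the longitude on both sides.  The equality of the
    indeterminacies follows by induction on the length of I. *)
Require Import Defs.
From HB Require Import structures.
From mathcomp Require Import all_boot all_order all_algebra.
From mathcomp Require Import all_classical all_reals all_analysis.
From mathcomp Require Import ring lra zify.

Set Implicit Arguments.
Unset Strict Implicit.
Unset Printing Implicit Defensive.

Import Order.TTheory GRing.Theory Num.Theory.
Import numFieldNormedType.Exports.

Local Open Scope classical_set_scope.
Local Open Scope ring_scope.

(** * Winding numbers and crossings of plane curves *)

Section Turning.
Variable R : realType.
Local Notation plane := (R * R)%type.
Implicit Types (u v x nu : plane) (w : R).

(** The group of the diagram is never formed: colourability in all groups G at once takes the place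
    of an isomorphism of groups with peripheral structure. Since h is defined on the whole line,
    base points enter only when a colouring is read off, and moving them conjugates the data. The
    integers e_i need not be matched with the kinks that produce them. In the abelian group of 2 by
    2 unitriangular matrices both diagrams have mu(ii) = 0, which forces e_i to be the change of the
    self-writhe of component i; the preferred longitudes absorb exactly this. The generators found
    for D' are conjugates of the elementary ones by unknown matrices. Their entries beyond the first
    superdiagonal skip letters of J, so the corner entry is a single Milnor number of D' only when
    the numbers of shorter sequences vanish for D' as well. Hence the congruence assumes vanishing
    on both sides, and comparing the indeterminacies cannot be separated from comparing the
    numbers. *)

Definition dot2 u v : R := u.1 * v.1 + u.2 * v.2.

(** A relation instead of an angle function: [w] is an unreduced real number, so that turns add up
    and full turns are not lost. *)
Definition turns u v w : Prop := exists2 r : R, 0 < r &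
  v = (r * (cos w * u.1 - sin w * u.2), r * (sin w * u.1 + cos w * u.2)).

Lemma turns_trans u v x w w' : turns u v w -> turns v x w' -> turns u x (w + w').
Proof.
move=> [r r0 ->] [s s0 ->] /=; exists (s * r); first exact: mulr_gt0.
rewrite cosD sinD; congr pair; ring.
Qed.

Lemma turns_sym u v w : turns u v w -> turns v u (- w).
Proof.
move=> [r r0 ->] /=; exists r^-1; rewrite ?invr_gt0 //.
have r0' : r != 0 by rewrite gt_eqF.
have c2 : cos w ^+ 2 = 1 - sin w ^+ 2 by rewrite -(cos2Dsin2 w); ring.
rewrite cosN sinN /=; case: u => a b /=; congr pair.
  transitivity ((cos w ^+ 2 + sin w ^+ 2) * a); last by field.
  by rewrite cos2Dsin2 mul1r.
transitivity ((cos w ^+ 2 + sin w ^+ 2) * b); last by field.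
by rewrite cos2Dsin2 mul1r.
Qed.

Lemma sqnorm_gt0 u : u != 0 -> 0 < sqnorm u.
Proof.
move=> u0; rewrite lt_def /sqnorm addr_ge0 ?sqr_ge0 // andbT.
apply: contra u0; rewrite paddr_eq0 ?sqr_ge0 // !sqrf_eq0.
by case: u => a b /= /andP[/eqP-> /eqP->].
Qed.

Lemma sqnorm_ge0 u : 0 <= sqnorm u.
Proof. by rewrite addr_ge0 ?sqr_ge0. Qed.

Lemma turns_det u v w : turns u v w ->
  exists2 r, 0 < r & det2 u v = r * sqnorm u * sin w /\
                     dot2 u v = r * sqnorm u * cos w.
Proof.
move=> [r r0 ->]; exists r => //; rewrite /det2 /dot2 /sqnorm /=.
by split; ring.
Qed.

Lemma cos1_small w : cos w = 1 -> `|w| < pi *+ 2 -> w = 0.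
Proof.
move=> cw w2; suff : `|w| / 2 = 0 by move=> /eqP; rewrite mulf_eq0 normr_eq0 invr_eq0 pnatr_eq0 orbF => /eqP.
apply/eqP; rewrite eq_le divr_ge0 // andbT leNgt; apply/negP => w0.
have w1 : `|w| / 2 < pi by rewrite ltr_pdivrMr // mulr_natr.
have := @sin_gt0_pi R (`|w| / 2); rewrite w0 w1 => /(_ isT).
have: cos (`|w| / 2 *+ 2) = 1 by rewrite -mulr_natr divfK ?pnatr_eq0 // cos_norm.
rewrite cos_mulr2n cos2sin2 => c s; have := exprn_gt0 2 s; lra.
Qed.

Lemma turns_uniq u v w w' : u != 0 -> turns u v w -> turns u v w' ->
  `|w - w'| < pi *+ 2 -> w = w'.
Proof.
move=> /sqnorm_gt0 u0 uv uv' ww.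
have [r r0 [ds cs]] := turns_det (turns_trans (turns_sym uv') uv).
apply/eqP; rewrite -subr_eq0; apply/eqP.
move: (turns_trans uv (turns_sym uv')) => /turns_det[s s0 []].
rewrite {1}/det2 mulrC subrr => /esym/eqP; rewrite mulf_eq0 gt_eqF ?mulr_gt0 //= => /eqP sw.
move=> dw; apply: cos1_small => //.
have : cos (w - w') ^+ 2 = 1 by rewrite -[RHS](cos2Dsin2 (w - w')) sw expr0n addr0.
have : 0 < cos (w - w').
  have : 0 < dot2 u u by exact: u0.
  by rewrite dw pmulr_rgt0 // mulr_gt0.
by move=> c0 /eqP; rewrite sqrp_eq1 ?ltW // => /eqP.
Qed.

(** The scalar product gives the angle up to sign through [acos], and [det2 u v] gives the sign. *)
Lemma turns_ex u v : u != 0 -> v != 0 -> exists2 w, turns u v w & - pi < w <= pi.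
Proof.
move=> u0 v0; have U := sqnorm_gt0 u0; have V := sqnorm_gt0 v0.
pose N := Num.sqrt (sqnorm u * sqnorm v).
have N0 : 0 < N by rewrite sqrtr_gt0 mulr_gt0.
have N2 : N ^+ 2 = sqnorm u * sqnorm v by rewrite sqr_sqrtr // ltW // mulr_gt0.
pose c := dot2 u v / N; pose s := det2 u v / N.
have Nn : N != 0 by rewrite gt_eqF.
have cs : c ^+ 2 + s ^+ 2 = 1.
  rewrite /c /s !expr_div_n -mulrDl N2.
  suff -> : dot2 u v ^+ 2 + det2 u v ^+ 2 = sqnorm u * sqnorm v.
    by rewrite divff // gt_eqF // mulr_gt0.
  by rewrite /dot2 /det2 /sqnorm; ring.
have c1 : -1 <= c <= 1 by have := sqr_ge0 s; nra.
have ac := acosK; have {}ac := ac _ c; rewrite in_itv /= c1 in ac.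
have sa : sin (acos c) = `|s|.
  by rewrite sin_acos // -sqrtr_sqr; congr Num.sqrt; rewrite -cs; ring.
have main w : cos w = c -> sin w = s -> turns u v w.
  move=> cw sw; exists (N / sqnorm u); first exact: divr_gt0.
  rewrite cw sw /c /s /dot2 /det2; have Un : sqnorm u != 0 by rewrite gt_eqF.
  rewrite /sqnorm in Un *; rewrite [LHS]surjective_pairing.
  by congr pair; field; rewrite Un Nn.
have [s0|s0] := leP 0 s.
  exists (acos c); first by apply: main; rewrite ?ac // sa ger0_norm.
  by rewrite acos_lepi // andbT; have := acos_ge0 c1; have := pi_gt0 R; lra.
exists (- acos c).
  by apply: main; rewrite ?cosN ?ac // sinN sa ltr0_norm // opprK.
have : acos c < pi.
  apply: acos_ltpi; move: c1 => /andP[c1 ->]; rewrite andbT lt_neqAle c1 andbT.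
  apply/negP => /eqP c'; move: cs; rewrite -c'; nra.
by have := acos_ge0 c1; lra.
Qed.

Lemma turns_half nu u w : turns nu u w -> 0 < dot2 nu u -> `|w| <= pi ->
  `|w| < pi / 2.
Proof.
move=> /turns_det[r r0 [_ ->]] h w1; rewrite ltNge; apply/negP => w2.
suff : cos w <= 0.
  move=> c0; move: h; rewrite ltNge => /negP; apply.
  by rewrite mulr_ge0_le0 // mulr_ge0 ?sqnorm_ge0 // ltW.
rewrite -cos_norm -[`|w|](subrK (pi / 2)) cosDpihalf oppr_le0.
by apply: sin_ge0_pi; have := pi_gt0 R; lra.
Qed.

Lemma dot_neq0 nu u : 0 < dot2 nu u -> u != 0.
Proof. by apply: contraTneq => ->; rewrite /dot2 !mulr0 addr0 ltxx. Qed.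
Lemma dot_neq0l nu u : 0 < dot2 nu u -> nu != 0.
Proof. by apply: contraTneq => ->; rewrite /dot2 !mul0r addr0 ltxx. Qed.

Lemma half_turn nu u : 0 < dot2 nu u ->
  exists2 th, turns nu u th & `|th| < pi / 2.
Proof.
move=> h; have [w uw /andP[w1 w2]] := turns_ex (dot_neq0l h) (dot_neq0 h).
exists w => //; apply: turns_half uw h _; rewrite ler_norml w2 andbT; exact: ltW.
Qed.

(** In an open half-plane the angle from the normal [nu] is a consistent choice of argument; a turn
    smaller than pi is a difference of its values. *)
Lemma half_diff nu u v th th' w : 0 < dot2 nu u -> turns nu u th -> turns nu v th' ->
  `|th| < pi / 2 -> `|th'| < pi / 2 -> turns u v w -> `|w| < pi -> w = th' - th.
Proof.
move=> h ut vt t1 t2 uv w1; apply: turns_uniq uv _ _; first exact: dot_neq0 h.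
  by rewrite addrC; apply: turns_trans (turns_sym ut) vt.
move: t1 t2 w1; rewrite !ltr_norml -mulr_natr.
by move=> /andP[? ?] /andP[? ?] /andP[? ?]; apply/andP; split; lra.
Qed.

Lemma turns_sin_gt0 u v w : turns u v w -> 0 < det2 u v -> -pi <= w <= pi -> 0 < w < pi.
Proof.
move=> /turns_det[r r0 [-> _]] h w1.
have s0 : 0 < sin w.
  rewrite -(@pmulr_rgt0 _ (r * sqnorm u)) // lt_def [X in _ && X]mulr_ge0 ?(ltW r0) ?sqnorm_ge0 ?andbT //.
  by apply: contraTneq h => ->; rewrite mul0r ltxx.
have w0 : 0 < w.
  rewrite ltNge; apply/negP => wl.
  have : 0 <= sin (- w) by apply: sin_ge0_pi; lra.
  by rewrite sinN; lra.
rewrite w0 /= lt_neqAle; move: w1 => /andP[_ ->]; rewrite andbT.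
by apply: contraTneq s0 => ->; rewrite sinpi ltxx.
Qed.

End Turning.

(** * Total turn of a plane path about the origin *)

Section Winding.
Variable R : realType.
Local Notation plane := (R * R)%type.

(** Real induction: the supremum of the endpoints reached from [a] is itself reached, and cannot lie
    below [b]. This stands in for the compactness of the interval whenever a property can be
    concatenated. *)
Lemma creep (P : R -> R -> Prop) a b : a <= b ->
  (forall x y z, a <= x <= y -> y <= z <= b -> P x y -> P y z -> P x z) ->
  (forall x, a <= x <= b -> exists2 e, 0 < e & forall u v,
     a <= u -> v <= b -> x - e < u <= x -> x <= v < x + e -> P u v) ->
  P a b.
Proof.
move=> ab cat loc; pose S := [set x | a <= x <= b /\ P a x].
have Sa : S a.
  split; first by rewrite lexx.
  by have [|e e0] := loc a; rewrite ?lexx ?ab //; apply; rewrite ?lexx ?ltrDl ?gtrBl ?e0.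
have hS : has_sup S by split; [exists a | exists b => x [/andP[]]].
set c := sup S.
have ac : a <= c by apply: sup_upper_bound.
have cb : c <= b by apply: ge_sup => [|x [/andP[]]] //; exists a.
have [|e e0 He] := loc c; first by rewrite ac.
have [y [/andP[ay yb] Py] yc] := sup_adherent e0 hS.
have yc' : y <= c by apply: sup_upper_bound => //; split=> //; rewrite ay.
have Pc : P a c.
  apply: (cat _ y) => //; rewrite ?lexx ?ay ?yc' ?cb //.
  by apply: He; rewrite ?lexx ?ltrDl ?yc' ?yc ?e0.
have [->//|cb'] := eqVneq b c; have {cb'}cb' : c < b by rewrite lt_neqAle eq_sym cb'.
pose v := Num.min b (c + e / 2).
have cv : c < v by rewrite lt_min cb' ltrDl divr_gt0.
have vb : v <= b by rewrite ge_min lexx.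
have : v <= c; last by rewrite leNgt cv.
apply: sup_upper_bound => //; split; first by rewrite vb (le_trans ac) ?ltW.
apply: (cat _ c) => //; rewrite ?lexx ?ac ?vb ?(ltW cv) //.
apply: He => //; rewrite ?lexx ?ltrBlDr ?ltrDl ?e0 ?(ltW cv) //.
by rewrite gt_min ltrD2l; apply/orP; right; lra.
Qed.

(* [wind c a b w]: the path c avoids the origin on [a, b] and turns by w about it. *)
Inductive wind (c : R -> plane) : R -> R -> R -> Prop :=
| wind_half a b w nu : a <= b ->
    (forall t, a <= t <= b -> 0 < dot2 nu (c t)) ->
    turns (c a) (c b) w -> `|w| < pi -> wind c a b w
| wind_cat a m b w w' : wind c a m w -> wind c m b w' -> wind c a b (w + w').

Section Path.
Variable c : R -> plane.

Lemma wind_le a b w : wind c a b w -> a <= b.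
Proof. by elim=> // {a b w} a m b w w' _ am _; apply: le_trans. Qed.

Lemma half_wind nu a b th th' : a <= b ->
  (forall t, a <= t <= b -> 0 < dot2 nu (c t)) ->
  turns nu (c a) th -> turns nu (c b) th' -> `|th| < pi / 2 -> `|th'| < pi / 2 ->
  wind c a b (th' - th).
Proof.
move=> ab h ta tb t1 t2; apply: (wind_half ab h).
  by rewrite addrC; apply: turns_trans (turns_sym ta) tb.
by move: t1 t2; rewrite !ltr_norml => /andP[? ?] /andP[? ?]; apply/andP; split; lra.
Qed.

(** However a derivation cuts the path, the turns of its pieces are differences of the angle from
    [nu], and they telescope. *)
Lemma wind_halfE nu a b w th th' :
  wind c a b w -> (forall t, a <= t <= b -> 0 < dot2 nu (c t)) ->
  turns nu (c a) th -> turns nu (c b) th' -> `|th| < pi / 2 -> `|th'| < pi / 2 ->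
  w = th' - th.
Proof.
move=> W; elim: W th th' => {a b w} [a b w _ ab _ tw w1|a m b w w' wa IHa wb IHb] th th' h ta tb t1 t2.
  by apply: (half_diff _ ta tb) => //; apply: h; rewrite lexx ab.
have [tm hm tm1] := half_turn (h m (introT andP (conj (wind_le wa) (wind_le wb)))).
rewrite (IHa th tm) // ?(IHb tm th') //; first by ring.
- by move=> t /andP[mt tb']; apply: h; rewrite tb' (le_trans (wind_le wa) mt).
- by move=> t /andP[mt tb']; apply: h; rewrite mt (le_trans tb' (wind_le wb)).
Qed.

Lemma wind_split a b w m : wind c a b w -> a <= m <= b ->
  exists w1 w2, [/\ wind c a m w1, wind c m b w2 & w = w1 + w2].
Proof.
move=> W; elim: W m => {a b w} [a b w nu ab h tw w1|a k b w w' wa IHa wb IHb] m /andP[am mb].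
  have [ta ha ta1] := half_turn (h a (introT andP (conj (lexx a) ab))).
  have [tm hm tm1] := half_turn (h m (introT andP (conj am mb))).
  have [tb hb tb1] := half_turn (h b (introT andP (conj ab (lexx b)))).
  exists (tm - ta), (tb - tm); split.
  - by apply: (half_wind am _ ha hm) => // t /andP[at' tm']; apply: h; rewrite at' (le_trans tm').
  - by apply: (half_wind mb _ hm hb) => // t /andP[mt tb']; apply: h; rewrite tb' (le_trans am).
  - rewrite (half_diff _ ha hb _ _ tw) //; first by ring.
    by apply: h; rewrite lexx.
have [mk|/ltW km] := leP m k.
  have [|w1 [w2 [h1 h2 ->]]] := IHa m; first by rewrite am.
  by exists w1, (w2 + w'); split; rewrite ?addrA //; apply: wind_cat h2 wb.
have [|w1 [w2 [h1 h2 ->]]] := IHb m; first by rewrite km.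
by exists (w + w1), w2; split; rewrite ?addrA //; apply: wind_cat wa h1.
Qed.

(** The second derivation is cut at the division points of the first, which reduces to pieces inside
    a half-plane. *)
Lemma wind_uniq a b w w' : wind c a b w -> wind c a b w' -> w = w'.
Proof.
move=> W; elim: W w' => {a b w} [a b w nu ab h tw w1|a m b w1 w2 wa IHa wb IHb] w'.
  have [ta ha ta1] := half_turn (h a (introT andP (conj (lexx a) ab))).
  have [tb hb tb1] := half_turn (h b (introT andP (conj ab (lexx b)))).
  move=> W; rewrite (wind_halfE W h ha hb) //.
  by apply: half_diff _ ha hb _ _ tw _ => //; apply: h; rewrite lexx.
move=> /wind_split-/(_ m)[|w1' [w2' [h1 h2 ->]]].
  by rewrite (wind_le wa) (wind_le wb).
by rewrite (IHa _ h1) (IHb _ h2).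
Qed.

Lemma wind_turns a b w : wind c a b w -> turns (c a) (c b) w.
Proof. by elim=> // {a b w} a m b w w' _ ? _ ?; apply: turns_trans; eassumption. Qed.

End Path.

Lemma dot2_cont (nu : plane) (c : R -> plane) : continuous c ->
  continuous (fun t => dot2 nu (c t)).
Proof.
move=> cc t.
have c1 : {for t, continuous (fun t => (c t).1)}.
  by apply: (continuous_comp (cc t)); exact: cvg_fst.
have c2 : {for t, continuous (fun t => (c t).2)}.
  by apply: (continuous_comp (cc t)); exact: cvg_snd.
by apply: cvgD; apply: cvgM; (try exact: cvg_cst).
Qed.

Lemma gt0_near (f : R -> R) x : {for x, continuous f} -> 0 < f x ->
  exists2 e, 0 < e & forall u, `|u - x| < e -> 0 < f u.
Proof.
move=> fc fx; have := cvgr_gt _ fc _ fx.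
move=> [e /= e0 H]; exists e => // u ux; apply: H.
by rewrite /ball_ /= distrC.
Qed.

Lemma wind_ex (c : R -> plane) a b : continuous c -> a <= b ->
  (forall t, a <= t <= b -> c t != 0) -> exists w, wind c a b w.
Proof.
move=> cc ab c0; apply: (creep (P := fun a b => exists w, wind c a b w)) ab _ _.
  by move=> x y z _ _ [w1 h1] [w2 h2]; exists (w1 + w2); apply: wind_cat h1 h2.
move=> x xab.
have [e e0 H] := gt0_near (@dot2_cont (c x) c cc x) (sqnorm_gt0 (c0 x xab)).
exists e => // u v _ _ /andP[u1 u2] /andP[v1 v2].
have h t : u <= t <= v -> 0 < dot2 (c x) (c t).
  by move=> /andP[ut tv]; apply: H; rewrite ltr_norml; apply/andP; split; lra.
have uv := le_trans u2 v1.
have [ta ha ta1] := half_turn (h u (introT andP (conj (lexx u) uv))).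
have [tb hb tb1] := half_turn (h v (introT andP (conj uv (lexx v)))).
by exists (tb - ta); apply: half_wind uv h ha hb ta1 tb1.
Qed.

(* The total turn of (s, t) |-> G s - H t around the rectangle [a, b] x [c, d]. *)
Definition boundary (G H : R -> plane) a b c d W : Prop := exists w1 w2 w3 w4,
  [/\ wind (fun s => G s - H c) a b w1, wind (fun t => G b - H t) c d w2,
      wind (fun s => G s - H d) a b w3, wind (fun t => G a - H t) c d w4 &
      W = w1 + w2 - w3 - w4].

Section Rectangle.
Variables G H : R -> plane.

(** The common side is counted with opposite signs, and its two turns are equal by [wind_uniq]. *)
Lemma boundary_cats a m b c d W W' : boundary G H a m c d W ->
  boundary G H m b c d W' -> boundary G H a b c d (W + W').
Proof.
move=> [w1 [w2 [w3 [w4 [h1 h2 h3 h4 ->]]]]] [v1 [v2 [v3 [v4 [k1 k2 k3 k4 ->]]]]].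
exists (w1 + v1), v2, (w3 + v3), w4; split=> //; try by apply: wind_cat; eassumption.
by rewrite (wind_uniq k4 h2); ring.
Qed.

Lemma boundary_catt a b c m d W W' : boundary G H a b c m W ->
  boundary G H a b m d W' -> boundary G H a b c d (W + W').
Proof.
move=> [w1 [w2 [w3 [w4 [h1 h2 h3 h4 ->]]]]] [v1 [v2 [v3 [v4 [k1 k2 k3 k4 ->]]]]].
exists w1, (w2 + v2), v3, (w4 + v4); split=> //; try by apply: wind_cat; eassumption.
by rewrite (wind_uniq k1 h3); ring.
Qed.

Lemma boundary_half nu a b c d : a <= b -> c <= d ->
  (forall s t, a <= s <= b -> c <= t <= d -> 0 < dot2 nu (G s - H t)) ->
  boundary G H a b c d 0.
Proof.
move=> ab cd h.
have aa : a <= a <= b by rewrite lexx.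
have bb : a <= b <= b by rewrite lexx ab.
have cc : c <= c <= d by rewrite lexx.
have dd : c <= d <= d by rewrite lexx cd.
have [tac hac nac] := half_turn (h _ _ aa cc).
have [tad had nad] := half_turn (h _ _ aa dd).
have [tbc hbc nbc] := half_turn (h _ _ bb cc).
have [tbd hbd nbd] := half_turn (h _ _ bb dd).
exists (tbc - tac), (tbd - tbc), (tbd - tad), (tad - tac); split; last by ring.
- by apply: (@half_wind _ nu) => // s sab; apply: h.
- by apply: (@half_wind (fun t => G b - H t) nu) => // s sab; apply: h.
- by apply: (@half_wind (fun t => G t - H d) nu) => // s sab; apply: h.
- by apply: (@half_wind (fun t => G a - H t) nu) => // s sab; apply: h.
Qed.

Hypotheses (Gc : continuous G) (Hc : continuous H).

Lemma dot2B nu (u v : plane) : dot2 nu (u - v) = dot2 nu u - dot2 nu v.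
Proof. by rewrite /dot2 /=; ring. Qed.

(** A tube argument with [creep] used twice: near a fixed [s0], small rectangles are joined along
    [t] into a strip of positive width, and the strips are joined along [s]. Each small rectangle is
    mapped into a half-plane. *)
Lemma boundary0 a b c d : a <= b -> c <= d ->
  (forall s t, a <= s <= b -> c <= t <= d -> G s != H t) ->
  boundary G H a b c d 0.
Proof.
move=> ab cd GH; apply: (creep (P := fun a b => boundary G H a b c d 0)) ab _ _.
  by move=> x y z _ _ h1 h2; rewrite -[0]addr0; apply: boundary_cats h1 h2.
move=> s0 hs0.
pose P c d := exists2 e, 0 < e & forall u v,
  a <= u -> v <= b -> s0 - e < u <= s0 -> s0 <= v < s0 + e -> boundary G H u v c d 0.
apply: (creep (P := P)) cd _ _.
  move=> x y z _ _ [e e0 h1] [e' e0' h2]; exists (Num.min e e').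
    by rewrite lt_min e0.
  move=> u v au vb /andP[u1 u2] /andP[v1 v2]; rewrite -[0]addr0.
  have m1 : Num.min e e' <= e by rewrite ge_min lexx.
  have m2 : Num.min e e' <= e' by rewrite ge_min lexx orbT.
  by apply: boundary_catt (h1 _ _ _ _ _ _) (h2 _ _ _ _ _ _) => //; apply/andP; split; lra.
move=> t0 ht0; set nu := G s0 - H t0.
have nu0 : 0 < dot2 nu nu.
  by apply: sqnorm_gt0; rewrite subr_eq0; apply: GH.
have hG := @dot2_cont nu G Gc s0; have hH := @dot2_cont nu H Hc t0.
(* Half of the available margin: [G] and [H] may each change the scalar product with [nu] by less
   than [D] without making it vanish. *)
pose D := dot2 nu nu / 2.
have [e e0 He] : exists2 e, 0 < e & forall u, `|u - s0| < e -> 0 < dot2 nu (G u) - dot2 nu (G s0) + D.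
  apply: (gt0_near (f := fun u => dot2 nu (G u) - dot2 nu (G s0) + D)).
    by apply: cvgD; [apply: cvgB|]; [exact: hG|exact: cvg_cst|exact: cvg_cst].
  by rewrite subrr add0r divr_gt0.
have [e' e0' He'] : exists2 e, 0 < e & forall u, `|u - t0| < e -> 0 < dot2 nu (H t0) - dot2 nu (H u) + D.
  apply: (gt0_near (f := fun u => dot2 nu (H t0) - dot2 nu (H u) + D)).
    by apply: cvgD; [apply: cvgB|]; [exact: cvg_cst|exact: hH|exact: cvg_cst].
  by rewrite subrr add0r divr_gt0.
exists e' => // c' d' _ _ /andP[c1 c2] /andP[d1 d2].
exists e => // u v _ _ /andP[u1 u2] /andP[v1 v2].
apply: (boundary_half (nu := nu)) (le_trans u2 v1) (le_trans c2 d1) _.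
move=> s t /andP[us sv] /andP[ct td].
have := He s; have := He' t; rewrite !ltr_norml => h1 h2.
have {}h1 : 0 < dot2 nu (H t0) - dot2 nu (H t) + D by apply: h1; apply/andP; split; lra.
have {}h2 : 0 < dot2 nu (G s) - dot2 nu (G s0) + D by apply: h2; apply/andP; split; lra.
have E : D + D = dot2 nu (G s0) - dot2 nu (H t0) by rewrite -dot2B -/nu /D; field.
by rewrite dot2B; lra.
Qed.

End Rectangle.
End Winding.

(** * Transverse crossings, and rays crossing a chord of the disc *)

Section Crossings.
Variable R : realType.
Local Notation plane := (R * R)%type.
Implicit Types (G H K : R -> plane) (a b u v nu : plane).

Definition slope G (s : R) b : Prop := forall eps, 0 < eps ->
  exists2 del, 0 < del & forall x, `|x| <= del ->
    `|(G (s + x)).1 - (G s).1 - x * b.1| <= eps * `|x| /\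
    `|(G (s + x)).2 - (G s).2 - x * b.2| <= eps * `|x|.

Lemma edge_turn nu (c : R -> plane) (p q : R) : p <= q ->
  (forall t, p <= t <= q -> 0 < dot2 nu (c t)) ->
  exists w, [/\ wind c p q w, turns (c p) (c q) w & `|w| < pi].
Proof.
move=> pq h.
have [ta ha ta1] := half_turn (h p (introT andP (conj (lexx p) pq))).
have [tb hb tb1] := half_turn (h q (introT andP (conj pq (lexx q)))).
have W := half_wind pq h ha hb ta1 tb1; exists (tb - ta); split=> //.
  exact: wind_turns.
by move: ta1 tb1; rewrite !ltr_norml => /andP[? ?] /andP[? ?]; apply/andP; split; lra.
Qed.

Lemma turns_signed (k : R) u v w : k = 1 \/ k = -1 -> turns u v w -> `|w| < pi ->
  0 < k * det2 u v -> 0 < k * w < pi.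
Proof.
have pi0 := pi_gt0 R.
case=> -> uv /[dup] /ltW; rewrite ler_norml => w1 w2.
  by rewrite !mul1r => h; apply: turns_sin_gt0 uv h w1.
rewrite !mulN1r => h; apply: (turns_sin_gt0 (turns_sym uv)).
  by have -> : det2 v u = - det2 u v by rewrite /det2; ring.
by move: w1 => /andP[? ?]; apply/andP; split; lra.
Qed.

Lemma turns_loop u w : u != 0 -> turns u u w -> 0 < w < pi *+ 4 -> w = pi *+ 2.
Proof.
move=> u0 uw /andP[w0 w4]; apply: (turns_uniq u0 uw).
  exists 1 => //; rewrite cos2pi sin2pi !mul1r !mul0r subr0 add0r; by case: (u).
by rewrite ltr_norml; apply/andP; split; lra.
Qed.

(** To first order the difference is [x * b - y * a], a linear map of determinant [- det2 b a]. On
    each side of a small square one coordinate with respect to [b] and [a] keeps its sign, so that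
    the side stays in a half-plane. The four sides turn in the same direction, each by less than pi;
    since the loop closes, the sum is one full turn. *)
Lemma boundary_zero G H s t b a : slope G s b -> slope H t a -> det2 b a != 0 ->
  G s = H t -> forall e, 0 < e -> exists2 eta, 0 < eta < e &
  boundary G H (s - eta) (s + eta) (t - eta) (t + eta) (- Num.sg (det2 b a) * pi *+ 2).
Proof.
move=> Gb Ha D0 GH e e0; set D := det2 b a in D0 *; set k := Num.sg D.
have kD : k * D = `|D| by rewrite normrEsg.
have Dp : 0 < `|D| by rewrite normr_gt0.
have k1 : k = 1 \/ k = -1.
  by rewrite /k; case: (ltrgtP D 0) D0 => [/ltr0_sg->|/gtr0_sg->|] //; [right|left].
(* [M] bounds the coefficients by which the remainders enter the two determinants below. The
   resulting error is at most half of [eta * |D|], the size of the main term on the sides of the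
   square. *)
pose M := `|b.1| + `|b.2| + `|a.1| + `|a.2| + 1.
have M0 : 0 < M by rewrite /M ltr_wpDl // !addr_ge0.
pose eps := `|D| / (4 * M).
have eps0 : 0 < eps by rewrite divr_gt0 // mulr_gt0.
have [d1 d10 H1] := Gb _ eps0; have [d2 d20 H2] := Ha _ eps0.
pose eta := Num.min (Num.min d1 d2) (e / 2).
have eta0 : 0 < eta by rewrite !lt_min d10 d20 divr_gt0.
have etae : eta < e by rewrite gt_min; apply/orP; right; lra.
have etad1 : eta <= d1 by rewrite !ge_min lexx.
have etad2 : eta <= d2 by rewrite !ge_min lexx orbT.
exists eta; first by rewrite eta0.
pose F x y := G (s + x) - H (t + y).
have bnd (c1 c2 r1 r2 : R) : `|r1| <= eps * eta *+ 2 -> `|r2| <= eps * eta *+ 2 ->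
    `|c1| + `|c2| <= M -> `|r1 * c1 - r2 * c2| < eta * `|D|.
  move=> h1 h2 cM; apply: (@le_lt_trans _ _ (eps * eta *+ 2 * M)).
    apply: (le_trans (ler_normB _ _)); rewrite !normrM.
    apply: (@le_trans _ _ (eps * eta *+ 2 * (`|c1| + `|c2|))).
      by rewrite mulrDr lerD // ler_wpM2r.
    by rewrite ler_wpM2l // mulrn_wge0 // mulr_ge0 ?ltW.
  have -> : eps * eta *+ 2 * M = eta * `|D| / 2.
    by rewrite /eps; field; rewrite gt_eqF.
  by have := mulr_gt0 eta0 Dp; lra.
have errs x y : `|x| <= eta -> `|y| <= eta -> exists r1 r2,
    [/\ `|r1| <= eps * eta *+ 2, `|r2| <= eps * eta *+ 2,
        (F x y).1 = x * b.1 - y * a.1 + r1 & (F x y).2 = x * b.2 - y * a.2 + r2].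
  move=> xe ye.
  have [g1 g2] := H1 x (le_trans xe etad1); have [h1 h2] := H2 y (le_trans ye etad2).
  have xb : eps * `|x| <= eps * eta by rewrite ler_wpM2l // ltW.
  have yb : eps * `|y| <= eps * eta by rewrite ler_wpM2l // ltW.
  exists (((G (s + x)).1 - (G s).1 - x * b.1) - ((H (t + y)).1 - (H t).1 - y * a.1)).
  exists (((G (s + x)).2 - (G s).2 - x * b.2) - ((H (t + y)).2 - (H t).2 - y * a.2)).
  rewrite mulr2n; split; try by apply: le_trans (ler_normB _ _) _; rewrite lerD //; eapply le_trans; eassumption.
    by rewrite /F GH /=; ring.
  by rewrite /F GH /=; ring.
have Pxy x y : `|x| <= eta -> `|y| <= eta -> `|det2 (F x y) a - x * D| < eta * `|D|.
  move=> xe ye; have [r1 [r2 [h1 h2 e1 e2]]] := errs x y xe ye.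
  have -> : det2 (F x y) a - x * D = r1 * a.2 - r2 * a.1.
    by rewrite /D /det2 e1 e2; ring.
  apply: bnd => //; rewrite /M; have := normr_ge0 b.1; have := normr_ge0 b.2; lra.
have Qxy x y : `|x| <= eta -> `|y| <= eta -> `|det2 b (F x y) + y * D| < eta * `|D|.
  move=> xe ye; have [r1 [r2 [h1 h2 e1 e2]]] := errs x y xe ye.
  have -> : det2 b (F x y) + y * D = r2 * b.1 - r1 * b.2.
    by rewrite /D /det2 e1 e2; ring.
  apply: bnd => //; rewrite /M; have := normr_ge0 a.1; have := normr_ge0 a.2; lra.
have ee : `|eta| <= eta by rewrite gtr0_norm.
have ee' : `|- eta| <= eta by rewrite normrN.
have kabs r : `|k * r| = `|r|.
  by case: k1 => ->; rewrite ?mul1r // mulN1r normrN.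
have PR y : `|y| <= eta -> 0 < k * det2 (F eta y) a.
  move=> ye; have := Pxy _ _ ee ye; rewrite -kabs mulrBr mulrCA kD ltr_norml => /andP[]; clear; lra.
have PL y : `|y| <= eta -> k * det2 (F (- eta) y) a < 0.
  move=> ye; have := Pxy _ _ ee' ye; rewrite -kabs mulrBr mulrCA kD ltr_norml => /andP[]; clear; lra.
have QT x : `|x| <= eta -> k * det2 b (F x eta) < 0.
  move=> xe; have := Qxy _ _ xe ee; rewrite -kabs mulrDr mulrCA kD ltr_norml => /andP[]; clear; lra.
have QB x : `|x| <= eta -> 0 < k * det2 b (F x (- eta)).
  move=> xe; have := Qxy _ _ xe ee'; rewrite -kabs mulrDr mulrCA kD ltr_norml => /andP[]; clear; lra.
have nrm r x : r - eta <= x <= r + eta -> `|x - r| <= eta.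
  by clear; move=> /andP[? ?]; rewrite ler_norml; apply/andP; split; lra.
have leB r : r - eta <= r + eta by clear -eta0; lra.
have FE x y : F (x - s) (y - t) = G x - H y by rewrite /F !(addrC _ (_ - _)) !subrK.
have [w1 [W1 T1 N1]] : exists w, [/\ wind (fun x => G x - H (t - eta)) (s - eta) (s + eta) w,
    turns (F (- eta) (- eta)) (F eta (- eta)) w & `|w| < pi].
  apply: (@edge_turn (- k * b.2, k * b.1)) => // x /nrm /QB.
  rewrite /F (addrC s) subrK => h; apply: lt_le_trans h _; rewrite le_eqVlt; apply/orP; left; apply/eqP.
  by rewrite /dot2 /det2 /=; ring.
have [w2 [W2 T2 N2]] : exists w, [/\ wind (fun y => G (s + eta) - H y) (t - eta) (t + eta) w,
    turns (F eta (- eta)) (F eta eta) w & `|w| < pi].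
  apply: (@edge_turn (k * a.2, - k * a.1) (fun y => G (s + eta) - H y)) => // x /nrm /PR.
  rewrite /F (addrC t) subrK => h; apply: lt_le_trans h _; rewrite le_eqVlt; apply/orP; left; apply/eqP.
  by rewrite /dot2 /det2 /=; ring.
have [w3 [W3 T3 N3]] : exists w, [/\ wind (fun x => G x - H (t + eta)) (s - eta) (s + eta) w,
    turns (F (- eta) eta) (F eta eta) w & `|w| < pi].
  apply: (@edge_turn (k * b.2, - k * b.1) (fun x => G x - H (t + eta))) => // x /nrm /QT.
  rewrite /F (addrC s) subrK -oppr_gt0 => h; apply: lt_le_trans h _; rewrite le_eqVlt; apply/orP; left; apply/eqP.
  by rewrite /dot2 /det2 /=; ring.
have [w4 [W4 T4 N4]] : exists w, [/\ wind (fun y => G (s - eta) - H y) (t - eta) (t + eta) w,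
    turns (F (- eta) (- eta)) (F (- eta) eta) w & `|w| < pi].
  apply: (@edge_turn (- k * a.2, k * a.1) (fun y => G (s - eta) - H y)) => // x /nrm /PL.
  rewrite /F (addrC t) subrK -oppr_gt0 => h; apply: lt_le_trans h _; rewrite le_eqVlt; apply/orP; left; apply/eqP.
  by rewrite /dot2 /det2 /=; ring.
exists w1, w2, w3, w4; split=> //.
(* Cramer's rule expresses [det2 u v] by the coordinates of [u] and [v] with respect to [b] and [a],
   whose signs are known at the corners. *)
have detE u v : D ^+ 2 * (- k * det2 u v) =
    `|D| * ((k * det2 b u) * (k * det2 v a) - (k * det2 u a) * (k * det2 b v)).
  have kk : k * k = 1 by case: k1 => ->; ring.
  rewrite -kD; transitivity (k * k * (k * D * (det2 b u * det2 v a - det2 u a * det2 b v))); last by ring.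
  by rewrite kk mul1r /D /det2; ring.
have D2 : 0 < D ^+ 2 by rewrite lt_def sqrf_eq0 D0 sqr_ge0.
have detP u v : 0 < (k * det2 b u) * (k * det2 v a) - (k * det2 u a) * (k * det2 b v) ->
    0 < - k * det2 u v.
  by move=> h; rewrite -(pmulr_rgt0 _ D2) detE mulr_gt0.
have k1' : - k = 1 \/ - k = -1 by case: k1 => ->; [right|left; rewrite opprK].
have X1 := PR _ ee; have X2 := PR _ ee'; have X3 := PL _ ee; have X4 := PL _ ee'.
have Y1 := QT _ ee; have Y2 := QT _ ee'; have Y3 := QB _ ee; have Y4 := QB _ ee'.
have s1 : 0 < - k * w1 < pi by apply: (turns_signed k1' T1 N1); apply: detP; move: X1 X2 X3 X4 Y1 Y2 Y3 Y4; clear; nra.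
have s2 : 0 < - k * w2 < pi by apply: (turns_signed k1' T2 N2); apply: detP; move: X1 X2 X3 X4 Y1 Y2 Y3 Y4; clear; nra.
have s3 : 0 < - k * - w3 < pi.
  by apply: (turns_signed k1' (turns_sym T3)); rewrite ?normrN //; apply: detP; move: X1 X2 X3 X4 Y1 Y2 Y3 Y4; clear; nra.
have s4 : 0 < - k * - w4 < pi.
  by apply: (turns_signed k1' (turns_sym T4)); rewrite ?normrN //; apply: detP; move: X1 X2 X3 X4 Y1 Y2 Y3 Y4; clear; nra.
have v0 : F (- eta) (- eta) != 0.
  by apply: contraTneq X4 => ->; rewrite /det2 !mul0r subrr mulr0 ltxx.
have L := turns_trans (turns_trans (turns_trans T1 T2) (turns_sym T3)) (turns_sym T4).
case: k1' => E; rewrite -/k E in s1 s2 s3 s4 *.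
  rewrite mul1r -(turns_loop v0 L) //; clear -s1 s2 s3 s4.
  by move: s1 s2 s3 s4 => /andP[? ?] /andP[? ?] /andP[? ?] /andP[? ?]; apply/andP; split; lra.
have := turns_loop v0 (turns_sym L); clear -s1 s2 s3 s4.
move: s1 s2 s3 s4 => /andP[? ?] /andP[? ?] /andP[? ?] /andP[? ?].
move=> W; rewrite mulN1r mulNrn -W; first by ring.
by apply/andP; split; lra.
Qed.

(** The rectangle is cut into a small square around the zero, one piece on each side of it, and
    strips of full width below and above; only the square contributes. *)
Lemma boundary_one G H p q c d s t b a : continuous G -> continuous H ->
  p < s < q -> c < t < d -> slope G s b -> slope H t a -> det2 b a != 0 -> G s = H t ->
  (forall x y, p <= x <= q -> c <= y <= d -> G x = H y -> x = s /\ y = t) ->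
  boundary G H p q c d (- Num.sg (det2 b a) * pi *+ 2).
Proof.
move=> Gc Hc /andP[ps sq] /andP[ct td] Gb Ha D0 GH uniq.
pose e := Num.min (Num.min (s - p) (q - s)) (Num.min (t - c) (d - t)).
have e0 : 0 < e by rewrite !lt_min !subr_gt0 ps sq ct td.
have [eta /andP[eta0 etae] B] := boundary_zero Gb Ha D0 GH e0.
move: etae; rewrite !lt_min => /andP[/andP[? ?] /andP[? ?]].
have free p' q' c' d' : p <= p' -> q' <= q -> c <= c' -> d' <= d -> p' <= q' -> c' <= d' ->
    [\/ q' < s, s < p', d' < t | t < c'] -> boundary G H p' q' c' d' 0.
  move=> h1 h2 h3 h4 h5 h6 h7; apply: boundary0 => // x y /andP[? ?] /andP[? ?].
  apply/eqP => /uniq[||xs yt]; try by apply/andP; split; lra.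
  by case: h7; lra.
have B1 : boundary G H p q c (t - eta) 0.
  by apply: free; try lra; constructor 3; lra.
have B5 : boundary G H p q (t + eta) d 0.
  by apply: free; try lra; constructor 4; lra.
have B2 : boundary G H p (s - eta) (t - eta) (t + eta) 0.
  by apply: free; try lra; constructor 1; lra.
have B4 : boundary G H (s + eta) q (t - eta) (t + eta) 0.
  by apply: free; try lra; constructor 2; lra.
have := boundary_catt (boundary_catt B1 (boundary_cats (boundary_cats B2 B) B4)) B5.
by rewrite !addr0 !add0r.
Qed.

(** Strict convexity: the tangent at a point of the circle has the rest of the disc on one side. *)
Lemma circle_dot u v : sqnorm u = 1 -> sqnorm v <= 1 -> v != u -> 0 < dot2 u (u - v).
Proof.
move=> u1 v1 vu; have {vu} := vu; rewrite -subr_eq0 => /sqnorm_gt0.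
by move: u1 v1; rewrite /sqnorm /dot2 /=; nra.
Qed.

(** The boundary of [[p, q] x [c, d]] turns once. At [p] and [q] the directions stay within pi / 2
    of the outer normal by [circle_dot], and the side at [d] lies in a half-plane, whence the bound
    on [Y]. The left-hand side depends only on the chord and the starting point [H c], so it is
    common to all rays from that point. *)
Lemma strand_side G H p q c d s t b a E al be : continuous G -> continuous H ->
  p < s < q -> c < t < d -> slope G s b -> slope H t a -> det2 b a != 0 -> G s = H t ->
  (forall x y, p <= x <= q -> c <= y <= d -> G x = H y -> x = s /\ y = t) ->
  (forall x, p <= x <= q -> sqnorm (G x) <= 1) ->
  (forall y, c <= y <= d -> sqnorm (H y) <= 1) ->
  sqnorm (G p) = 1 -> sqnorm (G q) = 1 -> sqnorm (H d) = 1 ->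
  wind (fun x => G x - H c) p q E ->
  turns (G p) (G p - H c) al -> `|al| < pi / 2 ->
  turns (G q) (G q - H c) be -> `|be| < pi / 2 ->
  exists2 Y, `|Y| < pi *+ 2 & E + al - be = Y - Num.sg (det2 b a) * pi *+ 2.
Proof.
move=> Gc Hc ps ct Gb Ha D0 GH uniq Gd Hd Gp Gq Hd1 WE ta na tb nb.
have pq : p <= q by move: ps => /andP[? ?]; lra.
have cd : c <= d by move: ct => /andP[? ?]; lra.
have [w1 [w2 [w3 [w4 [W1 W2 W3 W4 W]]]]] := boundary_one Gc Hc ps ct Gb Ha D0 GH uniq.
rewrite (wind_uniq W1 WE) {w1 W1} in W.
have pp : p <= p <= q by rewrite lexx.
have qq : p <= q <= q by rewrite lexx pq.
have cc : c <= c <= d by rewrite lexx.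
have dd : c <= d <= d by rewrite lexx cd.
have hq y : c <= y <= d -> 0 < dot2 (G q) (G q - H y).
  move=> yc; apply: circle_dot => //; first exact: Hd.
  by apply/eqP => /esym/uniq-/(_ qq yc)[]; move: ps => /andP[? ?]; lra.
have hp y : c <= y <= d -> 0 < dot2 (G p) (G p - H y).
  move=> yc; apply: circle_dot => //; first exact: Hd.
  by apply/eqP => /esym/uniq-/(_ pp yc)[]; move: ps => /andP[? ?]; lra.
have hd x : p <= x <= q -> 0 < dot2 (- H d) (G x - H d).
  move=> xp; suff : 0 < dot2 (H d) (H d - G x) by rewrite /dot2 /=; nra.
  apply: circle_dot => //; first exact: Gd.
  by apply/eqP => /uniq-/(_ xp dd)[]; move: ct => /andP[? ?]; lra.
have [ta' ha' na'] := half_turn (hp d dd); have [tb' hb' nb'] := half_turn (hq d dd).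
have E2 := wind_halfE W2 hq tb hb' nb nb'.
have E4 := wind_halfE W4 hp ta ha' na na'.
have [u1 k1 m1] := half_turn (hd p pp); have [u2 k2 m2] := half_turn (hd q qq).
have E3 := wind_halfE W3 hd k1 k2 m1 m2.
exists (w3 + ta' - tb'); last by rewrite -mulrnAr mulNr mulrnAr in W; lra.
move: m1 m2 na' nb'; rewrite E3 !ltr_norml.
by move=> /andP[? ?] /andP[? ?] /andP[? ?] /andP[? ?]; apply/andP; split; lra.
Qed.

(* Two rays which leave an inner point, reach the circle, and cross the chord G once
   each, cross it in the same direction: otherwise the turns of G seen from their two
   endpoints would be 4 pi apart. *)
Lemma rays_agree G H K (p q c d c' d' s t s' t' : R) b a (b' a' : plane) :
  continuous G -> continuous H -> continuous K -> H c = K c' ->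
  p < s < q -> c < t < d -> slope G s b -> slope H t a -> det2 b a != 0 -> G s = H t ->
  (forall x y, p <= x <= q -> c <= y <= d -> G x = H y -> x = s /\ y = t) ->
  p < s' < q -> c' < t' < d' -> slope G s' b' -> slope K t' a' -> det2 b' a' != 0 ->
  G s' = K t' ->
  (forall x y, p <= x <= q -> c' <= y <= d' -> G x = K y -> x = s' /\ y = t') ->
  (forall x, p <= x <= q -> sqnorm (G x) <= 1) ->
  (forall y, c <= y <= d -> sqnorm (H y) <= 1) ->
  (forall y, c' <= y <= d' -> sqnorm (K y) <= 1) ->
  sqnorm (G p) = 1 -> sqnorm (G q) = 1 -> sqnorm (H d) = 1 -> sqnorm (K d') = 1 ->
  Num.sg (det2 b a) = Num.sg (det2 b' a').
Proof.
move=> Gc Hc Kc HK ps ct Gb Ha D0 GH uniq ps' ct' Gb' Ka D0' GK uniq' Gd Hd Kd Gp Gq Hd1 Kd1.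
have pq : p <= q by move: ps => /andP[? ?]; lra.
have cd : c <= d by move: ct => /andP[? ?]; lra.
have pp : p <= p <= q by rewrite lexx.
have qq : p <= q <= q by rewrite lexx pq.
have cc : c <= c <= d by rewrite lexx.
have H0 x : p <= x <= q -> G x != H c.
  by move=> xp; apply/eqP => /uniq-/(_ xp cc)[]; move: ct => /andP[? ?]; lra.
have [E WE] : exists E, wind (fun x => G x - H c) p q E.
  apply: wind_ex => // [x|x xp]; last by rewrite subr_eq0 H0.
  by apply: cvgB; [exact: Gc|exact: cvg_cst].
have [al ta na] : exists2 al, turns (G p) (G p - H c) al & `|al| < pi / 2.
  by apply/half_turn/circle_dot; rewrite ?Hd // eq_sym H0.
have [be tb nb] : exists2 be, turns (G q) (G q - H c) be & `|be| < pi / 2.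
  by apply/half_turn/circle_dot; rewrite ?Hd // eq_sym H0.
have [Y Y2 EY] := strand_side Gc Hc ps ct Gb Ha D0 GH uniq Gd Hd Gp Gq Hd1 WE ta na tb nb.
rewrite HK in WE ta tb.
have [Y' Y2' EY'] := strand_side Gc Kc ps' ct' Gb' Ka D0' GK uniq' Gd Kd Gp Gq Kd1 WE ta na tb nb.
have := pi_gt0 R; move: EY' Y2 Y2'; rewrite EY !ltr_norml.
case: (ltrgtP (det2 b a) 0) D0 => [/ltr0_sg->|/gtr0_sg->|] // _;
case: (ltrgtP (det2 b' a') 0) D0' => [/ltr0_sg->|/gtr0_sg->|] // _ => h1 /andP[h2 h3] /andP[h4 h5] h6;
exfalso; clear -h1 h2 h3 h4 h5 h6; lra.
Qed.

End Crossings.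

(** * Derivatives and Jacobians of plane diffeomorphisms *)

Section PlaneMaps.
Variable R : realType.
Local Notation plane := (R * R)%type.

Lemma derive1_plane (c : R -> plane) t : differentiable c t -> derive1 c t = 'd c t 1.
Proof. by move=> dc; rewrite derive1E deriveE. Qed.

Lemma slope_derive1 (c : R -> plane) t : derivable c t 1 -> slope c t (derive1 c t).
Proof.
move=> dc eps eps0; have /derivable1_diffP df := dc.
have /eqaddoP/(_ eps eps0) := diff_locally df; rewrite derive1_plane //.
move=> [e /= e0 He]; exists (e / 2); first exact: divr_gt0.
move=> x xe.
have {He} : `|c (x + t) - (c t + 'd c t x)| <= eps * `|x|.
  apply: (He x); rewrite /= sub0r normrN; apply: le_lt_trans xe _.
  by rewrite ltr_pdivrMr // ltr_pMr // ltr1n.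
have -> : 'd c t x = x *: 'd c t 1 by rewrite -linearZ /GRing.scale /= mulr1.
rewrite (addrC x) opprD addrA prod_normE ge_max => /andP[h1 h2].
by split; [exact: h1|exact: h2].
Qed.

Lemma derive1_comp_plane (f : plane -> plane) (c : R -> plane) t :
  differentiable f (c t) -> derivable c t 1 ->
  derivable (f \o c) t 1 /\ derive1 (f \o c) t = 'd f (c t) (derive1 c t).
Proof.
move=> df /derivable1_diffP dc; have dfc := differentiable_comp dc df.
split; first exact/derivable1_diffP.
have := derive1_plane dfc; rewrite (diff_comp dc df) /= -(derive1_plane dc).
by apply.
Qed.

Definition jac (f : plane -> plane) x : R := det2 ('d f x (1, 0)) ('d f x (0, 1)).

Lemma diff_plane (f : plane -> plane) x (u : plane) : differentiable f x ->
  'd f x u = u.1 *: 'd f x (1, 0) + u.2 *: 'd f x (0, 1).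
Proof.
move=> df; rewrite -!linearZ -linearD; congr ('d f x _).
by case: u => a b; congr pair; rewrite /= /GRing.scale /=; ring.
Qed.

Lemma det2_diff (f : plane -> plane) x u v : differentiable f x ->
  det2 ('d f x u) ('d f x v) = jac f x * det2 u v.
Proof.
move=> df; rewrite (diff_plane u df) (diff_plane v df) /jac /det2 /= /GRing.scale /=.
ring.
Qed.

(** The differential of the inverse undoes that of [f]; if [jac f x] were 0, the standard basis
    would have determinant 0. *)
Lemma jac_neq0 (f : plane -> plane) x : plane_diffeo f -> jac f x != 0.
Proof.
move=> [[df _] [g [[dg _] fK gK]]].
have E u : 'd g (f x) ('d f x u) = u.
  have gf : g \o f = id by apply/funext => y; apply: fK.
  have := diff_comp (df x) (dg (f x)); rewrite gf => /(congr1 (fun h => h u)) /= <-.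
  by rewrite diff_val.
apply: contraTneq (oner_neq0 R) => j0; rewrite negbK; apply/eqP.
transitivity (det2 ((1, 0) : plane) (0, 1)); first by rewrite /det2 /=; ring.
by rewrite -(E (1, 0)) -(E (0, 1)) det2_diff // -/(jac f x) j0 mulr0.
Qed.

Lemma sg_const (phi : R -> R) : continuous phi -> (forall t, phi t != 0) ->
  Num.sg (phi 0) = Num.sg (phi 1).
Proof.
move=> cphi p0.
have ivt := @IVT R phi 0 1 0 ler01 (continuous_subspaceT cphi).
have : ~ (Num.min (phi 0) (phi 1) <= 0 <= Num.max (phi 0) (phi 1)).
  by move=> /ivt[c _ /eqP]; apply/negP.
case: (ltrgtP (phi 0) 0) (p0 0) => // h0 _; case: (ltrgtP (phi 1) 0) (p0 1) => // h1 _.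
- by rewrite !ltr0_sg.
- by case; rewrite ge_min le_max (ltW h0) (ltW h1) orbT.
- by case; rewrite ge_min le_max (ltW h0) (ltW h1) orbT.
- by rewrite !gtr0_sg.
Qed.

Lemma cts_det2 (T : topologicalType) (F G : T -> plane) :
  continuous F -> continuous G -> continuous (fun t => det2 (F t) (G t)).
Proof.
move=> cF cG t.
have f1 : {for t, continuous (fun t => (F t).1)} by apply: (continuous_comp (cF t)); exact: cvg_fst.
have f2 : {for t, continuous (fun t => (F t).2)} by apply: (continuous_comp (cF t)); exact: cvg_snd.
have g1 : {for t, continuous (fun t => (G t).1)} by apply: (continuous_comp (cG t)); exact: cvg_fst.
have g2 : {for t, continuous (fun t => (G t).2)} by apply: (continuous_comp (cG t)); exact: cvg_snd.
by apply: cvgB; apply: cvgM.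
Qed.

(** The Jacobian has no zero on the segment from [x] to [y]. A map onto the unit disc may reverse
    the orientation, but then it does so everywhere. *)
Lemma jac_sg (f : plane -> plane) x y : plane_diffeo f -> Num.sg (jac f x) = Num.sg (jac f y).
Proof.
move=> hf; pose c (t : R) : plane := x + t *: (y - x).
have cc : continuous c.
  move=> t; apply: cvgD; first exact: cvg_cst.
  by apply: cvgZr_tmp; exact: cvg_id.
have := @sg_const (fun t => jac f (c t)).
rewrite /c scale0r addr0 scale1r addrCA subrr addr0; apply; last by move=> t; apply: jac_neq0.
have [[_ cf] _] := hf.
have cd v : continuous (fun t => 'd f (c t) v).
  by move=> t; apply: (@continuous_comp _ _ _ c (fun x => plane_diff f x v)); [exact: cc|exact: cf].
exact: cts_det2.
Qed.

(** The Jacobian equals 1 at time 0 and never vanishes along the isotopy. *)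
Lemma isotopy_jac (H : R -> plane -> plane) x : plane_isotopy H -> 0 < jac (H 1) x.
Proof.
move=> [hd h0 _ hc].
have := @sg_const (fun t => jac (H t) x).
have -> : jac (H 0) x = 1.
  have -> : H 0 = id by apply/funext.
  by rewrite /jac !diff_val /det2 /=; ring.
rewrite sgr1 => E; rewrite -sgr_gt0 -E //; last by move=> t; apply: jac_neq0.
have c v : continuous (fun t => 'd (H t) x v).
  move=> t; have := hc v (t, x) => /= h.
  apply: (@continuous_comp _ _ _ (fun t => (t, x)) (fun tx => plane_diff (H tx.1) tx.2 v)) h.
  exact: (cvg_pair (G := nbhs t) (H := nbhs x) cvg_id (cvg_cst x)).
exact: cts_det2.
Qed.

End PlaneMaps.

(** * Colourings *)

Section IntPowers.
Variable G : groupType.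
Implicit Types (x y z : G) (a b : int).
Local Open Scope group_scope.

Lemma expgzS x a : expgz x (a + 1)%R = expgz x a * x.
Proof.
case: a => [k|[|k]]; first by rewrite -PoszD addn1 /= expgSr.
  by rewrite /= mulVg.
have -> : (Negz k.+1 + 1)%R = Negz k by rewrite !NegzE -addn1 PoszD opprD subrK.
rewrite /= [in RHS]expgS invgM -mulgA.
by rewrite mulVg mulg1.
Qed.

Lemma expgzD x a b : expgz x (a + b)%R = expgz x a * expgz x b.
Proof.
elim/int_rect: b => [|k IH|k IH]; first by rewrite addr0 mulg1.
  by rewrite -addn1 PoszD addrA !expgzS IH mulgA.
have E : (- k.+1%:Z + 1 = - k%:Z)%R by rewrite -addn1 PoszD opprD subrK.
by apply: (mulIg x); rewrite -mulgA -!expgzS -addrA E.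
Qed.

Lemma expgz0 x : expgz x 0 = 1. Proof. by []. Qed.
Lemma expgz1 x : expgz x 1 = x. Proof. by []. Qed.

Lemma expgzN x a : expgz x (- a) = (expgz x a)^-1.
Proof. by apply: (mulIg (expgz x a)); rewrite -expgzD addNr mulVg. Qed.

Lemma expgz_conj x y a : expgz x a ^ y = expgz (x ^ y) a.
Proof.
elim/int_rect: a => [|k IH|k IH]; first by rewrite conj1g.
  by rewrite -addn1 PoszD !expgzS conjMg IH.
have E : (- k.+1%:Z + 1 = - k%:Z)%R by rewrite -addn1 PoszD opprD subrK.
by apply: (mulIg (x ^ y)); rewrite -conjMg -!expgzS E.
Qed.

Lemma commute_expgz x y a : commute x y -> commute x (expgz y a).
Proof.
by case: a => k xy /=; [exact: commuteX|apply/commuteV/commuteX].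
Qed.

Lemma commute_conj x y : commute x y -> x ^ y = x.
Proof. by move=> xy; rewrite conjgE xy mulKg. Qed.

End IntPowers.

(** * Group-valued step functions on the line *)

Section Steps.
Variables (R : realType) (G : groupType).
Implicit Types (g J : R -> G) (us : seq (R * G)) (a b t : R) (c : G).
Local Open Scope group_scope.

(* g is left-continuous and locally constant, up to right jumps by J. *)
Definition left_const g t : Prop := \forall s \near t^'-, g s = g t.
Definition right_jump g t c : Prop := \forall s \near t^'+, g s = g t * c.

Fixpoint stepf c us (t : R) : G :=
  if us is (p, d) :: us' then (if (t <= p)%R then c else stepf (c * d) us' t) else c.

Fixpoint jumpf us (t : R) : G :=
  if us is (p, d) :: us' then (if t == p then d else jumpf us' t) else 1.

Definition before (x y : R * G) := (x.1 < y.1)%R.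

Lemma stepf_left c us t : left_const (stepf c us) t.
Proof.
elim: us c => [|[p d] us IH] c; first exact: nearW.
rewrite /left_const /=; have [tp|pt] := leP t p.
  near=> s; rewrite ifT //; apply: le_trans tp; apply: ltW; near: s; exact: nbhs_left_lt.
near=> s; rewrite ifF; first by near: s; exact: IH.
apply/negbTE; rewrite -ltNge; near: s; exact: nbhs_left_gt.
Unshelve. all: by end_near. Qed.

Lemma jumpf1 us t : all (fun x => t < x.1)%R us -> jumpf us t = 1.
Proof. by elim: us => //= -[p d] us IH /= /andP[tp /IH->]; rewrite lt_eqF. Qed.

Lemma stepf_before c us t : all (fun x => t <= x.1)%R us -> stepf c us t = c.
Proof. by case: us => //= -[p d] us /andP[/= ->]. Qed.

Lemma stepf_after c us t : all (fun x => x.1 < t)%R us ->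
  stepf c us t = c * \prod_(x <- us) x.2.
Proof.
elim: us c => [|[p d] us IH] c /=; first by rewrite big_nil mulg1.
by move=> /andP[pt /IH->]; rewrite leNgt pt big_cons mulgA.
Qed.

Lemma before_all x us : path before x us -> all (fun y => x.1 < y.1)%R us.
Proof. by apply: order_path_min => y x' z; apply: lt_trans. Qed.

Lemma stepf_right c us t : sorted before us -> right_jump (stepf c us) t (jumpf us t).
Proof.
rewrite /right_jump; elim: us c => [|[p d] us IH] c /= sus.
  by apply: nearW => s; rewrite mulg1.
have sus' := path_sorted sus; have lus := before_all sus.
have [tp|pt|tp] := ltgtP t p; last subst p.
- near=> s; rewrite ifT.
    rewrite jumpf1 ?mulg1 //; apply: sub_all lus => y /=; exact: lt_trans.
  near: s; exact: nbhs_right_ltW.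
- near=> s; rewrite ifF; first by near: s; exact: IH.
  apply/negbTE; rewrite -ltNge; apply: lt_trans pt _; near: s; exact: nbhs_right_gt.
- have E : stepf (c * d) us t * jumpf us t = c * d.
    rewrite jumpf1 // mulg1 stepf_before //.
    by apply: sub_all lus => y /=; exact: ltW.
  have IHp := IH (c * d) sus'; rewrite E in IHp.
  near=> s; rewrite ifF; last first.
    by apply/negbTE; rewrite -ltNge; near: s; exact: nbhs_right_gt.
  by near: s; exact: IHp.
Unshelve. all: by end_near. Qed.

Definition steps g J := forall t, left_const g t /\ right_jump g t (J t).

(** [creep] applied to equality of values. A jump at [b] shows only to the right of [b], hence the
    half-open interval. *)
Lemma steps_const g J a b : steps g J -> (a <= b)%R ->
  (forall u, (a <= u < b)%R -> J u = 1) -> g b = g a.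
Proof.
move=> st ab J1; apply/esym; apply: (creep (P := fun x y => g x = g y)) ab _ _.
  by move=> x y z _ _ -> ->.
move=> x /andP[ax xb]; have [L Rt] := st x.
have L' : \forall s \near x, (s < x)%R -> g s = g x by exact: L.
have R' : \forall s \near x, (x < s)%R -> g s = g x * J x by exact: Rt.
have [e /= e0 He] : \forall s \near x, ((s < x)%R -> g s = g x) /\ ((x < s)%R -> g s = g x * J x).
  by near=> s; split; near: s.
exists e => // u v au vb /andP[xu ux] /andP[xv ve].
have [->|ux'] := eqVneq u x.
  have [->//|vx'] := eqVneq v x; have {vx' xv}xv : (x < v)%R by rewrite lt_neqAle eq_sym vx'.
  have [|_ /(_ xv) ->] := He v; last by rewrite J1 ?mulg1 // ax (lt_le_trans xv vb).
  by rewrite /ball_ /= ltr0_norm; lra.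
have {ux' ux}ux : (u < x)%R by rewrite lt_neqAle ux'.
have [|/(_ ux) -> _] := He u; first by rewrite /ball_ /= gtr0_norm; lra.
have [->//|vx'] := eqVneq v x; have {vx' xv}xv : (x < v)%R by rewrite lt_neqAle eq_sym vx'.
have [|_ /(_ xv) ->] := He v; last by rewrite J1 ?mulg1 // ax (lt_le_trans xv vb).
by rewrite /ball_ /= ltr0_norm; lra.
Unshelve. all: by end_near. Qed.

Lemma steps_walk0 g J a b c : steps g J ->
  (\forall s \near a^'+, g s = c) -> (forall u, (a < u < b)%R -> J u = 1) ->
  forall t, (a < t <= b)%R -> g t = c.
Proof.
move=> st gc J1 t /andP[at' tb].
have [e /= e0 He] : \forall s \near a, (a < s)%R -> g s = c by exact: gc.
pose s := (a + Num.min (e / 2) (t - a))%R.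
have m0 : (0 < Num.min (e / 2) (t - a))%R by rewrite lt_min subr_gt0 at' divr_gt0.
have as' : (a < s)%R by rewrite /s ltrDl.
have st' : (s <= t)%R by rewrite /s -lerBrDl ge_min lexx orbT.
rewrite (steps_const st st') ?(He s) //.
  rewrite /ball_ /= /s opprD addNKr normrN gtr0_norm // gt_min ltr_pdivrMr //.
  by rewrite ltr_pMr // ltr1n.
by move=> u /andP[su ut]; apply: J1 => //; rewrite (lt_le_trans as' su) (lt_le_trans ut tb).
Qed.

(** Starting from the right limit at [a], instead of the value there, permits a jump at [a]; this is
    the situation met again after each point of [us]. *)
Lemma steps_walk_open g J a b c (us : seq R) : steps g J ->
  (\forall s \near a^'+, g s = c) -> path <%R a us ->
  (forall u, (a < u < b)%R -> u \notin us -> J u = 1) ->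
  forall t, (a < t <= b)%R -> g t = stepf c [seq (u, J u) | u <- us] t.
Proof.
move=> st; elim: us a c => [|p us IH] a c gc /= sus J1 t /andP[at' tb].
  by apply: (steps_walk0 st gc (b := b)) => [u /J1->|] //; rewrite at'.
move: sus => /andP[ap sus].
have lus : all (fun y => p < y)%R us.
  by apply: order_path_min sus => y x' z; apply: lt_trans.
have before_p s : (a < s <= p)%R -> (s <= b)%R -> g s = c.
  move=> /andP[as' sp] sb; apply: (steps_walk0 st gc (b := s)) => [u /andP[au us']|].
    apply: J1; first by rewrite au (lt_le_trans us').
    rewrite inE negb_or lt_eqF ?(lt_le_trans us') //=.
    apply/negP => /(allP lus); rewrite ltNge (le_trans (ltW us')) //.
  by rewrite as' lexx.
have [tp|pt] := leP t p; first by apply: before_p => //; rewrite at'.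
apply: (IH p) => //; last by rewrite pt.
  have gp : g p = c by apply: before_p; rewrite ?ap ?lexx // (le_trans (ltW pt)).
  by have [_] := st p; rewrite /right_jump gp.
move=> u /andP[pu ub] uus; apply: J1; first by rewrite (lt_trans ap).
by rewrite inE negb_or gt_eqF.
Qed.

Lemma steps_walk g J a b (us : seq R) : steps g J -> J a = 1 -> path <%R a us ->
  (forall u, (a < u < b)%R -> u \notin us -> J u = 1) ->
  forall t, (a <= t <= b)%R -> g t = stepf (g a) [seq (u, J u) | u <- us] t.
Proof.
move=> st Ja sus J1 t /andP[]; rewrite le_eqVlt => /predU1P[<- _|at' tb].
  rewrite stepf_before // all_map.
  have : all (fun y => a < y)%R us by apply: order_path_min sus => y x' z; apply: lt_trans.
  by apply: sub_all => y /=; exact: ltW.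
apply: (steps_walk_open st (a := a) (b := b)) => //; last by rewrite at'.
by have [_] := st a; rewrite /right_jump Ja mulg1.
Qed.

End Steps.

Lemma det2Z (R : realType) a b (u v : R * R) : det2 (a *: u) (b *: v) = a * b * det2 u v.
Proof. by rewrite /det2 /= /GRing.scale /=; ring. Qed.

Lemma sgz_scale (R : realType) (a b c d e : R) :
  0 < a -> 0 < b -> 0 < c -> a * b * d = c * e -> sgz d = sgz e.
Proof.
by move=> a0 b0 c0 /(congr1 (@sgz R)); rewrite !sgzM (gtr0_sgz a0) (gtr0_sgz b0) (gtr0_sgz c0) !mul1r.
Qed.

(** * Colourings of diagrams and invariance under isotopy *)

Section Colorings.
Variables (R : realType) (n : nat).
Implicit Types (D : vdiagram R n) (G : groupType).

Lemma same_point_sym (s t : R) : same_point s t -> same_point t s.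
Proof. by move=> [z ->]; exists (- z); rewrite mulrNz addrK. Qed.

Lemma same_point_trans (s t u : R) : same_point s t -> same_point t u -> same_point s u.
Proof. by move=> [z ->] [z' ->]; exists (z + z'); rewrite intrD addrA. Qed.

Lemma same_site_sym (x y : 'I_n * R) : same_site x y -> same_site y x.
Proof. by move=> [e /same_point_sym]. Qed.

Lemma same_site_trans (x y z : 'I_n * R) : same_site x y -> same_site y z -> same_site x z.
Proof.
by move=> [e h1] [e' h2]; split; [rewrite e|apply: same_point_trans h1 h2].
Qed.

Lemma int_periodic (T : Type) (f : R -> T) : (forall t, f (t + 1) = f t) ->
  forall t (z : int), f (t + z%:~R) = f t.
Proof.
move=> f1 t; elim/int_rect => [|k IH|k IH]; first by rewrite addr0.
  by rewrite -addn1 PoszD intrD addrA f1.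
by rewrite -[RHS]IH -[in LHS]f1 -addn1 PoszD opprD intrD -addrA subrK.
Qed.

Lemma curve_shift D i t (z : int) : curve D i (t + z%:~R) = curve D i t.
Proof. by apply: int_periodic => s; apply: curve_periodic. Qed.

Lemma info_shift D i t (z : int) : info D i (t + z%:~R) = info D i t.
Proof. by apply: int_periodic => s; apply: info_periodic. Qed.

Lemma tangent_shift D i t (z : int) : tangent D i (t + z%:~R) = tangent D i t.
Proof.
apply: int_periodic => s; rewrite /tangent /derive1.
by under eq_fun do rewrite addrA !curve_periodic.
Qed.

Lemma crosses_sym (c : 'I_n -> R -> R * R) i s k t : crosses c i s k t -> crosses c k t i s.
Proof. by move=> [e ns]; split=> // /same_site_sym. Qed.

Lemma crosses_shift D i s k t (z : int) :
  crosses (curve D) i s k t -> crosses (curve D) i s k (t + z%:~R).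
Proof.
move=> [e ns]; split; first by rewrite curve_shift.
move=> h; apply: ns; apply: same_site_trans h _; apply: same_site_sym.
by split=> //; exists z.
Qed.

Definition over_at D i t : 'I_n * R := xget (i, t) [set x | crosses (curve D) i t x.1 x.2].

Section Def.
Variables (G : groupType) (D : vdiagram R n) (m lam : 'I_n -> G) (h : 'I_n -> R -> G).
Local Open Scope group_scope.

Definition meridian k v : G := m k ^ h k v.

Definition jump i t : G :=
  if info D i t is Under then
    let x := over_at D i t in expgz (meridian x.1 x.2) (crossing_sign D x (i, t))
  else 1.

(* h i t is the developing map of a homomorphism of the group of D: the meridian at
   the point t of the component i is the conjugate of m i by h i t, and lam i is the
   monodromy along the whole component. *)
Definition coloring : Prop :=
  (forall i t, h i (t + 1)%R = lam i * h i t) /\ forall i, steps (h i) (jump i).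

Lemma jump_not_under i t : info D i t <> Under -> jump i t = 1.
Proof. by rewrite /jump; case: (info D i t). Qed.

Hypothesis mlam : forall i, commute (m i) (lam i).
Hypothesis h1 : forall i t, h i (t + 1)%R = lam i * h i t.

Lemma monodromy i t (z : int) : h i (t + z%:~R)%R = expgz (lam i) z * h i t.
Proof.
pose f (s : R) (z : int) := h i (s + z%:~R)%R.
elim/int_rect: z => [|k IH|k IH]; first by rewrite addr0 mul1g.
  by rewrite -addn1 PoszD intrD addrA h1 IH addrC expgzD mulgA.
have E : (1 - k.+1%:Z = - k%:Z)%R by rewrite -addn1 PoszD opprD addrCA subrr addr0.
apply: (mulgI (lam i)); rewrite -h1 -addrA (addrC _ 1%R) -(intrD _ 1) E IH mulgA.
by rewrite -[X in _ = X * _ * _]expgz1 -expgzD E.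
Qed.

(** Commutation of [m k] with [lam k] is what lets the meridian descend to the circle. *)
Lemma meridian_shift k v (z : int) : meridian k (v + z%:~R)%R = meridian k v.
Proof.
by rewrite /meridian monodromy conjgM (commute_conj (commute_expgz _ (mlam k))).
Qed.

Lemma meridian_site x y : same_site x y -> meridian x.1 x.2 = meridian y.1 y.2.
Proof. by case: x y => [k v] [k' v'] [/= <- [z ->]]; rewrite meridian_shift. Qed.

Lemma crossing_sign_site x y z : same_site x y -> crossing_sign D x z = crossing_sign D y z.
Proof.
by case: x y => [k v] [k' v'] [/= <- [a ->]]; rewrite /crossing_sign /= tangent_shift.
Qed.

Lemma jumpE i t k v : info D i t = Under -> crosses (curve D) i t k v ->
  jump i t = expgz (meridian k v) (crossing_sign D (k, v) (i, t)).
Proof.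
move=> it ikv; rewrite /jump it /=.
have ov : crosses (curve D) i t (over_at D i t).1 (over_at D i t).2.
  by apply: (@xgetPex _ (i, t) [set x | crosses (curve D) i t x.1 x.2]); exists (k, v).
have ss : same_site (over_at D i t) (k, v).
  by case: (over_at D i t) ov => a b /= ov; apply: curve_double ov ikv.
by rewrite (meridian_site ss) (crossing_sign_site _ ss).
Qed.

Lemma under_site i t : info D i t = Under ->
  exists k v, crosses (curve D) i t k v /\ info D k v = Over.
Proof.
move=> it; have /info_plain[k [v ikv]] : info D i t <> Plain by rewrite it.
by exists k, v; split=> //; have [[]|[_ ->]|[]] := info_crossing ikv; rewrite ?it.
Qed.

Lemma jump_shift i t (z : int) : jump i (t + z%:~R)%R = jump i t.
Proof.
have [it|it] := pselect (info D i t = Under); last first.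
  by rewrite !jump_not_under // info_shift.
have [k [v [ikv _]]] := under_site it.
have it' : info D i (t + z%:~R)%R = Under by rewrite info_shift.
rewrite (jumpE it ikv) (jumpE it' (crosses_sym (crosses_shift z (crosses_sym ikv)))).
by rewrite /crossing_sign /= tangent_shift.
Qed.

End Def.

Definition colorable G D (m lam : 'I_n -> G) : Prop := exists h, coloring D m lam h.

(** [eps] precedes the quantifier over [G], so that it can be determined in one group and used in
    another. *)
Definition comparable D D' (eps : 'I_n -> int) : Prop :=
  forall G (m lam : 'I_n -> G), (forall i, commute (m i) (lam i)) ->
  colorable D m lam <-> colorable D' m (fun i => expgz (m i) (eps i) * lam i)%g.

Lemma comparable_refl D : comparable D D (fun=> 0).
Proof. by move=> G m lam _; rewrite (_ : (fun i => _) = lam) //; apply/funext => i; rewrite mul1g. Qed.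

Lemma comparable_sym D D' eps : comparable D D' eps -> comparable D' D (fun i => - eps i).
Proof.
move=> DD' G m lam c; rewrite DD'; last first.
  by move=> i; apply: commuteM => //; apply: commute_expgz.
rewrite (_ : (fun i => _) = lam) //; apply/funext => i.
by rewrite mulgA -expgzD subrr mul1g.
Qed.

Lemma comparable_trans D D' D'' eps eps' : comparable D D' eps -> comparable D' D'' eps' ->
  comparable D D'' (fun i => eps' i + eps i).
Proof.
move=> h1 h2 G m lam c.
have c' i : commute (m i) (expgz (m i) (eps i) * lam i)%g.
  by apply: commuteM => //; apply: commute_expgz.
have -> : (fun i => expgz (m i) (eps' i + eps i) * lam i)%g =
    (fun i => expgz (m i) (eps' i) * (expgz (m i) (eps i) * lam i))%g.
  by apply/funext => i; rewrite expgzD mulgA.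
exact: iff_trans (h1 G m lam c) (h2 G m _ c').
Qed.

Section Reparametrization.
Variables (D D' : vdiagram R n) (phi psi : 'I_n -> R -> R).
Hypotheses (phi_lt : forall i, {homo phi i : s t / s < t})
  (psi_lt : forall i, {homo psi i : s t / s < t}).
Hypotheses (phiK : forall i, cancel (phi i) (psi i)) (psiK : forall i, cancel (psi i) (phi i)).
Hypothesis psi1 : forall i t, psi i (t + 1) = psi i t + 1.
Hypothesis infoE : forall i t, info D' i t = info D i (psi i t).
Hypothesis crossE : forall i s k t, crosses (curve D') i s k t ->
  crosses (curve D) i (psi i s) k (psi k t) /\
  crossing_sign D' (k, t) (i, s) = crossing_sign D (k, psi k t) (i, psi i s).

Lemma coloring_reparam G (m lam : 'I_n -> G) h : (forall i, commute (m i) (lam i)) ->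
  coloring D m lam h -> coloring D' m lam (fun i t => h i (psi i t)).
Proof.
move=> c [h1 hs]; have h1' i t : h i (psi i (t + 1)) = (lam i * h i (psi i t))%g.
  by rewrite psi1.
split; first exact: h1'.
move=> i t.
have <- : jump D m h i (psi i t) = jump D' m (fun i t => h i (psi i t)) i t.
  have [it|it] := pselect (info D' i t = Under); last first.
    by rewrite !jump_not_under // -infoE.
  have [k [v [ikv _]]] := under_site it; have [ikv' sE] := crossE ikv.
  have it' : info D i (psi i t) = Under by rewrite -infoE.
  rewrite (jumpE c h1 it' ikv') (jumpE c h1' it ikv) sE; reflexivity.
have [L Rt] := hs i (psi i t); split.
- have [e /= e0 He] : \forall s \near psi i t, (s < psi i t)%R -> h i s = h i (psi i t) by exact: L.
  have : phi i (psi i t - e) < t by rewrite -[ltRHS](psiK i) phi_lt // ltrBlDr ltrDl.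
  move=> lt; near=> s.
  have st : psi i s < psi i t by apply: psi_lt; near: s; exact: nbhs_left_lt.
  apply: He => //; rewrite /ball_ /= gtr0_norm ?subr_gt0 // ltrBlDr -ltrBlDl.
  by rewrite -[ltLHS](phiK i) psi_lt //; near: s; apply: nbhs_left_gt.
- have [e /= e0 He] : \forall s \near psi i t, (psi i t < s)%R -> h i s = (h i (psi i t) * jump D m h i (psi i t))%g by exact: Rt.
  have : t < phi i (psi i t + e) by rewrite -[ltLHS](psiK i) phi_lt // ltrDl.
  move=> lt; near=> s.
  have st : psi i t < psi i s by apply: psi_lt; near: s; exact: nbhs_right_gt.
  apply: He => //; rewrite /ball_ /= ltr0_norm ?subr_lt0 // opprB ltrBlDl.
  by rewrite -[ltRHS](phiK i) psi_lt //; near: s; apply: nbhs_right_lt.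
Unshelve. all: by end_near. Qed.

End Reparametrization.

Lemma reparam_lt (phi : R -> R) : circle_reparam phi -> {homo phi : s t / s < t}.
Proof.
move=> [dphi _ dpos _] s t st.
apply: (@gtr0_derive1_lt_cc _ phi s t) => //; rewrite ?in_itv /= ?lexx ?ltW //.
by apply: derivable_within_continuous => x _; apply: dphi.
Qed.

Lemma shift_equivariant (phi : R -> R) : (forall t, phi (t + 1) = phi t + 1) ->
  forall t (z : int), phi (t + z%:~R) = phi t + z%:~R.
Proof.
move=> p1 t z; have h u : phi (u + 1) - (u + 1) = phi u - u by rewrite p1; ring.
by have := int_periodic h t z => E; lra.
Qed.

Lemma reparam_onto (phi : R -> R) t : circle_reparam phi -> exists s, phi s = t.
Proof.
move=> [dphi _ _ p1].
have pz := shift_equivariant p1.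
pose z := Num.floor (t - phi 0).
have /andP[z1 z2] := floor_itv (t - phi 0).
have cphi : {within `[z%:~R, (z + 1)%:~R], continuous phi}.
  by apply: derivable_within_continuous => x _; apply: dphi.
have zz : (z%:~R : R) <= (z + 1)%:~R by rewrite ler_int lerDl.
have [|c _ <-] := IVT (v := t) zz cphi; last by exists c.
have e1 : phi z%:~R = phi 0 + z%:~R by rewrite -pz add0r.
have e2 : phi (z + 1)%:~R = phi 0 + (z + 1)%:~R by rewrite -pz add0r.
rewrite e1 e2 ge_min le_max; apply/andP; split; apply/orP; [left|right].
  by rewrite -lerBrDl.
by rewrite -lerBlDl ltW.
Qed.

Lemma isotopic_comparable D D' : isotopic D D' -> comparable D D' (fun=> 0).
Proof.
move=> [H [phi [isoH rphi cE iE]]].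
have /choice[psi psiP] : forall i, exists psi : R -> R, forall t, phi i (psi t) = t.
  by move=> i; have [psi h] := choice (fun t => reparam_onto t (rphi i)); exists psi.
have phi_lt i := reparam_lt (rphi i).
have phi_inj i : injective (phi i).
  by move=> s t; case: (ltgtP s t) => // /(phi_lt i) h e; move: h; rewrite e ltxx.
have phiK i : cancel (phi i) (psi i) by move=> t; apply: (phi_inj i); rewrite psiP.
have psi_lt i : {homo psi i : s t / s < t}.
  move=> s t st; rewrite ltNge le_eqVlt; apply/negP => /orP[/eqP e|/(phi_lt i)].
    by move: st; rewrite -(psiP i s) -(psiP i t) e ltxx.
  by rewrite !psiP ltNge (ltW st).
have phi1 i t : phi i (t + 1) = phi i t + 1 by have [_ _ _] := rphi i.
have psi1 i t : psi i (t + 1) = psi i t + 1 by apply: (phi_inj i); rewrite phi1 !psiP.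
have [/(_ 1) d1 _ _ _] := isoH; have [[df _] [g [_ HK gK]]] := d1.
have sameE i s k t : same_site (i, phi i s) (k, phi k t) <-> same_site (i, s) (k, t).
  have pz i' := shift_equivariant (phi1 i').
  split=> -[/= e [z ez]]; subst k; split=> //; exists z.
    by apply: (phi_inj i); rewrite pz.
  by rewrite ez pz.
have crossP i s k t : crosses (curve D') i (phi i s) k (phi k t) <-> crosses (curve D) i s k t.
  split=> -[e ns]; split; try by move=> /sameE.
    by move: e; rewrite !cE => /(can_inj HK).
  by rewrite !cE e.
(* Reparametrization scales the tangents by positive factors and [H 1] multiplies determinants by a
   positive Jacobian; signs of crossings survive both. *)
have tE i t : exists2 r, 0 < r & 'd (H 1) (curve D i t) (tangent D i t) = (r : R) *: tangent D' i (phi i t).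
  exists (derive1 (phi i) t); first by have [_ _ + _] := rphi i.
  have [dHc <-] := derive1_comp_plane (df (curve D i t)) (@curve_derivable _ _ D i t).
  have -> : (H 1 \o curve D i) = (curve D' i \o phi i) by apply/funext => u /=; rewrite cE.
  have [/(_ t)/derivable1_diffP dphi _ _ _] := rphi i.
  have /derivable1_diffP dc := @curve_derivable _ _ D' i (phi i t).
  have -> : derive1 (phi i) t = 'd (phi i) t 1 by rewrite derive1E deriveE.
  have := derive1_plane (differentiable_comp dphi dc); rewrite (diff_comp dphi dc) /= => ->.
  by rewrite /tangent (derive1_plane dc) -linearZ /GRing.scale /= mulr1.
have signE i s k t : curve D k t = curve D i s ->
    crossing_sign D' (k, phi k t) (i, phi i s) = crossing_sign D (k, t) (i, s).
  move=> ets; have [r1 r10 e1] := tE k t; have [r2 r20 e2] := tE i s.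
  rewrite -ets in e2; have := det2_diff (tangent D k t) (tangent D i s) (df (curve D k t)).
  rewrite e1 e2 det2Z => E.
  have j0 : 0 < jac (H 1) (curve D k t) := isotopy_jac _ isoH.
  apply: (sgz_scale r10 r20 j0).
  exact: E.
move=> G m lam c.
have -> : (fun i => expgz (m i) 0 * lam i)%g = lam by apply/funext => i; rewrite mul1g.
split=> -[h hh].
  exists (fun i t => h i (psi i t)); apply: (coloring_reparam phi_lt psi_lt phiK psiP psi1 _ _ c hh).
    by move=> i t; rewrite -iE psiP.
  move=> i s k t; have E := crossP i (psi i s) k (psi k t); rewrite !psiP in E.
  move=> /E ikst; split; first exact: ikst.
  have S := signE i (psi i s) k (psi k t); rewrite !psiP in S.
  by apply: S; case: ikst.
exists (fun i t => h i (phi i t)); apply: (coloring_reparam psi_lt phi_lt psiP phiK phi1 _ _ c hh).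
  by move=> i t; rewrite iE.
by move=> i s k t ikst; split; [apply/crossP|apply/esym/signE; case: ikst].
Qed.

End Colorings.

(** * Invariance under the welded moves *)

Section Surgery.
Variables (R : realType) (n : nat).

Lemma int_close (a b : int) : `|a%:~R - b%:~R| < 1 :> R -> a = b.
Proof.
move=> h; apply/eqP; rewrite -subr_eq0 -normr_le0 -ltzD1 add0r.
by rewrite -(ltr_int R) intr_norm intrB.
Qed.

Lemma int_window (x t : R) : exists z : int, x <= t + z%:~R < x + 1.
Proof.
exists (- Num.floor (t - x)); have /andP[h1 h2] := floor_itv (t - x).
by rewrite intrD in h2; rewrite mulrNz; apply/andP; split; lra.
Qed.

Lemma int_window' (x t : R) : exists z : int, x < t + z%:~R <= x + 1.
Proof.
have [z /andP[]] := int_window x t; rewrite le_eqVlt => /orP[/eqP e _|h1 /ltW h2].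
  by exists (z + 1); rewrite intrD addrA -e lexx ltrDl ltr01.
by exists z; rewrite h1.
Qed.

Lemma window_clash (a b s : R) (z z' : int) : a <= s + z'%:~R <= b ->
  ~ (b < s + z%:~R < a + 1) /\ (b <= s + z%:~R <= a + 1 -> a < s + z'%:~R < b -> False).
Proof.
move=> /andP[h1 h2]; have [lt|le] := ltP z' z.
  have {lt} : z' + 1 <= z by rewrite lezD1.
  rewrite -(ler_int R) intrD => h.
  by split=> [/andP[? ?]|/andP[? ?] /andP[? ?]]; lra.
move: le; rewrite -(ler_int R) => h.
by split=> [/andP[? ?]|/andP[? ?] /andP[? ?]]; lra.
Qed.

Lemma left_shift (G : groupType) (g : R -> G) t a : left_const g (t + a) ->
  left_const (fun s => g (s + a)) t.
Proof.
move=> L; have [e /= e0 He] : \forall s \near t + a, (s < t + a)%R -> g s = g (t + a) by exact: L.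
near=> s; apply: He; last by rewrite ltrD2r; near: s; exact: nbhs_left_lt.
have st : s < t by near: s; exact: nbhs_left_lt.
have st' : t - e < s by near: s; apply: nbhs_left_gt; lra.
by rewrite /ball_ /= opprD addrACA subrr addr0 gtr0_norm; lra.
Unshelve. all: by end_near. Qed.

Lemma right_shift (G : groupType) (g : R -> G) t a c : right_jump g (t + a) c ->
  right_jump (fun s => g (s + a)) t c.
Proof.
move=> L; have [e /= e0 He] : \forall s \near t + a, (t + a < s)%R -> g s = (g (t + a) * c)%g by exact: L.
near=> s; apply: He; last by rewrite ltrD2r; near: s; exact: nbhs_right_gt.
have st : t < s by near: s; exact: nbhs_right_gt.
have st' : s < t + e by near: s; apply: nbhs_right_lt; lra.
by rewrite /ball_ /= opprD addrACA subrr addr0 ltr0_norm; lra.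
Unshelve. all: by end_near. Qed.

Variables (D D' : vdiagram R n) (K : nat) (S : 'I_K -> strand R n).
Hypothesis LC : local_change D D' S.

Lemma strand_short j : src (S j) < tgt (S j) < src (S j) + 1.
Proof. by case: LC => h _ _ _; apply: h. Qed.

Lemma strand_unique j l i t (z z' : int) :
  strand_comp (S j) = i -> src (S j) <= t + z%:~R <= tgt (S j) ->
  strand_comp (S l) = i -> src (S l) <= t + z'%:~R <= tgt (S l) -> j = l /\ z = z'.
Proof.
move=> ji jz li lz; have [sh dis _ _] := LC.
have E : j = l.
  by apply: (dis j l i t); [split=> //; exists z|split=> //; exists z'].
subst l; split=> //; apply: int_close.
by have := sh j; move: jz lz => /andP[? ?] /andP[? ?] /andP[? ?]; rewrite ltr_norml; apply/andP; split; lra.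
Qed.

Lemma outside_window j i s (z : int) : strand_comp (S j) = i ->
  tgt (S j) <= s + z%:~R <= src (S j) + 1 -> ~ inside_strand (S j) i s.
Proof.
move=> ji h [_ [a ha]]; have /andP[/ltW a1 /ltW a2] := ha.
by apply: (proj2 (@window_clash _ _ s z a _) h ha); rewrite a1.
Qed.

Definition off i t := ~ exists j, on_strand (S j) i t.
Definition not_inside i t := ~ exists j, inside_strand (S j) i t.

Lemma off_not_inside i t : off i t -> not_inside i t.
Proof.
move=> o [j [ji [z /andP[h1 h2]]]]; apply: o; exists j; split=> //; exists z.
by rewrite !ltW.
Qed.

(** Equality of the curves at one point says nothing about tangents; openness of [off] gives
    equality on a neighbourhood. *)
Lemma off_near i t : off i t -> \forall s \near t, off i s.
Proof.
move=> o; suff : \forall s \near t, forall j, ~ on_strand (S j) i s.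
  by apply: filterS => s h [j]; apply: h.
refine (@filter_forall _ _ (fun j s => ~ on_strand (S j) i s) (nbhs t) _ _) => j.
have [ji|ji] := pselect (strand_comp (S j) = i); last by apply: nearW => s [].
have [z /andP[z1 z2]] := int_window (src (S j)) t.
have tz : tgt (S j) < t + z%:~R.
  by rewrite ltNge; apply/negP => h; apply: o; exists j; split=> //; exists z; rewrite z1.
have /andP[sh1 sh2] := strand_short j.
have t1 : tgt (S j) - z%:~R < t by rewrite ltrBlDr.
have t2 : t < src (S j) + 1 - z%:~R by rewrite ltrBrDr.
near=> s; move=> [_ [a ha]]; apply: (proj1 (@window_clash _ _ s z a ha)).
have s1 : tgt (S j) - z%:~R < s by near: s; exact: (lt_nbhsr t1).
have s2 : s < src (S j) + 1 - z%:~R by near: s; exact: (lt_nbhsl t2).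
by rewrite -ltrBlDr s1 -ltrBrDr s2.
Unshelve. all: by end_near. Qed.

(** By [disc_meets], being off the strands means lying outside the closed disc, a property of the
    point of the plane and so of both passages through it. *)
Lemma off_crossing i t k v : off i t -> crosses (curve D) i t k v -> off k v.
Proof.
have [_ _ [f _ [[dm _] _]] _] := LC.
by move=> o [e _] /(dm k v).2; rewrite -e => /(dm i t).1.
Qed.

Lemma off_tangent i t : off i t -> tangent D' i t = tangent D i t.
Proof.
move=> o; rewrite /tangent !derive1E; apply: near_eq_derive.
have := off_near o; apply: filterS => s /off_not_inside os.
by have [_ _ _ E] := LC; have [] := E i s os.
Qed.

(** A point that is not inside is either [off], where the two diagrams agree locally, or an endpoint
    of a strand, where [plain] excludes a crossing. *)
Lemma jump_outside (G : groupType) (m lam lam' : 'I_n -> G) (h h' : 'I_n -> R -> G) i t :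
  (forall j, info D (strand_comp (S j)) (src (S j)) = Plain /\
             info D (strand_comp (S j)) (tgt (S j)) = Plain) ->
  (forall i, commute (m i) (lam i)) -> (forall i, commute (m i) (lam' i)) ->
  (forall i t, h i (t + 1) = lam i * h i t)%g ->
  (forall i t, h' i (t + 1) = lam' i * h' i t)%g ->
  (forall k v, off k v -> meridian m h' k v = meridian m h k v) ->
  not_inside i t -> jump D' m h' i t = jump D m h i t.
Proof.
move=> plain c c' h1 h1' mE ni; have [_ _ _ E] := LC; have [_ iE] := E i t ni.
have [it|it] := pselect (info D i t = Under); last first.
  by rewrite !jump_not_under // iE.
have o : off i t.
  move=> [j [ji [z /andP[]]]]; have [p1 p2] := plain j.
  rewrite le_eqVlt => /orP[/eqP e _|a1].
    by move: it; rewrite -(info_shift D i t z) -e -ji p1.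
  rewrite le_eqVlt => /orP[/eqP e|a2].
    by move: it; rewrite -(info_shift D i t z) e -ji p2.
  by apply: ni; exists j; split=> //; exists z; rewrite a1.
have [k [v [ikv _]]] := under_site it; have o' := off_crossing o ikv.
have ikv' : crosses (curve D') i t k v.
  case: ikv => e ns; split=> //.
  by rewrite (proj1 (E i t ni)) (proj1 (E k v (off_not_inside o'))).
have it' : info D' i t = Under by rewrite iE.
rewrite (jumpE c' h1' it' ikv') (jumpE c h1 it ikv) (mE _ _ o').
by rewrite /crossing_sign /= !off_tangent.
Qed.

Section Patch.
Variables (G : groupType) (m lam : 'I_n -> G) (h : 'I_n -> R -> G) (kk : 'I_K -> R -> G).
Hypothesis c : forall i, commute (m i) (lam i).
Hypothesis hh : coloring D m lam h.
Local Open Scope group_scope.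

(* h, with its values inside the strands S j replaced by those of kk j. *)
Definition patch i t : G :=
  match pselect (exists jz : 'I_K * int, strand_comp (S jz.1) = i /\
                   (src (S jz.1) < t + jz.2%:~R < tgt (S jz.1))%R) with
  | left e => let jz := sval (cid e) in expgz (lam i) (- jz.2)%R * kk jz.1 (t + jz.2%:~R)%R
  | right _ => h i t
  end.

Lemma patch_off i t : not_inside i t -> patch i t = h i t.
Proof.
rewrite /patch; case: pselect => // -[[j z] [ji jz]] []; exists j; split=> //.
by exists z.
Qed.

Hypothesis ends : forall j, kk j (src (S j)) = h (strand_comp (S j)) (src (S j)) /\
                           kk j (tgt (S j)) = h (strand_comp (S j)) (tgt (S j)).

Lemma patch_on j i t (z : int) : strand_comp (S j) = i ->
  (src (S j) <= t + z%:~R <= tgt (S j))%R ->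
  patch i t = expgz (lam i) (- z)%R * kk j (t + z%:~R)%R.
Proof.
move=> ji tz; rewrite /patch; case: pselect => [e|ne].
  case: (cid e) => -[l z'] /= [li /andP[l1 l2]].
  have [|<- <-] := strand_unique ji tz li (z' := z'); first by rewrite !ltW.
  by [].
have E : h i (t + z%:~R)%R = kk j (t + z%:~R)%R.
  have [e1 e2] := ends j; move: tz => /andP[]; rewrite le_eqVlt => /orP[/eqP <- _|a1].
    by rewrite e1 ji.
  rewrite le_eqVlt => /orP[/eqP->|a2]; first by rewrite e2 ji.
  by case: ne; exists (j, z); rewrite a1.
by rewrite -E -(monodromy (proj1 hh)) -addrA -intrD subrr addr0.
Qed.

Lemma patch1 i t : patch i (t + 1)%R = lam i * patch i t.
Proof.
have [[j [ji [z /andP[a1 a2]]]]|o] := pselect (exists j, inside_strand (S j) i t).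
  have e : (t + 1 + (z - 1)%:~R = t + z%:~R)%R by rewrite intrB; lra.
  rewrite (@patch_on j i t z ji); last by rewrite !ltW.
  rewrite (@patch_on j i (t + 1) (z - 1) ji); last by rewrite e !ltW.
  by rewrite e mulgA; congr (_ * _); rewrite -[X in _ = X * _]expgz1 -expgzD opprB.
rewrite !patch_off //; first exact: (proj1 hh).
move=> [j [ji [z /andP[a1 a2]]]]; apply: o; exists j; split=> //; exists (z + 1).
by rewrite intrD; apply/andP; split; lra.
Qed.

Hypothesis plain : forall j, info D (strand_comp (S j)) (src (S j)) = Plain /\
                             info D (strand_comp (S j)) (tgt (S j)) = Plain.
Hypothesis kk_left : forall j u, (src (S j) < u <= tgt (S j))%R -> left_const (kk j) u.
Hypothesis kk_right : forall j u, (src (S j) <= u < tgt (S j))%R ->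
  right_jump (kk j) u (jump D' m patch (strand_comp (S j)) u).

(** Left behaviour follows [kk] on strands without their source, right behaviour on strands without
    their target. At all other points the corresponding side lies outside the open strands, and
    [patch] is [h] there. *)
Lemma patch_coloring : coloring D' m lam patch.
Proof.
split=> [|i t]; first exact: patch1.
have st := proj2 hh i t; split.
- have [[j [z [ji tz]]]|no] := pselect (exists j (z : int), strand_comp (S j) = i /\
      (src (S j) < t + z%:~R <= tgt (S j))%R).
    have L := left_shift (kk_left tz); move: tz => /andP[t1 t2].
    rewrite /left_const (@patch_on j i t z ji); last by rewrite t2 ltW.
    near=> s; rewrite (@patch_on j i s z ji); last first.
      have h1 : (s < t)%R by near: s; exact: nbhs_left_lt.
      have h2 : (src (S j) - z%:~R < s)%R by near: s; apply: nbhs_left_gt; lra.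
      by apply/andP; split; lra.
    by congr (_ * _); near: s; exact: L.
  have ni : not_inside i t.
    by move=> [j [ji [z /andP[a1 a2]]]]; apply: no; exists j, z; split=> //; rewrite a1 ltW.
  rewrite /left_const (patch_off ni).
  have ns : \forall s \near t^'-, forall j, ~ inside_strand (S j) i s.
    refine (@filter_forall _ _ (fun j s => ~ inside_strand (S j) i s) (t^'-) _ _) => j.
    have [ji|ji] := pselect (strand_comp (S j) = i); last by apply: nearW => s [].
    have [z /andP[z1 z2]] := int_window' (src (S j)) t.
    have tz : (tgt (S j) < t + z%:~R)%R.
      by rewrite ltNge; apply/negP => a; apply: no; exists j, z; rewrite z1.
    near=> s; apply: (outside_window ji (z := z)).
    have h1 : (s < t)%R by near: s; exact: nbhs_left_lt.
    have h2 : (tgt (S j) - z%:~R < s)%R by near: s; apply: nbhs_left_gt; lra.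
    by apply/andP; split; lra.
  near=> s; rewrite patch_off; last by move=> [j]; apply: (near ns s).
  by near: s; exact: (proj1 st).
- have [[j [z [ji tz]]]|no] := pselect (exists j (z : int), strand_comp (S j) = i /\
      (src (S j) <= t + z%:~R < tgt (S j))%R).
    have L := right_shift (kk_right tz); move: tz => /andP[t1 t2].
    rewrite ji (jump_shift D' c patch1) in L.
    rewrite /right_jump (@patch_on j i t z ji); last by rewrite t1 ltW.
    near=> s; rewrite (@patch_on j i s z ji); last first.
      have h1 : (t < s)%R by near: s; exact: nbhs_right_gt.
      have h2 : (s < tgt (S j) - z%:~R)%R by near: s; apply: nbhs_right_lt; lra.
      by apply/andP; split; lra.
    by rewrite -mulgA; congr (_ * _); near: s; exact: L.
  have ni : not_inside i t.
    by move=> [j [ji [z /andP[a1 a2]]]]; apply: no; exists j, z; split=> //; rewrite a2 ltW.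
  rewrite /right_jump (patch_off ni) (jump_outside plain c c (proj1 hh) patch1 _ ni); last first.
    by move=> k v /off_not_inside o; rewrite /meridian patch_off.
  have ns : \forall s \near t^'+, forall j, ~ inside_strand (S j) i s.
    refine (@filter_forall _ _ (fun j s => ~ inside_strand (S j) i s) (t^'+) _ _) => j.
    have [ji|ji] := pselect (strand_comp (S j) = i); last by apply: nearW => s [].
    have [z /andP[z1 z2]] := int_window (src (S j)) t.
    have tz : (tgt (S j) <= t + z%:~R)%R.
      by rewrite leNgt; apply/negP => a; apply: no; exists j, z; rewrite z1.
    near=> s; apply: (outside_window ji (z := z)).
    have h1 : (t < s)%R by near: s; exact: nbhs_right_gt.
    have h2 : (s < src (S j) + 1 - z%:~R)%R by near: s; apply: nbhs_right_lt; lra.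
    by apply/andP; split; lra.
  near=> s; rewrite patch_off; last by move=> [j]; apply: (near ns s).
  by near: s; exact: (proj2 st).
Unshelve. all: by end_near. Qed.

End Patch.
End Surgery.

(** * The moves R1 and V1 *)

Section Kinks.
Variables (R : realType) (n : nat).
Implicit Types (D : vdiagram R n) (G : groupType).

Lemma local_change_sym D D' k (S : 'I_k -> strand R n) :
  local_change D D' S -> local_change D' D S.
Proof.
move=> [h1 h2 [f hf [h3 h4]] h5]; split=> //; first by exists f.
by move=> i t /h5[-> ->].
Qed.

(* The number of passages of the points y + Z on the way from y to t. *)
Definition laps (y t : R) : int := - Num.floor (y - t).

Lemma lapsE y t z : (z - 1)%:~R < t - y <= z%:~R -> laps y t = z.
Proof.
move=> /andP[h1 h2]; rewrite /laps (@floor_def _ _ (- z)) ?opprK //.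
by rewrite intrD mulrNz; rewrite intrB in h1; apply/andP; split; lra.
Qed.

Lemma laps_itv y t : (laps y t - 1)%:~R < t - y <= (laps y t)%:~R.
Proof.
have /andP[h1 h2] := floor_itv (y - t).
rewrite /laps intrB mulrNz; rewrite intrD in h2.
by apply/andP; split; lra.
Qed.

Lemma laps1 y t : laps y (t + 1) = laps y t + 1.
Proof.
apply: lapsE; have /andP[h1 h2] := laps_itv y t.
by rewrite addrK intrD; rewrite intrB in h1; apply/andP; split; lra.
Qed.

Lemma laps_left y t : \forall s \near t^'-, laps y s = laps y t.
Proof.
have /andP[h1 h2] := laps_itv y t.
near=> s; apply: lapsE.
have st : s < t by near: s; exact: nbhs_left_lt.
have h3 : y + (laps y t - 1)%:~R < s by near: s; apply: nbhs_left_gt; lra.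
by apply/andP; split; lra.
Unshelve. all: by end_near. Qed.

Lemma laps_right y t : ~ same_point y t -> \forall s \near t^'+, laps y s = laps y t.
Proof.
move=> ns; have /andP[h1] := laps_itv y t; rewrite le_eqVlt => /orP[/eqP e|h2].
  by case: ns; exists (laps y t); rewrite -e addrC subrK.
near=> s; apply: lapsE.
have st : t < s by near: s; exact: nbhs_right_gt.
have h3 : s < y + (laps y t)%:~R by near: s; apply: nbhs_right_lt; lra.
by apply/andP; split; lra.
Unshelve. all: by end_near. Qed.

Lemma laps_right1 y t : same_point y t -> \forall s \near t^'+, laps y s = laps y t + 1.
Proof.
move=> [z tz]; have -> : laps y t = z.
  by apply: lapsE; rewrite tz intrB; apply/andP; split; lra.
near=> s; apply: lapsE.
have st : t < s by near: s; exact: nbhs_right_gt.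
have h3 : s < t + 1 by near: s; apply: nbhs_right_lt; lra.
by rewrite addrK intrD; apply/andP; split; lra.
Unshelve. all: by end_near. Qed.

Section Twist.
Variables (G : groupType) (m lam : 'I_n -> G) (h : 'I_n -> R -> G).
Variables (i0 : 'I_n) (y : R) (e : int).
Hypothesis c : forall i, commute (m i) (lam i).
Local Open Scope group_scope.

(** Left multiplication by powers of [m i] changes no meridian, so it may extend along the whole
    line. Its effects are a factor in the monodromy and an additional jump at the translates of
    [y]. *)
Definition twist i t : G := if i == i0 then expgz (m i) (e * laps y t)%R * h i t else h i t.
Definition twist_lam i : G := expgz (m i) (if i == i0 then e else 0) * lam i.

Lemma twist_commute i : commute (m i) (twist_lam i).
Proof. by apply: commuteM => //; apply: commute_expgz. Qed.

Lemma twist_meridian k v : meridian m twist k v = meridian m h k v.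
Proof.
rewrite /meridian /twist; case: eqP => // _.
by rewrite conjgM (commute_conj (commute_expgz _ (commute_refl _))).
Qed.

Hypothesis h1 : forall i t, h i (t + 1)%R = lam i * h i t.

Lemma twist1 i t : twist i (t + 1)%R = twist_lam i * twist i t.
Proof.
rewrite /twist /twist_lam; case: eqP => _; last by rewrite h1 mul1g.
rewrite laps1 mulrDr mulr1 h1 expgzD -!mulgA.
have E := commute_expgz (e * laps y t) (commute_sym (c i)).
rewrite (mulgA (lam i)) (E : _ * _ = _ * _) !mulgA; congr (_ * _ * _).
by rewrite -!expgzD addrC.
Qed.

Lemma twist_coloring D D' : coloring D m lam h ->
  (forall i t, ~ (i = i0 /\ same_point y t) -> jump D' m twist i t = jump D m h i t) ->
  (forall t, same_point y t -> jump D' m twist i0 t =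
     expgz (meridian m h i0 t) e * jump D m h i0 t) ->
  coloring D' m twist_lam twist.
Proof.
move=> hh J0 J1; split=> [|i t]; first exact: twist1.
have [L Rt] := proj2 hh i t; split.
  have LL := laps_left y t.
  rewrite /left_const /twist; case: eqP => _ //.
  near=> s; have -> : laps y s = laps y t by near: s.
  by congr (_ * _); near: s.
have [[ii sp]|no] := pselect (i = i0 /\ same_point y t); last first.
  rewrite /right_jump J0 // /twist; case: eqP => ii //.
  have LL : \forall s \near t^'+, laps y s = laps y t.
    by apply: laps_right => sp; apply: no.
  near=> s; have -> : laps y s = laps y t by near: s.
  by rewrite -mulgA; congr (_ * _); near: s.
subst i; have LL := laps_right1 sp.
rewrite /right_jump J1 // /twist eqxx; near=> s.
have -> : laps y s = (laps y t + 1)%R by near: s.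
have -> : h i0 s = h i0 t * jump D m h i0 t by near: s.
rewrite mulrDr mulr1 expgzD -!mulgA; congr (_ * _).
(* A power of [m i0] to the left of [h i0 t] is the same power of the meridian to its right. *)
rewrite /meridian -expgz_conj conjgE !mulgA mulgV mul1g.
by [].
Unshelve. all: by end_near. Qed.

End Twist.

Section Kink.
Variables (D D' : vdiagram R n) (S : strand R n) (x y : R) (e : int).
Hypothesis LC : local_change D D' (fun _ : 'I_1 => S).
Hypothesis noD : no_crossing D S.
Local Notation i0 := (strand_comp S).
Hypotheses (yS : src S < y < tgt S) (xS : src S < x < tgt S).
Hypothesis under_y : forall u, src S <= u <= tgt S -> info D' i0 u = Under -> u = y.
Hypothesis kink_y :
  (info D' i0 y = Under /\ crosses (curve D') i0 y i0 x /\
     e = crossing_sign D' (i0, x) (i0, y)) \/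
  (info D' i0 y <> Under /\ e = 0).

Let plain : forall j : 'I_1, info D (strand_comp S) (src S) = Plain /\
                             info D (strand_comp S) (tgt S) = Plain.
Proof.
by move=> _; have /andP[s1 _] := strand_short LC ord0; split; apply: noD; rewrite lexx ltW.
Qed.

Lemma kink_jump0 G (m lam lam' : 'I_n -> G) h h' i t :
  (forall i, commute (m i) (lam i)) -> (forall i, commute (m i) (lam' i)) ->
  (forall i t, h i (t + 1) = lam i * h i t)%g ->
  (forall i t, h' i (t + 1) = lam' i * h' i t)%g ->
  (forall k v, meridian m h' k v = meridian m h k v) ->
  ~ (i = i0 /\ same_point y t) -> jump D' m h' i t = jump D m h i t.
Proof.
move=> c c' h1 h1' mE no.
have [ni|/notP ni] := pselect (not_inside (fun _ : 'I_1 => S) i t).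
  by apply: (jump_outside LC plain c c' h1 h1' _ ni) => k v _.
have [j [ji [z /andP[/ltW z1 /ltW z2]]]] := ni.
have zz : src S <= t + z%:~R <= tgt S by rewrite z1.
subst i; rewrite !jump_not_under //.
  by rewrite -(info_shift D i0 t z) noD.
move=> it; apply: no; split=> //; have := under_y zz; rewrite info_shift => /(_ it) <-.
by apply: same_point_sym; exists z.
Qed.

(** If the over-passage [x] follows the under-passage [y], the only jump in between is a power of
    the meridian at [x] itself, and conjugation by it fixes that meridian. *)
Let xy_meridian G (m lam : 'I_n -> G) h : (forall i, commute (m i) (lam i)) ->
  coloring D' m lam h -> info D' i0 y = Under -> crosses (curve D') i0 y i0 x ->
  meridian m h i0 x = meridian m h i0 y.
Proof.
move=> c hh uy yx; have := jumpE c (proj1 hh) uy yx.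
set a := crossing_sign _ _ _ => J.
have J1 u : src S <= u <= tgt S -> u != y -> jump D' m h i0 u = 1%g.
  move=> uS /eqP uy'; apply: jump_not_under => /(under_y uS); exact: uy'.
have st := proj2 hh i0; move: xS yS => /andP[x1 x2] /andP[y1 y2].
case: (ltgtP x y) => [xy|xy|->//].
  congr (_ ^ _)%g; apply/esym; apply: (steps_const st); first exact: ltW.
  move=> u /andP[u1 u2]; apply: J1; last by rewrite lt_eqF.
  by apply/andP; split; lra.
have W := @steps_walk_open _ _ _ _ y (tgt S) (h i0 y * jump D' m h i0 y)%g [::] st.
have E : h i0 x = (h i0 y * jump D' m h i0 y)%g.
  apply: W => //; first by have [_] := st y.
    move=> u /andP[u1 u2] _; apply: J1; last by rewrite gt_eqF.
    by apply/andP; split; lra.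
  by rewrite xy ltW.
set M := meridian m h i0 x in J *.
have MJ : (M ^ (expgz M a)^-1)%g = M.
  by apply: commute_conj; apply: commuteV; apply: commute_expgz.
have EM : M = (meridian m h i0 y ^ expgz M a)%g by rewrite {1}/M /meridian E conjgM J.
by rewrite -[RHS](conjgK (expgz M a)) -EM MJ.
Qed.

(** The jump at the kink is a power of the strand's own meridian. It cannot be compensated inside
    the disc; [twist] moves it into the monodromy. *)
Lemma kink_comparable : comparable D D' (fun i => if i == i0 then e else 0).
Proof.
move=> G m lam c; split=> -[h hh].
  exists (twist m h i0 y e).
  have h1' := twist1 i0 y e c (proj1 hh); have c' := twist_commute i0 e c.
  apply: (twist_coloring c (proj1 hh) hh) => [i t no|t [z tz]].
    by apply: (kink_jump0 c c' (proj1 hh) h1' _ no) => k v; apply: twist_meridian.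
  rewrite [jump D _ _ _ _]jump_not_under ?mulg1; last first.
    by rewrite tz info_shift noD //; move: yS => /andP[? ?]; rewrite !ltW.
  rewrite tz (meridian_shift c (proj1 hh)).
  have -> : jump D' m (twist m h i0 y e) i0 (y + z%:~R) = jump D' m (twist m h i0 y e) i0 y.
    exact: (jump_shift D' c' h1').
  case: kink_y => [[uy [yx ee]]|[nuy ->]]; last by rewrite jump_not_under.
  rewrite (jumpE c' h1' uy yx) twist_meridian -ee; congr (expgz _ _).
  congr (_ ^ _)%g; have st := proj2 hh i0; move: xS yS => /andP[x1 x2] /andP[y1 y2].
  have cst u v : src S <= u -> v <= tgt S -> u <= v -> h i0 v = h i0 u.
    move=> su vt uv; apply: (steps_const st) => // w /andP[w1 w2].
    by apply: jump_not_under; rewrite noD //; apply/andP; split; lra.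
  by case: (ltP x y) => xy; [apply/esym|]; apply: cst; lra.
pose lam' i := (expgz (m i) (if i == i0 then e else 0) * lam i)%g.
have c' i : commute (m i) (lam' i) by apply: twist_commute.
have h1 := twist1 i0 y (- e) c' (proj1 hh); have c'' := twist_commute i0 (- e) c'.
have <- : twist_lam m lam' i0 (- e) = lam.
  apply/funext => i; rewrite /twist_lam /lam' mulgA -expgzD.
  by case: eqP; rewrite ?addNr ?add0r mul1g.
exists (twist m h i0 y (- e)); apply: (twist_coloring c' (proj1 hh) hh) => [i t no|t [z tz]].
  apply/esym; apply: (kink_jump0 c'' c' h1 (proj1 hh) _ no) => k v.
  by apply/esym/twist_meridian.
rewrite [jump D _ _ _ _]jump_not_under; last first.
  by rewrite tz info_shift noD //; move: yS => /andP[? ?]; rewrite !ltW.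
rewrite tz (meridian_shift c' (proj1 hh)).
rewrite (jump_shift D' c' (proj1 hh)).
case: kink_y => [[uy [yx ee]]|[nuy ->]]; last by rewrite jump_not_under // mulg1.
by rewrite (jumpE c' (proj1 hh) uy yx) (xy_meridian c' hh uy yx) ee expgzN mulVg.
Qed.

End Kink.
End Kinks.

Section LocalMoves.
Variables (R : realType) (n : nat).
Implicit Types (D : vdiagram R n) (G : groupType).

Lemma kink_move_comparable virtual D D' : kink_move virtual D D' -> exists eps, comparable D D' eps.
Proof.
move=> [S [LC noD [s [t [[ss /andP[st tt]] cst only _]]]]].
have sS : src S < s < tgt S by rewrite ss (lt_trans st).
have tS : src S < t < tgt S by rewrite tt (lt_trans ss).
have only' u : src S <= u <= tgt S -> info D' (strand_comp S) u = Under -> u = s \/ u = t.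
  by move=> uS iu; apply: only => //; rewrite iu.
have X : crosses (curve D') (strand_comp S) s (strand_comp S) t.
  split=> // -[_ [z tz]]; have /andP[_ sh] := strand_short LC ord0.
  have z0 : z = 0.
    move: sS tS sh => /andP[h1 h2] /andP[h3 h4] h5.
    apply: (@int_close R); move: tz st h1 h2 h3 h4 h5; rewrite subr0 /=; clear.
    by move=> tz ? ? ? ? ? ?; rewrite ltr_norml; apply/andP; split; lra.
  by move: st; rewrite (_ : t = s) ?ltxx // -[RHS]addr0; move: tz; rewrite z0.
have [[is' it]|[is' it]|[is' it]] := info_crossing X.
- exists (fun i => if i == strand_comp S then crossing_sign D' (strand_comp S, s) (strand_comp S, t) else 0).
  apply: (kink_comparable LC noD tS sS) => [u uS iu|]; last first.
    by left; split; [|split; [exact: crosses_sym|]].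
  by have [us|//] := only' u uS iu; rewrite us is' in iu.
- exists (fun i => if i == strand_comp S then crossing_sign D' (strand_comp S, t) (strand_comp S, s) else 0).
  apply: (kink_comparable LC noD sS tS) => [u uS iu|]; last by left; split.
  by have [//|us] := only' u uS iu; rewrite us it in iu.
- exists (fun i => if i == strand_comp S then 0 else 0).
  apply: (kink_comparable LC noD sS tS) => [u uS iu|]; last by right; rewrite is'.
  by have [//|us] := only' u uS iu; rewrite us it in iu.
Qed.

Section Steps.
Variables (D D' : vdiagram R n) (K : nat) (S : 'I_K -> strand R n).
Hypothesis LC : local_change D D' S.
Hypothesis plain : forall j, info D (strand_comp (S j)) (src (S j)) = Plain /\
                             info D (strand_comp (S j)) (tgt (S j)) = Plain.

Lemma distinct_crosses j l u v : j != l ->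
  src (S j) <= u <= tgt (S j) -> src (S l) <= v <= tgt (S l) ->
  curve D (strand_comp (S j)) u = curve D (strand_comp (S l)) v ->
  crosses (curve D) (strand_comp (S j)) u (strand_comp (S l)) v.
Proof.
move=> jl uS vS e; split=> // -[/= ji [z vz]]; move: jl; apply/negP; rewrite negbK.
have [_ dis _ _] := LC; apply/eqP; apply: (dis j l (strand_comp (S j)) u).
  by split=> //; exists 0; rewrite addr0.
by split=> //; exists z; rewrite -vz.
Qed.

(** The product condition makes the new step functions end where [h] does. The jumps are required
    for every [h'] with the prescribed values on the strands, because the jumps of [D'] involve
    meridians of the patched function. *)
Lemma surgery_steps G (m lam : 'I_n -> G) h (us : 'I_K -> seq (R * G)) :
  (forall i, commute (m i) (lam i)) -> coloring D m lam h ->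
  (forall j, sorted (@before R G) (us j)) ->
  (forall j, all (fun x => src (S j) < x.1 < tgt (S j)) (us j)) ->
  (forall j, h (strand_comp (S j)) (src (S j)) * \prod_(x <- us j) x.2 =
             h (strand_comp (S j)) (tgt (S j)))%g ->
  (forall h' : 'I_n -> R -> G, (forall i t, h' i (t + 1) = lam i * h' i t)%g ->
     (forall j u, src (S j) <= u <= tgt (S j) ->
        h' (strand_comp (S j)) u = stepf (h (strand_comp (S j)) (src (S j))) (us j) u) ->
     forall j u, src (S j) <= u < tgt (S j) ->
     jump D' m h' (strand_comp (S j)) u = jumpf (us j) u) ->
  colorable D' m lam.
Proof.
move=> c hh srt ins tot HJ.
pose kk j := stepf (h (strand_comp (S j)) (src (S j))) (us j).
have ends j : kk j (src (S j)) = h (strand_comp (S j)) (src (S j)) /\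
              kk j (tgt (S j)) = h (strand_comp (S j)) (tgt (S j)).
  split.
    by apply: stepf_before; apply: sub_all (ins j) => x /andP[/ltW].
  by rewrite -tot; apply: stepf_after; apply: sub_all (ins j) => x /andP[_].
have P1 := patch1 LC hh ends.
exists (patch S lam h kk); apply: (patch_coloring LC c hh ends plain).
  by move=> j u _; apply: stepf_left.
move=> j u uS; rewrite (HJ _ P1 _ j u uS); first by apply: stepf_right.
move=> l v vS; have E := patch_on LC hh ends (j := l) (t := v) (z := 0) erefl.
by rewrite addr0 in E; rewrite (E vS) oppr0 mul1g.
Qed.

End Steps.

(** The quotient of [h i] by the expected step function has no jumps on the interval. *)
Lemma strand_walk D G (m lam : 'I_n -> G) h i a b (us : seq (R * G)) : a <= b ->
  coloring D m lam h -> sorted (@before R G) us -> all (fun x => a < x.1) us ->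
  (forall u, a <= u < b -> jump D m h i u = jumpf us u) ->
  forall u, a <= u <= b -> h i u = stepf (h i a) us u.
Proof.
move=> ab hh srt ins J u uab.
pose f := stepf (h i a) us; pose k v := (h i v * (f v)^-1)%g.
pose J' v := (f v * (jump D m h i v * (jumpf us v)^-1) * (f v)^-1)%g.
have st : steps k J'.
  move=> t; have [L Rt] := proj2 hh i t.
  have Lf := stepf_left (h i a) us t; have Rf := stepf_right (h i a) t srt.
  split; rewrite /k; first by near=> s; congr (_ * _^-1)%g; near: s.
  near=> s; have -> : h i s = (h i t * jump D m h i t)%g by near: s.
  have -> : f s = (f t * jumpf us t)%g by near: s.
  by rewrite /J' invgM !mulgA mulgVK.
move: uab => /andP[au ub].
have : k u = k a.
  apply: (steps_const st au) => v /andP[av vu].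
  by rewrite /J' J ?av ?(lt_le_trans vu) // mulgV mulg1 mulgV.
have -> : k a = 1%g.
  rewrite /k /f stepf_before ?mulgV //; apply: sub_all ins => x /=; exact: ltW.
by move=> E; apply: (mulIg (f u)^-1%g); rewrite mulgV.
Unshelve. all: by end_near. Qed.

End LocalMoves.

(** * The moves R2 and V2 *)

Section Bigon.
Variables (R : realType) (n : nat).

Lemma plain_ends (D D' : vdiagram R n) K (S : 'I_K -> strand R n) : local_change D D' S ->
  (forall j, info D (strand_comp (S j)) (src (S j)) = Plain /\
             info D (strand_comp (S j)) (tgt (S j)) = Plain) ->
  forall j, info D' (strand_comp (S j)) (src (S j)) = Plain /\
            info D' (strand_comp (S j)) (tgt (S j)) = Plain.
Proof.
move=> LC plain j; have [_ _ _ E] := LC; have /andP[s1 _] := strand_short LC j.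
have ends u : u = src (S j) \/ u = tgt (S j) -> not_inside S (strand_comp (S j)) u.
  move=> uu [l [li [z zz]]]; have zz' := zz; move: zz' => /andP[/ltW z1 /ltW z2].
  have := strand_unique LC (j := j) (l := l) (t := u) (z := 0) (z' := z) erefl _ li.
  rewrite addr0 z1 z2 => /(_ _ isT)[|jl z0].
    by case: uu => ->; rewrite lexx ltW.
  by move: zz; rewrite -z0 addr0 -jl; case: uu => ->; rewrite ltxx ?andbF.
have [p1 p2] := plain j; split.
  by rewrite (proj2 (E _ _ (ends _ (or_introl erefl)))).
by rewrite (proj2 (E _ _ (ends _ (or_intror erefl)))).
Qed.

Variables (D D' : vdiagram R n) (S0 S1 : strand R n).
Local Notation S := (fun j : 'I_2 => if j == ord0 then S0 else S1).
Local Notation i0 := (strand_comp S0).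
Local Notation i1 := (strand_comp S1).
Hypothesis LC : local_change D D' S.
Hypotheses (no0 : no_crossing D S0) (no1 : no_crossing D S1).
Variables (virtual : bool) (s0 t0 s1 t1 : R).
Local Notation kind := (if virtual then Virt else Over).
Hypotheses (s0S : src S0 < s0 < tgt S0) (t0S : src S0 < t0 < tgt S0)
  (s1S : src S1 < s1 < tgt S1) (t1S : src S1 < t1 < tgt S1).
Hypotheses (es : curve D' i0 s0 = curve D' i1 s1) (et : curve D' i0 t0 = curve D' i1 t1).
Hypothesis only0 : forall u, src S0 <= u <= tgt S0 -> info D' i0 u <> Plain -> u = s0 \/ u = t0.
Hypothesis only1 : forall u, src S1 <= u <= tgt S1 -> info D' i1 u <> Plain -> u = s1 \/ u = t1.
Hypothesis sgn : crossing_sign D' (i0, s0) (i1, s1) = - crossing_sign D' (i0, t0) (i1, t1).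
Hypotheses (ks : info D' i0 s0 = kind) (kt : info D' i0 t0 = kind).
Hypothesis st : s1 < t1.

Lemma forall_ord2 (P : 'I_2 -> Prop) : P ord0 -> P ord_max -> forall j, P j.
Proof.
move=> h0 h1; case=> -[|[|//]] k; [have -> : Ordinal k = ord0 | have -> : Ordinal k = ord_max];
  by [apply/val_inj|].
Qed.

Let sh0 : src S0 < tgt S0 < src S0 + 1 := strand_short LC ord0.
Let sh1 : src S1 < tgt S1 < src S1 + 1 := strand_short LC ord_max.

Let plain : forall j, info D (strand_comp (S j)) (src (S j)) = Plain /\
                      info D (strand_comp (S j)) (tgt (S j)) = Plain.
Proof.
move: sh0 sh1 => /andP[/ltW h0 _] /andP[/ltW h1 _].
by apply: forall_ord2; split=> /=; [apply: no0|apply: no0|apply: no1|apply: no1]; rewrite lexx ?h0 ?h1.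
Qed.

Let le_mid (a b u : R) : a < u < b -> a <= u <= b.
Proof. by move=> /andP[/ltW-> /ltW->]. Qed.

Let Xs : crosses (curve D') i1 s1 i0 s0.
Proof.
apply: crosses_sym.
exact: (distinct_crosses (local_change_sym LC) (j := ord0) (l := ord_max) isT (le_mid s0S) (le_mid s1S) es).
Qed.

Let Xt : crosses (curve D') i1 t1 i0 t0.
Proof.
apply: crosses_sym.
exact: (distinct_crosses (local_change_sym LC) (j := ord0) (l := ord_max) isT (le_mid t0S) (le_mid t1S) et).
Qed.

Let e : int := if virtual then 0 else crossing_sign D' (i0, s0) (i1, s1).

Lemma bigon_jump0 (G : groupType) (m : 'I_n -> G) h u :
  src S0 <= u <= tgt S0 -> jump D' m h i0 u = 1%g.
Proof.
move=> uS; apply: jump_not_under => iu.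
have [us|ut] : u = s0 \/ u = t0 by apply: only0 => //; rewrite iu.
  by move: iu; rewrite us ks; case: virtual.
by move: iu; rewrite ut kt; case: virtual.
Qed.

Lemma bigon_jump1 (G : groupType) (m lam : 'I_n -> G) h u :
  (forall i, commute (m i) (lam i)) -> (forall i t, h i (t + 1) = lam i * h i t)%g ->
  src S1 <= u <= tgt S1 ->
  jump D' m h i1 u = if u == s1 then expgz (meridian m h i0 s0) e
                     else if u == t1 then expgz (meridian m h i0 t0) (- e) else 1%g.
Proof.
move=> c h1 uS.
have Is : info D' i1 s1 = if virtual then Virt else Under.
  by move: ks; have [[-> ->]|[-> ->]|[-> ->]] := info_crossing Xs; case: virtual.
have It : info D' i1 t1 = if virtual then Virt else Under.
  by move: kt; have [[-> ->]|[-> ->]|[-> ->]] := info_crossing Xt; case: virtual.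
rewrite /e; case: eqP => [->|us].
  move: Is; case: virtual => Is; first by rewrite jump_not_under // Is.
  by rewrite (jumpE c h1 Is Xs).
case: eqP => [->|ut].
  move: It; case: virtual => It; first by rewrite jump_not_under // It.
  by rewrite (jumpE c h1 It Xt) sgn opprK.
apply: jump_not_under => iu.
by have [] : u = s1 \/ u = t1 by apply: only1 => //; rewrite iu.
Qed.

(** The strand [S0] has no jumps, so both crossings show the same meridian [g], and the jumps on
    [S1] are [g] to the powers [e] and [- e]. *)
Lemma bigon_transfer (G : groupType) (m lam : 'I_n -> G) :
  (forall i, commute (m i) (lam i)) -> colorable D m lam <-> colorable D' m lam.
Proof.
move=> c; split=> -[h hh].
  pose g := meridian m h i0 (src S0).
  pose us (j : 'I_2) : seq (R * G) := if j == ord0 then [::] else [:: (s1, expgz g e); (t1, expgz g (- e))].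
  apply: (surgery_steps LC plain c hh (us := us)).
  - by apply: forall_ord2; rewrite //= /before /= st.
  - by apply: forall_ord2; rewrite //= s1S t1S.
  - have noJ S' u : no_crossing D S' -> src S' <= u <= tgt S' -> jump D m h (strand_comp S') u = 1%g.
      by move=> no uS; apply: jump_not_under; rewrite no.
    apply: forall_ord2; rewrite /us /=.
      rewrite big_nil mulg1; apply/esym; apply: (steps_const (proj2 hh i0)); first by case/andP: sh0 => /ltW.
      by move=> u /andP[u1 /ltW u2]; apply: noJ => //; rewrite u1.
    rewrite !big_cons big_nil /= mulg1 -expgzD subrr mulg1.
    apply/esym; apply: (steps_const (proj2 hh i1)); first by case/andP: sh1 => /ltW.
    by move=> u /andP[u1 /ltW u2]; apply: noJ => //; rewrite u1.
  - move=> h' h1' E; have E0 u : src S0 <= u <= tgt S0 -> h' i0 u = h i0 (src S0) := E ord0 u.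
    apply: forall_ord2 => u /andP[u1 /ltW u2].
      by rewrite /us /=; apply: bigon_jump0; rewrite u1.
    have uS : src S1 <= u <= tgt S1 by rewrite u1.
    rewrite /us /= (bigon_jump1 c h1' uS) /meridian !E0 //; exact: le_mid.
have LC' := local_change_sym LC; have plain' := plain_ends LC plain.
apply: (surgery_steps LC' plain' c hh (us := fun=> [::])) => //.
  have h0 u : src S0 <= u <= tgt S0 -> h i0 u = h i0 (src S0).
    move=> /andP[u1 u2]; apply: (steps_const (proj2 hh i0) u1) => v /andP[v1 v2].
    by apply: bigon_jump0; rewrite v1 (le_trans (ltW v2)).
  pose g := meridian m h i0 (src S0).
  move: (sh0) (sh1) => /andP[/ltW l0 _] /andP[/ltW l1 _].
  apply: forall_ord2; rewrite big_nil mulg1 /=; first by rewrite h0 // lexx l0.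
  have W := @strand_walk _ _ D' G m lam h i1 (src S1) (tgt S1)
    [:: (s1, expgz g e); (t1, expgz g (- e))] l1 hh.
  have -> : h i1 (tgt S1) = stepf (h i1 (src S1)) [:: (s1, expgz g e); (t1, expgz g (- e))] (tgt S1).
    apply: W; last by rewrite lexx l1.
    - by rewrite /= /before /= st.
    - by rewrite /= (andP s1S).1 (andP t1S).1.
    - move=> u /andP[u1 /ltW u2]; have uS : src S1 <= u <= tgt S1 by rewrite u1.
      rewrite (bigon_jump1 c (proj1 hh) uS) /meridian (h0 _ (le_mid s0S)) (h0 _ (le_mid t0S)).
      reflexivity.
  rewrite stepf_after; last by rewrite /= (andP s1S).2 (andP t1S).2.
  by rewrite !big_cons big_nil /= mulg1 -expgzD subrr mulg1.
move=> h' _ _; apply: forall_ord2 => u /andP[u1 /ltW u2] /=; apply: jump_not_under.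
  by rewrite no0 // u1.
by rewrite no1 // u1.
Qed.

End Bigon.

Lemma comparable0 (R : realType) n (D D' : vdiagram R n) :
  (forall (G : groupType) (m lam : 'I_n -> G), (forall i, commute (m i) (lam i)) ->
     colorable D m lam <-> colorable D' m lam) -> comparable D D' (fun=> 0).
Proof.
move=> H G m lam c; have -> : (fun i => expgz (m i) 0 * lam i)%g = lam.
  by apply/funext => i; rewrite mul1g.
exact: H.
Qed.

Lemma bigon_move_comparable (R : realType) n virtual (D D' : vdiagram R n) :
  bigon_move virtual D D' -> comparable D D' (fun=> 0).
Proof.
move=> [S0 [S1 [LC [no0 no1] [s0 [t0 [s1 [t1 [[s0S t0S s1S t1S] [_ s1t1 es et] [only0 only1] sgn [ks kt]]]]]]]]].
apply: comparable0 => G m lam c; case: (ltgtP s1 t1) => [h|h|/s1t1[]].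
  exact: (bigon_transfer LC no0 no1 s0S t0S s1S t1S es et only0 only1 sgn ks kt h c).
have only0' u : src S0 <= u <= tgt S0 -> info D' (strand_comp S0) u <> Plain -> u = t0 \/ u = s0.
  by move=> a b; have [] := only0 u a b; [right|left].
have only1' u : src S1 <= u <= tgt S1 -> info D' (strand_comp S1) u <> Plain -> u = t1 \/ u = s1.
  by move=> a b; have [] := only1 u a b; [right|left].
apply: (bigon_transfer LC no0 no1 t0S s0S t1S s1S et es only0' only1' _ kt ks h c).
by rewrite sgn opprK.
Qed.

(** * The moves R3, V3, V4 and OC *)

Notation o0 := (@Ordinal 3 0 isT).
Notation o1 := (@Ordinal 3 1 isT).
Notation o2 := (@Ordinal 3 2 isT).

Lemma forall_ord3 (P : 'I_3 -> Prop) : P o0 -> P o1 -> P o2 -> forall j, P j.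
Proof.
by move=> h0 h1 h2; case=> -[|[|[|//]]] k;
  [have -> : Ordinal k = o0 | have -> : Ordinal k = o1 | have -> : Ordinal k = o2];
  try exact/val_inj.
Qed.

(** [J1] and [J2] are the jumps of the strands 1 and 2 under the strand 0, [M] and [M'] the
    meridians of strand 1 at its crossing with strand 2 before and after the move, [b1] and [b2] the
    orders of the crossings along the strands 1 and 2. The sign relation makes [J1] equal to [J2] or
    its inverse, as needed to reduce the identity to [x * y = y * x ^ y]. *)
Lemma triangle_algebra (G : groupType) (g0 g1 : G) (e1 e2 e3 : int) (b1 b2 : bool) :
  (e3 = 0 \/ e1 = if b1 == b2 then - e2 else e2) ->
  let J1 := expgz g0 e1 in let J2 := expgz g0 e2 in
  let M := if b1 then g1 else (g1 ^ J1)%g in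
  let M' := if b1 then (g1 ^ J1)%g else g1 in
  (if b2 then J2 * expgz M e3 else expgz M e3 * J2)%g =
  (if b2 then expgz M' e3 * J2 else J2 * expgz M' e3)%g.
Proof.
move=> H /=; case: H => [->|->]; first by case: b2; rewrite !expgz0 ?mulg1 ?mul1g.
case: b1; case: b2 => /=.
- by rewrite [RHS]conjgC expgz_conj -conjgM -expgzD addNr conjg1.
- by rewrite [LHS]conjgC expgz_conj.
- by rewrite [RHS]conjgC expgz_conj.
- by rewrite [LHS]conjgC expgz_conj -conjgM -expgzD addNr conjg1.
Qed.

Section TriangleJumps.
Variables (R : realType) (n : nat) (E E' : vdiagram R n) (S : 'I_3 -> strand R n).
Variable x : 'I_3 -> 'I_3 -> R.
Hypothesis LC : local_change E E' S.
Hypothesis tri : triangle E S x.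
Local Notation ii j := (strand_comp (S j)).

Lemma triangle_mid j k : j <> k -> src (S j) <= x j k <= tgt (S j).
Proof. by move=> /(proj1 tri)[/andP[/ltW-> /ltW->]]. Qed.

Lemma triangle_crosses j k : j <> k -> crosses (curve E) (ii j) (x j k) (ii k) (x k j).
Proof.
move=> jk; have [_ e] := proj1 tri j k jk.
apply: (distinct_crosses LC) e; [exact/eqP|exact: triangle_mid|apply: triangle_mid].
by move=> kj; apply: jk.
Qed.

(** Otherwise three strands would pass through one point, against [curve_double]. *)
Lemma triangle_neq j k l : j <> k -> j <> l -> k <> l -> x j k <> x j l.
Proof.
move=> jk jl kl e; have X1 := triangle_crosses jk; have X2 := triangle_crosses jl.
rewrite e in X1; have [/= kl' [z ez]] := curve_double X1 X2.
have [_ dis _ _] := LC; apply: kl; apply: (dis k l (ii l) (x l j)).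
  split=> //; exists (- z); rewrite ez mulrNz addrK; apply: triangle_mid.
  by move=> kj; apply: jk.
split=> //; exists 0; rewrite addr0; apply: triangle_mid.
by move=> lj; apply: jl.
Qed.

Variables p01 p02 p12 : passage.
Hypotheses (v01 : p01 = Over \/ p01 = Virt) (v02 : p02 = Over \/ p02 = Virt)
  (v12 : p12 = Over \/ p12 = Virt).
Hypotheses (q01 : info E (ii o0) (x o0 o1) = p01) (q02 : info E (ii o0) (x o0 o2) = p02)
  (q12 : info E (ii o1) (x o1 o2) = p12).

(** Exponent 0 at a virtual crossing lets a single computation cover all four triangle moves. *)
Definition classical_sign (p : passage) (e : int) : int := if p is Over then e else 0.

Local Notation e1 := (classical_sign p01 (crossing_sign E (ii o0, x o0 o1) (ii o1, x o1 o0))).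
Local Notation e2 := (classical_sign p02 (crossing_sign E (ii o0, x o0 o2) (ii o2, x o2 o0))).
Local Notation e3 := (classical_sign p12 (crossing_sign E (ii o1, x o1 o2) (ii o2, x o2 o1))).

Variables (G : groupType) (m lam : 'I_n -> G) (h : 'I_n -> R -> G).
Hypothesis c : forall i, commute (m i) (lam i).
Hypothesis h1 : forall i t, (h i (t + 1) = lam i * h i t)%g.

Lemma triangle_jump_at j k p : j <> k -> p = Over \/ p = Virt -> info E (ii j) (x j k) = p ->
  jump E m h (ii j) (x j k) = 1%g /\
  jump E m h (ii k) (x k j) = expgz (meridian m h (ii j) (x j k))
    (classical_sign p (crossing_sign E (ii j, x j k) (ii k, x k j))).
Proof.
move=> jk vp ip; have kj : k <> j by move=> e; apply: jk.
have X := triangle_crosses kj; split; first by apply: jump_not_under; rewrite ip; case: vp => ->.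
case: vp ip => -> ip /=.
  have iu : info E (ii k) (x k j) = Under.
    by have [[]|[]|[]] := info_crossing X; rewrite ip.
  by rewrite (jumpE c h1 iu X).
by rewrite jump_not_under //; have [[]|[]|[]] := info_crossing X; rewrite ip // => ->.
Qed.

Lemma triangle_jump_off j u : src (S j) <= u <= tgt (S j) ->
  (forall k, j <> k -> u <> x j k) -> jump E m h (ii j) u = 1%g.
Proof.
move=> uS ne; apply: jump_not_under => iu.
have [|k jk ux] := proj2 tri j u uS; first by rewrite iu.
exact: ne ux.
Qed.

Lemma triangle_jump0 u : src (S o0) <= u <= tgt (S o0) -> jump E m h (ii o0) u = 1%g.
Proof.
move=> uS; have [->|n1] := eqVneq u (x o0 o1); first by apply: (triangle_jump_at _ v01 q01).1.
have [->|n2] := eqVneq u (x o0 o2); first by apply: (triangle_jump_at _ v02 q02).1.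
by apply: triangle_jump_off => //; apply: forall_ord3 => // _; apply/eqP.
Qed.

Lemma triangle_jump1 u : src (S o1) <= u <= tgt (S o1) -> jump E m h (ii o1) u =
  if u == x o1 o0 then expgz (meridian m h (ii o0) (x o0 o1)) e1 else 1%g.
Proof.
move=> uS; case: eqP => [->|n1]; first by apply: (triangle_jump_at _ v01 q01).2.
have [->|n2] := eqVneq u (x o1 o2); first by apply: (triangle_jump_at _ v12 q12).1.
by apply: triangle_jump_off => //; apply: forall_ord3 => // _; apply/eqP.
Qed.

Lemma triangle_jump2 u : src (S o2) <= u <= tgt (S o2) -> jump E m h (ii o2) u =
  if u == x o2 o0 then expgz (meridian m h (ii o0) (x o0 o2)) e2
  else if u == x o2 o1 then expgz (meridian m h (ii o1) (x o1 o2)) e3 else 1%g.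
Proof.
move=> uS; case: eqP => [->|n1]; first by apply: (triangle_jump_at _ v02 q02).2.
case: eqP => [->|n2]; first by apply: (triangle_jump_at _ v12 q12).2.
by apply: triangle_jump_off => //; apply: forall_ord3 => // _; apply/eqP.
Qed.

End TriangleJumps.

Section TriangleTransfer.
Variables (R : realType) (n : nat) (E E' : vdiagram R n) (S : 'I_3 -> strand R n).
Variables x x' : 'I_3 -> 'I_3 -> R.
Hypothesis LC : local_change E E' S.
Hypotheses (tri : triangle E S x) (tri' : triangle E' S x').
Local Notation ii j := (strand_comp (S j)).
Hypothesis rev : forall j k l, j <> k -> j <> l -> k <> l -> x j k < x j l <-> x' j l < x' j k.
Variables p01 p02 p12 : passage.
Hypotheses (v01 : p01 = Over \/ p01 = Virt) (v02 : p02 = Over \/ p02 = Virt)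
  (v12 : p12 = Over \/ p12 = Virt).
Hypotheses (q01 : info E (ii o0) (x o0 o1) = p01) (q02 : info E (ii o0) (x o0 o2) = p02)
  (q12 : info E (ii o1) (x o1 o2) = p12).
Hypothesis same : forall j k, j <> k ->
  info E' (ii j) (x' j k) = info E (ii j) (x j k) /\
  crossing_sign E' (ii j, x' j k) (ii k, x' k j) = crossing_sign E (ii j, x j k) (ii k, x k j).

Local Notation e1 := (classical_sign p01 (crossing_sign E (ii o0, x o0 o1) (ii o1, x o1 o0))).
Local Notation e2 := (classical_sign p02 (crossing_sign E (ii o0, x o0 o2) (ii o2, x o2 o0))).
Local Notation e3 := (classical_sign p12 (crossing_sign E (ii o1, x o1 o2) (ii o2, x o2 o1))).

Hypothesis orient : e3 = 0 \/
  e1 = if (x o1 o2 < x o1 o0) == (x o2 o0 < x o2 o1) then - e2 else e2.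

(** Strand 0 has no jump and strand 1 has the single jump [J1] in both diagrams. On strand 2 the two
    jumps change places while [M] becomes [M']; [triangle_algebra] says that their product is
    unchanged. *)
Lemma triangle_transfer (G : groupType) (m lam : 'I_n -> G) :
  (forall i, commute (m i) (lam i)) -> colorable E m lam -> colorable E' m lam.
Proof.
move=> c [h hh]; have LC' := local_change_sym LC.
have plain j : info E (ii j) (src (S j)) = Plain /\ info E (ii j) (tgt (S j)) = Plain.
  have /andP[/ltW s1 _] := strand_short LC j.
  have ne k (jk : j <> k) : x j k <> src (S j) /\ x j k <> tgt (S j).
    by have [/andP[h1 h2] _] := proj1 tri j k jk; split=> e; move: h1 h2; rewrite e ltxx.
  split; apply/not_notP => /(proj2 tri) H.
    by have [|k jk e] := H; [rewrite lexx s1|case: (ne k jk); rewrite -e].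
  by have [|k jk e] := H; [rewrite lexx s1|case: (ne k jk); rewrite -e].
have q01' : info E' (ii o0) (x' o0 o1) = p01 by rewrite (proj1 (same _)).
have q02' : info E' (ii o0) (x' o0 o2) = p02 by rewrite (proj1 (same _)).
have q12' : info E' (ii o1) (x' o1 o2) = p12 by rewrite (proj1 (same _)).
pose g0 := meridian m h (ii o0) (src (S o0)); pose a1 := h (ii o1) (src (S o1)).
pose a2 := h (ii o2) (src (S o2)); pose g1 := (m (ii o1) ^ a1)%g.
pose J1 := expgz g0 e1; pose J2 := expgz g0 e2.
pose b1 := x o1 o2 < x o1 o0; pose b2 := x o2 o0 < x o2 o1.
pose M := if b1 then g1 else (g1 ^ J1)%g; pose M' := if b1 then (g1 ^ J1)%g else g1.
have lt_x j k (jk : j <> k) : src (S j) < x j k < tgt (S j) := (proj1 tri j k jk).1.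
have lt_x' j k (jk : j <> k) : src (S j) < x' j k < tgt (S j) := (proj1 tri' j k jk).1.
have le_x j k (jk : j <> k) : src (S j) <= x j k <= tgt (S j) := triangle_mid tri jk.
have le_x' j k (jk : j <> k) : src (S j) <= x' j k <= tgt (S j) := triangle_mid tri' jk.
have sS j : src (S j) <= tgt (S j) by have /andP[/ltW] := strand_short LC j.
have H0 u : src (S o0) <= u <= tgt (S o0) -> h (ii o0) u = h (ii o0) (src (S o0)).
  move=> /andP[u1 u2]; apply: (steps_const (proj2 hh _) u1) => v /andP[v1 v2].
  by apply: (triangle_jump0 LC tri v01 v02 q01 q02 c (proj1 hh)); rewrite v1 (le_trans (ltW v2)).
have m0 k : o0 <> k -> meridian m h (ii o0) (x o0 k) = g0.
  by move=> k0; rewrite /meridian H0 // le_x.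
have H1 u : src (S o1) <= u <= tgt (S o1) -> h (ii o1) u = stepf a1 [:: (x o1 o0, J1)] u.
  apply: (strand_walk (sS o1) hh) => //; first by rewrite /= (andP (lt_x o1 o0 _)).1.
  move=> v /andP[v1 /ltW v2]; rewrite (triangle_jump1 LC tri v01 v12 q01 q12 c (proj1 hh)) ?v1 //.
  by rewrite m0.
have ME : meridian m h (ii o1) (x o1 o2) = M.
  rewrite /meridian H1 ?le_x //= /M /b1; have ne := @triangle_neq _ _ _ _ _ _ LC tri o1 o2 o0.
  case: (ltgtP (x o1 o2) (x o1 o0)) => // [_|/ne []//].
  by rewrite conjgM.
pose us2 (xa xb : R) (Ja Jb : G) := if xa < xb then [:: (xa, Ja); (xb, Jb)] else [:: (xb, Jb); (xa, Ja)].
pose J3 := expgz M e3; pose J3' := expgz M' e3.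
have us2_sorted xa xb Ja Jb : xa <> xb -> sorted (@before R G) (us2 xa xb Ja Jb).
  by rewrite /us2 => ne; case: ltgtP => //= h'; rewrite /before /= h'.
have us2_all (P : R -> bool) xa xb Ja Jb : P xa -> P xb -> all (fun y => P y.1) (us2 xa xb Ja Jb).
  by rewrite /us2 => Pa Pb; case: ifP => _ /=; rewrite Pa Pb.
have us2_jump xa xb Ja Jb u : xa <> xb -> jumpf (us2 xa xb Ja Jb) u =
    if u == xa then Ja else if u == xb then Jb else 1%g.
  rewrite /us2 => ne; case: ifP => _ //=; case: eqP => // ->; case: eqP => // e.
  by case: ne.
have n20 : o2 <> o0 by []. have n21 : o2 <> o1 by [].
have ne20 : x o2 o0 <> x o2 o1 by apply: (triangle_neq LC tri).
have ne20' : x' o2 o0 <> x' o2 o1 by apply: (triangle_neq LC' tri').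
have T2 : h (ii o2) (tgt (S o2)) = (a2 * \prod_(y <- us2 (x o2 o0) (x o2 o1) J2 J3) y.2)%g.
  have W := @strand_walk _ _ E G m lam h (ii o2) (src (S o2)) (tgt (S o2))
    (us2 (x o2 o0) (x o2 o1) J2 J3) (sS o2) hh.
  have -> : h (ii o2) (tgt (S o2)) = stepf a2 (us2 (x o2 o0) (x o2 o1) J2 J3) (tgt (S o2)).
    apply: W; last by rewrite lexx sS.
    - exact: us2_sorted.
    - exact: (us2_all (fun y => src (S o2) < y)) (andP (lt_x o2 o0 n20)).1 (andP (lt_x o2 o1 n21)).1.
    - move=> u /andP[u1 /ltW u2].
      rewrite (triangle_jump2 LC tri v02 v12 q02 q12 c (proj1 hh)) ?u1 //.
      by rewrite us2_jump // m0 // ME.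
  apply: stepf_after.
  exact: (us2_all (fun y => y < tgt (S o2))) (andP (lt_x o2 o0 n20)).2 (andP (lt_x o2 o1 n21)).2.
pose us (j : 'I_3) : seq (R * G) := if j == o0 then [::] else if j == o1 then [:: (x' o1 o0, J1)]
  else us2 (x' o2 o0) (x' o2 o1) J2 J3'.
have rev1 : (x' o1 o0 < x' o1 o2) = b1.
  by apply/idP/idP => [/rev|/rev]; apply.
have rev2 : (x' o2 o0 < x' o2 o1) = ~~ b2.
  have n01 : o0 <> o1 by []. have n10 : o1 <> o0 by [].
  rewrite /b2; case: (ltgtP (x o2 o0) (x o2 o1)) => [/(rev n20 n21 n01) k|/(rev n21 n20 n10) k|/ne20 []] /=.
    by rewrite ltNge (ltW k).
  by rewrite k.
apply: (surgery_steps LC plain c hh (us := us)).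
- by apply: forall_ord3 => //; apply: us2_sorted.
- apply: forall_ord3 => //=; first by rewrite lt_x'.
  exact: (us2_all (fun y => src (S o2) < y < tgt (S o2))) (lt_x' _ _ n20) (lt_x' _ _ n21).
- apply: forall_ord3; rewrite /us /=.
  + by rewrite big_nil mulg1 H0 // lexx sS.
  + have n10 : o1 <> o0 by []. rewrite (H1 (tgt (S o1))); last by rewrite lexx sS.
    by rewrite stepf_after /= ?(andP (lt_x o1 o0 n10)).2 // !big_cons.
  + have TA : (if b2 then J2 * J3 else J3 * J2)%g = (if b2 then J3' * J2 else J2 * J3')%g.
      exact: (@triangle_algebra G g0 g1 e1 e2 e3 b1 b2 orient).
    rewrite T2; congr (_ * _)%g; rewrite /us2 rev2 -/b2; move: TA.
    move: (J2) (J3) (J3') (b2) => K2 K3 K3' b; clear; case: b => /= TA;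
      by rewrite !big_cons !big_nil /= !mulg1 TA.
move=> h' h1' HE.
have E0 u : src (S o0) <= u <= tgt (S o0) -> h' (ii o0) u = h (ii o0) (src (S o0)) := HE o0 u.
have E1 u : src (S o1) <= u <= tgt (S o1) -> h' (ii o1) u = stepf a1 [:: (x' o1 o0, J1)] u := HE o1 u.
have m0' k : o0 <> k -> meridian m h' (ii o0) (x' o0 k) = g0.
  by move=> k0; rewrite /meridian E0 // le_x'.
have ME' : meridian m h' (ii o1) (x' o1 o2) = M'.
  rewrite /meridian E1 ?le_x' //= leNgt rev1 /M'; case: (b1) => //=.
  by rewrite conjgM.
apply: forall_ord3 => u /andP[u1 /ltW u2]; have uS := introT andP (conj u1 u2).
- exact: (triangle_jump0 LC' tri' v01 v02 q01' q02' c h1' uS).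
- have n01 : o0 <> o1 by [].
  rewrite (triangle_jump1 LC' tri' v01 v12 q01' q12' c h1' uS) (m0' _ n01) (proj2 (same n01)).
  reflexivity.
- have n02 : o0 <> o2 by []. have n12 : o1 <> o2 by [].
  rewrite (triangle_jump2 LC' tri' v02 v12 q02' q12' c h1' uS) (m0' _ n02) ME'.
  rewrite (proj2 (same n02)) (proj2 (same n12)) (us2_jump _ _ J2 J3' u ne20').
  reflexivity.
Qed.

End TriangleTransfer.

(** * Planarity and the signs of a triangle *)

Section Orientation.
Variables (R : realType) (n : nat).

Lemma det2Nr (u v : R * R) : det2 u (- v) = - det2 u v.
Proof. by rewrite /det2 /=; ring. Qed.

Lemma slope_opp (H : R -> R * R) t a : slope H t a -> slope (fun s => H (- s)) (- t) (- a).
Proof.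
move=> Ha eps e0; have [d d0 Hd] := Ha eps e0; exists d => // x xd.
have := Hd (- x); rewrite normrN => /(_ xd); rewrite /= opprD opprK.
by rewrite !mulNr !mulrN.
Qed.

Variables (E E' : vdiagram R n) (S : 'I_3 -> strand R n) (x : 'I_3 -> 'I_3 -> R).
Hypothesis LC : local_change E E' S.
Hypothesis tri : triangle E S x.
Local Notation ii j := (strand_comp (S j)).
Variable f : R * R -> R * R.
Hypotheses (hf : plane_diffeo f) (dm : disc_meets f E S).

Definition disc_curve j (t : R) : R * R := f (curve E (ii j) t).

Lemma disc_curve_continuous j : continuous (disc_curve j).
Proof.
move=> t; apply: (@continuous_comp _ _ _ (curve E (ii j)) f).
  by apply: differentiable_continuous; apply/derivable1_diffP; apply: curve_derivable.
by apply: differentiable_continuous; case: hf => -[].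
Qed.

Lemma disc_curve_slope j t :
  slope (disc_curve j) t ('d f (curve E (ii j) t) (tangent E (ii j) t)).
Proof.
have [[df _] _] := hf.
have [d <-] := derive1_comp_plane (df (curve E (ii j) t)) (@curve_derivable _ _ E (ii j) t).
exact: slope_derive1.
Qed.

Lemma disc_curve_le1 j t : src (S j) <= t <= tgt (S j) -> sqnorm (disc_curve j t) <= 1.
Proof. by move=> tS; apply/(proj1 dm); exists j; split=> //; exists 0; rewrite addr0. Qed.

Lemma disc_curve_ends j t : t = src (S j) \/ t = tgt (S j) -> sqnorm (disc_curve j t) = 1.
Proof.
have /andP[/ltW sS _] := strand_short LC j.
move=> tt; have tS : src (S j) <= t <= tgt (S j) by case: tt => ->; rewrite lexx sS.
apply/eqP; rewrite eq_le disc_curve_le1 //= leNgt; apply/negP => /(proj2 dm)[l [li [z zz]]].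
have zz' := zz; move: zz' => /andP[/ltW z1 /ltW z2].
have := strand_unique LC (j := j) (l := l) (t := t) (z := 0) (z' := z) erefl _ li.
rewrite addr0 z1 z2 tS => /(_ isT isT)[jl z0].
by move: zz; rewrite -z0 addr0 -jl; case: tt => ->; rewrite ltxx ?andbF.
Qed.

Lemma disc_curve_meet j k u v : j <> k -> src (S j) <= u <= tgt (S j) ->
  src (S k) <= v <= tgt (S k) -> disc_curve j u = disc_curve k v -> u = x j k /\ v = x k j.
Proof.
have [_ [g [_ fK _]]] := hf.
have half a b w w' : a <> b -> src (S a) <= w <= tgt (S a) ->
    src (S b) <= w' <= tgt (S b) -> disc_curve a w = disc_curve b w' -> w = x a b.
  move=> ab wS wS' /(can_inj fK) e.
  have X : crosses (curve E) (ii a) w (ii b) w'.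
    by apply: (distinct_crosses LC) e => //; apply/eqP.
  have np : info E (ii a) w <> Plain by apply/info_plain; exists (ii b), w'.
  have [l al wl] := proj2 tri a w wS np.
  have [->//|/eqP lb] := eqVneq b l.
  have Y := triangle_crosses LC tri al; rewrite -wl in Y.
  have [/= e1 [z ez]] := curve_double X Y.
  have [_ dis _ _] := LC; case: lb; apply: (dis b l (ii l) (x l a)).
    by split=> //; exists (- z); rewrite ez mulrNz addrK.
  split=> //; exists 0; rewrite addr0; apply: (triangle_mid tri).
  by move=> la; apply: al.
move=> jk uS vS e; split; first exact: half jk uS vS e.
by apply: (half k j v u) => // kj; apply: jk.
Qed.

Local Notation sign j := (det2 (tangent E (ii o0) (x o0 j)) (tangent E (ii j) (x j o0))).

(* The part of the strand j from its crossing with the strand l to the circle, through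
   its crossing with the strand 0. *)
Lemma disc_ray j l : j <> o0 -> j <> l -> l <> o0 -> exists K c d t a,
  [/\ [/\ continuous K, K c = disc_curve j (x j l), c < t < d & sqnorm (K d) = 1],
      slope K t a, disc_curve o0 (x o0 j) = K t,
      (forall y, c <= y <= d -> sqnorm (K y) <= 1) /\
      (forall u y, src (S o0) <= u <= tgt (S o0) -> c <= y <= d ->
         disc_curve o0 u = K y -> u = x o0 j /\ y = t) &
      det2 ('d f (curve E (ii o0) (x o0 j)) (tangent E (ii o0) (x o0 j))) a =
      (if x j l < x j o0 then 1 else -1) * (jac f (curve E (ii o0) (x o0 j)) * sign j)].
Proof.
move=> j0 jl l0; have j0' : o0 <> j by move=> e; apply: j0.
have [[df _] _] := hf.
have [/andP[s1 s2] es] := proj1 tri j o0 j0; have [/andP[s3 s4] _] := proj1 tri j l jl.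
have e0 : curve E (ii o0) (x o0 j) = curve E (ii j) (x j o0) by rewrite es.
have e0' : disc_curve o0 (x o0 j) = disc_curve j (x j o0) by rewrite /disc_curve e0.
have DD : det2 ('d f (curve E (ii o0) (x o0 j)) (tangent E (ii o0) (x o0 j)))
    ('d f (curve E (ii j) (x j o0)) (tangent E (ii j) (x j o0))) =
    jac f (curve E (ii o0) (x o0 j)) * sign j.
  by rewrite -e0; apply: det2_diff.
have ne := triangle_neq LC tri jl j0 l0.
case: (ltgtP (x j l) (x j o0)) => [lt|gt|/ne []].
  exists (disc_curve j), (x j l), (tgt (S j)), (x j o0).
  exists ('d f (curve E (ii j) (x j o0)) (tangent E (ii j) (x j o0))); split.
  - split=> //; [exact: disc_curve_continuous|by rewrite lt|by apply: disc_curve_ends; right].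
  - exact: disc_curve_slope.
  - exact: e0'.
  - split=> [y|u y uS] /andP[y1 y2].
      by apply: disc_curve_le1; rewrite (le_trans (ltW s3) y1).
    by apply: disc_curve_meet => //; rewrite (le_trans (ltW s3) y1).
  - by rewrite mul1r.
(* Strand [j] meets strand 0 before strand [l], so the ray runs backwards and its slope changes
   sign. *)
exists (fun t => disc_curve j (- t)), (- x j l), (- src (S j)), (- x j o0).
exists (- 'd f (curve E (ii j) (x j o0)) (tangent E (ii j) (x j o0))); split.
- split.
  + move=> t; apply: (@continuous_comp _ _ _ (fun t : R => - t) (disc_curve j)).
      exact: opp_continuous.
    exact: disc_curve_continuous.
  + by rewrite opprK.
  + by rewrite !ltrN2 gt.
  + by rewrite opprK; apply: disc_curve_ends; left.
- exact: slope_opp (@disc_curve_slope j (x j o0)).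
- by rewrite opprK.
- have in_S y : - x j l <= y <= - src (S j) -> src (S j) <= - y <= tgt (S j).
    by move=> /andP[y1 y2]; apply/andP; split; lra.
  split=> [y /in_S|u y uS /in_S y2 e]; first exact: disc_curve_le1.
  have [-> <-] := disc_curve_meet j0' uS y2 e.
  by rewrite opprK.
- by rewrite -DD mulN1r; exact: det2Nr.
Qed.

Lemma sgz_signed (b : bool) (r s : R) : r != 0 ->
  Num.sg ((if b then 1 else -1) * (r * s)) = (if b then 1 else -1) * (Num.sg r * (sgz s)%:~R).
Proof. by move=> r0; rewrite sgrM sgrM -sgrEz; case: b; rewrite ?sgr1 ?sgrN1. Qed.

Lemma signed_cancel (b1 b2 : bool) (j j' : R) (u v : int) : j != 0 -> j = j' ->
  (if b1 then 1 else -1) * (j * u%:~R) = (if b2 then 1 else -1) * (j' * v%:~R) ->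
  u = if b1 == b2 then v else - v.
Proof.
move=> j0 <-; rewrite mulrCA [RHS]mulrCA => /(mulfI j0) e; apply: (@intr_inj R).
move: e; case: b1; case: b2; rewrite ?mul1r ?mulN1r ?mulrNz //=; last exact: oppr_inj.
by move=> <-; rewrite opprK.
Qed.

(** Two rays start at the crossing of the strands 1 and 2, and [rays_agree] compares their crossings
    with the chord given by strand 0. A ray running against its strand reverses a sign; the sign of
    the Jacobian of [f] is common to both crossings and cancels. *)
Lemma triangle_orientation :
  sgz (sign o1) = if (x o1 o2 < x o1 o0) == (x o2 o0 < x o2 o1) then - sgz (sign o2) else sgz (sign o2).
Proof.
have n10 : o1 <> o0 by []. have n12 : o1 <> o2 by []. have n20 : o2 <> o0 by [].
have n21 : o2 <> o1 by []. have n01 : o0 <> o1 by []. have n02 : o0 <> o2 by [].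
have [K [c [d [t [a [[Kc K0 ct Kd] Ka Kt [K1 Ku] Kdet]]]]]] := disc_ray n10 n12 n20.
have [K' [c' [d' [t' [a' [[Kc' K0' ct' Kd'] Ka' Kt' [K1' Ku'] Kdet']]]]]] := disc_ray n20 n21 n10.
have sne j (jn : o0 <> j) : sign j != 0.
  by apply: (@curve_transverse _ _ E); apply: (triangle_crosses LC tri jn).
have jn y := jac_neq0 y hf.
have pm (b : bool) : (if b then 1 else -1 : R) != 0 by case: b; rewrite ?oppr_eq0 oner_neq0.
have dn : det2 ('d f (curve E (ii o0) (x o0 o1)) (tangent E (ii o0) (x o0 o1))) a != 0.
  by rewrite Kdet !mulf_neq0 ?pm ?jn ?sne.
have dn' : det2 ('d f (curve E (ii o0) (x o0 o2)) (tangent E (ii o0) (x o0 o2))) a' != 0.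
  by rewrite Kdet' !mulf_neq0 ?pm ?jn ?sne.
have KK : K c = K' c'.
  by rewrite K0 K0' /disc_curve; have [_ ->] := proj1 tri o1 o2 n12.
have /andP[/ltW sS _] := strand_short LC o0.
have RA := rays_agree (@disc_curve_continuous o0) Kc Kc' KK (proj1 (proj1 tri o0 o1 n01)) ct
  (@disc_curve_slope o0 (x o0 o1)) Ka dn Kt Ku (proj1 (proj1 tri o0 o2 n02)) ct'
  (@disc_curve_slope o0 (x o0 o2)) Ka' dn' Kt' Ku' (@disc_curve_le1 o0) K1 K1'
  (disc_curve_ends (or_introl erefl)) (disc_curve_ends (or_intror erefl)) Kd Kd'.
have E1 := sgz_signed (x o1 o2 < x o1 o0) (sign o1) (jn (curve E (ii o0) (x o0 o1))).
have E2 := sgz_signed (x o2 o1 < x o2 o0) (sign o2) (jn (curve E (ii o0) (x o0 o2))).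
have J := jac_sg (curve E (ii o0) (x o0 o1)) (curve E (ii o0) (x o0 o2)) hf.
have RA' := etrans (etrans (esym E1) (esym (congr1 (@Num.sg R) Kdet)))
  (etrans RA (etrans (congr1 (@Num.sg R) Kdet') E2)).
have j0 : Num.sg (jac f (curve E (ii o0) (x o0 o1))) != 0 by rewrite sgr_eq0; exact: jn.
refine (etrans (signed_cancel j0 J RA') _).
have ne := triangle_neq LC tri n20 n21 n01.
(* The ray on strand 2 runs forwards when [x o2 o1 < x o2 o0], the opposite of the comparison in the
   statement; hence the minus sign when the booleans there agree. *)
case: (ltgtP (x o2 o0) (x o2 o1)) => [_|_|/ne[]]; by case: (_ < _).
Qed.

End Orientation.

(** Reversing a triangle move gives one of the same type, so the transfer serves in both directions.
    Planarity is needed only if all crossings are classical: otherwise [e3] is 0, or [e1] and [e2]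
    are. *)
Lemma triangle_move_comparable (R : realType) n p01 p02 p12 (D D' : vdiagram R n) :
  (p01 = Over \/ p01 = Virt) -> p02 = p01 -> (p12 = Over \/ p12 = Virt) ->
  triangle_move p01 p02 p12 D D' -> comparable D D' (fun=> 0).
Proof.
move=> v01 e02 v12 [S [LC [x [x' [tri tri' rev same [q01 q02 q12]]]]]]; subst p02.
have n01 : o0 <> o1 by []. have n02 : o0 <> o2 by []. have n12 : o1 <> o2 by [].
have [_ _ [f hf [dm dm']] _] := LC; have LC' := local_change_sym LC.
have orient (E E' : vdiagram R n) y : local_change E E' S -> triangle E S y -> disc_meets f E S ->
    classical_sign p12 (crossing_sign E (strand_comp (S o1), y o1 o2) (strand_comp (S o2), y o2 o1)) = 0 \/
    classical_sign p01 (crossing_sign E (strand_comp (S o0), y o0 o1) (strand_comp (S o1), y o1 o0)) =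
    if (y o1 o2 < y o1 o0) == (y o2 o0 < y o2 o1)
    then - classical_sign p01 (crossing_sign E (strand_comp (S o0), y o0 o2) (strand_comp (S o2), y o2 o0))
    else classical_sign p01 (crossing_sign E (strand_comp (S o0), y o0 o2) (strand_comp (S o2), y o2 o0)).
  move=> LCE triE dmE; case: v12 => ->; last by left.
  right; case: v01 => -> /=; last by case: ifP.
  exact: (triangle_orientation LCE triE hf dmE).
apply: comparable0 => G m lam c; split.
  exact: (triangle_transfer LC tri tri' rev v01 v01 v12 q01 q02 q12 same (orient _ _ _ LC tri dm) c).
have q01' : info D' (strand_comp (S o0)) (x' o0 o1) = p01 by rewrite (proj1 (same _ _ n01)).
have q02' : info D' (strand_comp (S o0)) (x' o0 o2) = p01 by rewrite (proj1 (same _ _ n02)).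
have q12' : info D' (strand_comp (S o1)) (x' o1 o2) = p12 by rewrite (proj1 (same _ _ n12)).
apply: (triangle_transfer LC' tri' tri _ v01 v01 v12 q01' q02' q12' _ (orient _ _ _ LC' tri' dm') c).
  move=> j k l jk jl kl; have lk : l <> k by move=> e; apply: kl.
  exact: iff_sym (rev j l k jl jk lk).
by move=> j k jk; have [-> ->] := same j k jk.
Qed.

Lemma welded_comparable (R : realType) n (D D' : vdiagram R n) :
  welded_equivalent D D' -> exists eps, comparable D D' eps.
Proof.
elim=> {D D'} [D D' [iso|mv]|D|D D' _ [eps h]|D D' D'' _ [e1 h1] _ [e2 h2]].
- by exists (fun=> 0); apply: isotopic_comparable.
- have Oo : Over = Over \/ Over = Virt by left.
  have Vv : Virt = Over \/ Virt = Virt by right.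
  case: mv => h.
  + exact: kink_move_comparable h.
  + by exists (fun=> 0); apply: bigon_move_comparable h.
  + by exists (fun=> 0); apply: triangle_move_comparable h.
  + exact: kink_move_comparable h.
  + by exists (fun=> 0); apply: bigon_move_comparable h.
  + by exists (fun=> 0); apply: triangle_move_comparable h.
  + by exists (fun=> 0); apply: triangle_move_comparable h.
  + by exists (fun=> 0); apply: triangle_move_comparable h.
- by exists (fun=> 0); apply: comparable_refl.
- by exists (fun i => - eps i); apply: comparable_sym.
- by exists (fun i => e2 i + e1 i); apply: comparable_trans h1 h2.
Qed.

(** * Unitriangular matrices and the Magnus expansion *)

Section Unitriangular.
Variables (K : comNzRingType) (s : nat).
Local Notation mx := 'M[K]_s.+1.
Implicit Types (A B : mx) (k l : nat).

(** The filtration by superdiagonals: indices add under products ([ftriM]), and index [s.+1] forces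
    0 ([ftri_top]). *)
Definition ftri k A : Prop := forall a b : 'I_s.+1, (b < a + k)%N -> A a b = 0.

Lemma ftri0 k : ftri k 0. Proof. by move=> a b _; rewrite mxE. Qed.

Lemma ftriD k A B : ftri k A -> ftri k B -> ftri k (A + B).
Proof. by move=> hA hB a b ab; rewrite mxE hA ?hB ?addr0. Qed.

Lemma ftriN k A : ftri k A -> ftri k (- A).
Proof. by move=> hA a b ab; rewrite mxE hA ?oppr0. Qed.

Lemma ftriB k A B : ftri k A -> ftri k B -> ftri k (A - B).
Proof. by move=> hA hB; apply: ftriD => //; apply: ftriN. Qed.

Lemma ftri_le k l A : (l <= k)%N -> ftri k A -> ftri l A.
Proof. by move=> lk hA a b ab; apply: hA; apply: leq_trans ab _; rewrite leq_add2l. Qed.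

Lemma ftriM k l A B : ftri k A -> ftri l B -> ftri (k + l) (A * B).
Proof.
move=> hA hB a b ab; rewrite mxE big1 // => c _.
have [ca|ac] := ltnP c (a + k); first by rewrite hA ?mul0r.
rewrite hB ?mulr0 //; apply: leq_trans ab _.
by rewrite addnA leq_add2r.
Qed.

Lemma ftri1 : ftri 0 (1 : mx).
Proof.
move=> a b ab; rewrite mxE; case: eqP => // e.
by move: ab; rewrite e addn0 ltnn.
Qed.

Lemma ftri_top A : ftri s.+1 A -> A = 0.
Proof.
move=> hA; apply/matrixP => a b; rewrite mxE hA //.
by apply: leq_trans (ltn_ord b) _; rewrite leq_addl.
Qed.

Lemma ftriX A i : ftri 1 A -> ftri i (A ^+ i).
Proof.
move=> hA; elim: i => [|i IH]; first exact: ftri1.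
by rewrite exprS; apply: (@ftriM 1 i).
Qed.

Lemma ftri_sum k (I : Type) (r : seq I) (P : pred I) (F : I -> mx) :
  (forall i, P i -> ftri k (F i)) -> ftri k (\sum_(i <- r | P i) F i).
Proof. by move=> h; apply: big_ind => //; [exact: ftri0|exact: ftriD]. Qed.

Definition is_unitri : {pred mx} :=
  fun A => [forall a : 'I_s.+1, forall b : 'I_s.+1, (b < a.+1)%N ==> ((A - 1) a b == 0)].

Lemma is_unitriP A : reflect (ftri 1 (A - 1)) (is_unitri A).
Proof.
apply: (iffP forallP) => [h a b ab|h a].
  have /forallP/(_ b)/implyP hab := h a.
  by apply/eqP/hab; move: ab; rewrite addn1.
by apply/forallP => b; apply/implyP => ab; apply/eqP/h; rewrite addn1.
Qed.

Record unitri := Unitri { unitri_mx :> mx; _ : is_unitri unitri_mx }.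

HB.instance Definition _ := [isSub for unitri_mx].
HB.instance Definition _ := [Choice of unitri by <:].

Lemma unitri_sub1 (x : unitri) : ftri 1 (unitri_mx x - 1).
Proof. by apply/is_unitriP; case: x. Qed.

Lemma unitri_upper (x : unitri) : ftri 0 (unitri_mx x).
Proof.
rewrite -[unitri_mx x](subrK 1); apply: ftriD; last exact: ftri1.
exact: ftri_le (unitri_sub1 x).
Qed.

Fact unitri_one_subproof : is_unitri 1.
Proof. by apply/is_unitriP; rewrite subrr; exact: ftri0. Qed.

Fact unitri_mul_subproof (x y : unitri) : is_unitri (unitri_mx x * unitri_mx y).
Proof.
apply/is_unitriP; rewrite (_ : _ - 1 = unitri_mx x * (unitri_mx y - 1) + (unitri_mx x - 1)); last first.
  by rewrite mulrBr mulr1 addrA subrK.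
apply: ftriD; last exact: unitri_sub1.
exact: (ftriM (unitri_upper x) (unitri_sub1 y)).
Qed.

(** The geometric series for the inverse, finite because [1 - A] is nilpotent when [A] is
    unitriangular. *)
Definition neumann A : mx := \sum_(i < s.+1) (1 - A) ^+ i.

Lemma neumannK A : ftri 1 (A - 1) -> A * neumann A = 1 /\ neumann A * A = 1.
Proof.
move=> h; have N : (1 - A) ^+ s.+1 = 0.
  by apply/ftri_top/ftriX; rewrite -opprB; apply: ftriN.
have := subrX1 (1 - A) s.+1; rewrite N sub0r -[1 - A - 1]addrAC subrr sub0r mulNr => /oppr_inj/esym E.
split=> //; rewrite -[RHS]E /neumann big_distrl big_distrr /=; apply: eq_bigr => i _.
by apply/esym/commrX; rewrite /GRing.comm mulrBl mulrBr mul1r mulr1.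
Qed.

Fact unitri_inv_subproof (x : unitri) : is_unitri (neumann (unitri_mx x)).
Proof.
apply/is_unitriP; rewrite /neumann big_ord_recl expr0 addrC addrA addNr add0r.
apply: ftri_sum => i _; apply: (@ftri_le (bump 0 i)) => //; apply: ftriX.
by rewrite -opprB; apply/ftriN/unitri_sub1.
Qed.

Definition unitri_one := Unitri unitri_one_subproof.
Definition unitri_mul x y := Unitri (unitri_mul_subproof x y).
Definition unitri_inv x := Unitri (unitri_inv_subproof x).

Fact unitri_mulA : associative unitri_mul.
Proof. by move=> x y z; apply/val_inj; rewrite /= mulrA. Qed.
Fact unitri_mul1 : left_id unitri_one unitri_mul.
Proof. by move=> x; apply/val_inj; rewrite /= mul1r. Qed.
Fact unitri_mulr1 : right_id unitri_one unitri_mul.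
Proof. by move=> x; apply/val_inj; rewrite /= mulr1. Qed.
Fact unitri_mulV : left_inverse unitri_one unitri_inv unitri_mul.
Proof. by move=> x; apply/val_inj; rewrite /= (neumannK (unitri_sub1 x)).2. Qed.
Fact unitri_mulrV : right_inverse unitri_one unitri_inv unitri_mul.
Proof. by move=> x; apply/val_inj; rewrite /= (neumannK (unitri_sub1 x)).1. Qed.

HB.instance Definition _ :=
  isGroup.Build unitri unitri_mulA unitri_mul1 unitri_mulr1 unitri_mulV unitri_mulrV.

Implicit Types (x y u v : unitri).
Local Notation "x %:mx" := (unitri_mx x) (at level 2, format "x %:mx").

Lemma unitri_mxM x y : (x * y)%g%:mx = x%:mx * y%:mx. Proof. by []. Qed.
Lemma unitri_mxV x : x^-1%g%:mx * x%:mx = 1 /\ x%:mx * x^-1%g%:mx = 1.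
Proof. by rewrite -!unitri_mxM mulVg mulgV. Qed.

(* Congruence modulo the k-th superdiagonal. *)
Definition cong k x y := ftri k (x%:mx - y%:mx).

Lemma cong_refl k x : cong k x x.
Proof. by rewrite /cong subrr; exact: ftri0. Qed.

Lemma cong_sym k x y : cong k x y -> cong k y x.
Proof. by rewrite /cong -[y%:mx - _]opprB; apply: ftriN. Qed.

Lemma cong1 x y : cong 1 x y.
Proof.
rewrite /cong -(subrK 1 x%:mx) -addrA; apply: ftriD; first exact: unitri_sub1.
by rewrite -opprB; apply/ftriN/unitri_sub1.
Qed.

Lemma cong_le k l x y : (l <= k)%N -> cong k x y -> cong l x y.
Proof. exact: ftri_le. Qed.

Lemma cong_top x y : cong s.+1 x y -> x = y.
Proof. by move=> /ftri_top/subr0_eq; apply: val_inj. Qed.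

Lemma congM k x y u v : cong k x y -> cong k u v -> cong k (x * u)%g (y * v)%g.
Proof.
move=> h1 h2; rewrite /cong !unitri_mxM.
rewrite (_ : _ - _ = (x%:mx - y%:mx) * u%:mx + y%:mx * (u%:mx - v%:mx)); last first.
  by rewrite mulrBl mulrBr addrA subrK.
by apply: ftriD; [rewrite -[k]addn0; apply: ftriM => //|apply: (@ftriM 0 k) => //]; apply: unitri_upper.
Qed.

Lemma congV k x y : cong k x y -> cong k x^-1%g y^-1%g.
Proof.
move=> h; rewrite /cong.
have -> : x^-1%g%:mx - y^-1%g%:mx = x^-1%g%:mx * ((y%:mx - x%:mx) * y^-1%g%:mx).
  by rewrite mulrBl (unitri_mxV y).2 mulrBr mulr1 mulrA (unitri_mxV x).1 mul1r.
apply: (@ftriM 0 k); first exact: unitri_upper.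
rewrite -[k]addn0; apply: ftriM; [exact: cong_sym|exact: unitri_upper].
Qed.

Lemma cong_expgz k x y a : cong k x y -> cong k (expgz x a) (expgz y a).
Proof.
move=> h; have X i : cong k (x ^+ i)%g (y ^+ i)%g.
  elim: i => [|i IH]; first exact: cong_refl.
  by rewrite !expgS; apply: congM.
by case: a => i; [exact: X|apply/congV/X].
Qed.

Lemma cong_prod k (r : nat) (F F' : 'I_r -> unitri) :
  (forall i, cong k (F i) (F' i)) -> cong k (\prod_(i < r) F i)%g (\prod_(i < r) F' i)%g.
Proof.
move=> h; apply: (big_ind2 (cong k)) => //; [exact: cong_refl|].
by move=> *; apply: congM.
Qed.

(* Conjugating gains one superdiagonal because m - 1 is strictly upper triangular. *)
Lemma cong_conj k x u v : cong k u v -> cong k.+1 (x ^ u)%g (x ^ v)%g.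
Proof.
move=> h; have hV := congV h; rewrite /cong !conjgE !unitri_mxM.
have E w : w^-1%g%:mx * (x%:mx * w%:mx) = 1 + w^-1%g%:mx * ((x%:mx - 1) * w%:mx).
  by rewrite mulrBl mul1r mulrBr (unitri_mxV w).1 addrC subrK.
rewrite !E opprD addrACA subrr add0r; set N := x%:mx - 1.
have N1 : ftri 1 N := unitri_sub1 x; clearbody N.
have -> : u^-1%g%:mx * (N * u%:mx) - v^-1%g%:mx * (N * v%:mx) =
   (u^-1%g%:mx - v^-1%g%:mx) * (N * u%:mx) + v^-1%g%:mx * (N * (u%:mx - v%:mx)).
  by rewrite [in RHS]mulrBl [N * (_ - _)]mulrBr [_ * (_ - _)]mulrBr addrA subrK.
apply: ftriD.
  rewrite -addn1 -[1%N]addn0; apply: ftriM; first exact: hV.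
  exact: ftriM N1 (unitri_upper u).
apply: (@ftriM 0 k.+1); first exact: unitri_upper.
exact: (@ftriM 1 k).
Qed.

End Unitriangular.

(** * Substituting strictly triangular matrices into power series *)

Section Theta.
Variables (K : comNzRingType) (s n : nat).
Local Notation mx := 'M[K]_s.+1.
Variable N : 'I_n -> mx.
Hypothesis N1 : forall x, ftri 1 (N x).
Implicit Types (f g : ncseries n) (k : nat).

(* The substitution X_x := N x in the part of f of degree at most k. *)
Fixpoint theta k f : mx :=
  (f [::])%:~R + (if k is k'.+1 then \sum_x N x * theta k' (fun w => f (x :: w)) else 0).

Lemma int_mxE (z : int) (a b : 'I_s.+1) : (z%:~R : mx) a b = z%:~R *+ (a == b).
Proof. by rewrite -(rmorph_int (@scalar_mx K s.+1)) mxE. Qed.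

Lemma thetaD k f g : theta k (fun w => f w + g w) = theta k f + theta k g.
Proof.
elim: k f g => [|k IH] f g /=; first by rewrite !addr0 intrD.
rewrite intrD addrACA; congr (_ + _); rewrite -big_split; apply: eq_bigr => x _.
by rewrite IH mulrDr.
Qed.

Lemma thetaZ k c f : theta k (fun w => c * f w) = theta k f *~ c.
Proof.
elim: k f => [|k IH] f /=; first by rewrite !addr0 mulrC mulrzA.
rewrite mulrzDl mulrC mulrzA; congr (_ + _); rewrite mulrz_suml; apply: eq_bigr => x _.
by rewrite IH mulrzAr.
Qed.

Lemma theta0 k : theta k (fun=> 0) = 0.
Proof. by elim: k => [|k IH] /=; rewrite ?addr0 // add0r big1 // => x _; rewrite IH mulr0. Qed.

Lemma theta1 k : theta k 1 = 1.
Proof.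
case: k => [|k] /=; first by rewrite addr0.
by rewrite big1 ?addr0 // => x _; rewrite (theta0 k) mulr0.
Qed.

Lemma ftri_int (z : int) : ftri 0 (z%:~R : mx).
Proof.
move=> a b ab; rewrite int_mxE; case: eqP => // e.
by move: ab; rewrite e addn0 ltnn.
Qed.

Lemma theta_upper k f : ftri 0 (theta k f).
Proof.
elim: k f => [|k IH] f /=; apply: ftriD; try exact: ftri_int; first exact: ftri0.
by apply: ftri_sum => x _; apply: (@ftri_le _ _ 1) => //; apply: (@ftriM _ _ 1 0).
Qed.

Lemma theta_diag k f a : theta k f a a = (f [::])%:~R.
Proof.
case: k => [|k] /=; rewrite mxE int_mxE eqxx mulr1n; first by rewrite mxE addr0.
rewrite [X in _ + X](_ : _ = 0) ?addr0 //.
have : ftri 1 (\sum_x N x * theta k (fun w => f (x :: w))).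
  by apply: ftri_sum => x _; apply: (@ftriM _ _ 1 0) => //; apply: theta_upper.
by apply; rewrite addn1.
Qed.

Lemma theta_succ k f : ftri k.+1 (theta k.+1 f - theta k f).
Proof.
elim: k f => [|k IH] f.
  rewrite /= addr0 addrAC subrr add0r; apply: ftri_sum => x _.
  by apply: (@ftriM _ _ 1 0) => //; rewrite addr0; exact: ftri_int.
have -> : theta k.+2 f - theta k.+1 f =
  \sum_x N x * (theta k.+1 (fun w => f (x :: w)) - theta k (fun w => f (x :: w))).
  transitivity (\sum_x N x * theta k.+1 (fun w => f (x :: w)) - \sum_x N x * theta k (fun w => f (x :: w))).
    by rewrite [theta k.+2 f]/= [theta k.+1 f in LHS]/= opprD addrACA subrr add0r.
  by rewrite -sumrB; apply: eq_bigr => x _; rewrite mulrBr.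
by apply: ftri_sum => x _; apply: (@ftriM _ _ 1 k.+1).
Qed.

(** Truncation is multiplicative up to terms of degree above [k], which lie beyond the k-th
    superdiagonal. For [k = s] no such terms are left. *)
Lemma thetaM k f g : ftri k.+1 (theta k (nc_mul f g) - theta k f * theta k g).
Proof.
elim: k f g => [|k IH] f g.
  by rewrite /= !addr0 nc_mul_nil intrM subrr; exact: ftri0.
set fx := fun x w => f (x :: w).
have -> : theta k.+1 (nc_mul f g) - theta k.+1 f * theta k.+1 g =
  \sum_x N x * ((theta k (nc_mul (fx x) g) - theta k (fx x) * theta k g) -
                theta k (fx x) * (theta k.+1 g - theta k g)).
  have E1 : theta k.+1 (nc_mul f g) = theta k.+1 g *~ f [::] +
      \sum_x N x * theta k (nc_mul (fx x) g).
    rewrite /= nc_mul_nil mulrzDl [f [::] * _]mulrC mulrzA -addrA; congr (_ + _).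
    rewrite mulrz_suml -big_split; apply: eq_bigr => x _.
    have -> : (fun w => nc_mul f g (x :: w)) =
        (fun w => f [::] * g (x :: w) + nc_mul (fx x) g w).
      by apply/funext => w; rewrite nc_mul_cons.
    by rewrite thetaD thetaZ mulrDr mulrzAr.
  have E2 : theta k.+1 f * theta k.+1 g = theta k.+1 g *~ f [::] +
      \sum_x N x * (theta k (fx x) * theta k.+1 g).
    rewrite [theta k.+1 f]/= mulrDl mulrzl; congr (_ + _).
    by rewrite mulr_suml; apply: eq_bigr => x _; rewrite mulrA.
  rewrite E1 E2 opprD addrACA subrr add0r -sumrB; apply: eq_bigr => x _.
  rewrite -mulrBr; congr (_ * _); by rewrite mulrBr opprB addrA subrK.
apply: ftri_sum => x _; apply: (@ftriM _ _ 1 k.+1) => //; apply: ftriB; first exact: IH.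
by apply: (@ftriM _ _ 0 k.+1); [exact: theta_upper|exact: theta_succ].
Qed.

Lemma theta_topM f g : theta s (f * g) = theta s f * theta s g.
Proof. by apply/subr0_eq/ftri_top/thetaM. Qed.

Lemma nc_gen_cons i x : (fun w => (1 + nc_var i : ncseries n) (x :: w)) =
  if x == i then (1 : ncseries n) else (fun=> 0).
Proof.
apply: funext => w.
rewrite [LHS]/GRing.add /= [X in X + _]/GRing.one /= /nc_one /nc_var /= eqseq_cons add0r.
by case: (x == i); reflexivity.
Qed.

Lemma theta_gen i : (0 < s)%N -> theta s (1 + nc_var i) = 1 + N i.
Proof.
have E k : theta k.+1 (1 + nc_var i) = 1 + N i.
  rewrite /= (_ : (1 + nc_var i : ncseries n) [::] = 1) //; congr (_ + _).
  rewrite (bigD1 i) //= big1 ?addr0 => [|x xi]; first by rewrite nc_gen_cons eqxx theta1 mulr1.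
  by rewrite nc_gen_cons (negbTE xi) theta0 mulr0.
by move=> s0; have := E s.-1; rewrite prednK.
Qed.

End Theta.

(** * Matrix entries as Magnus coefficients *)

Section Corner.
Variables (K : comNzRingType) (n : nat) (J : seq 'I_n).
Local Notation s := (size J).
Local Notation mx := 'M[K]_s.+1.
Implicit Types (a b c : 'I_s.+1) (f : ncseries n).

Definition seg (a b : nat) : seq 'I_n := take (b - a) (drop a J).

Lemma size_seg a b : size (seg a b) = (b - a)%N.
Proof.
rewrite /seg size_take size_drop; have := ltn_ord b; rewrite ltnS => bs.
by case: ltnP => // h; apply/eqP; rewrite eqn_leq h leq_sub2r.
Qed.

Lemma seg_cat (a c b : nat) : (a <= c)%N -> (c <= b)%N -> seg a b = seg a c ++ seg c b.
Proof.
move=> ac cb; have E : drop c J = drop (c - a) (drop a J) by rewrite drop_drop subnK.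
have {1}-> : seg a b = take ((c - a) + (b - c)) (drop a J) by rewrite /seg; congr take; lia.
by rewrite takeD /seg E.
Qed.

Lemma seg_cons x0 (a b : nat) : (a < b)%N -> (a < s)%N -> seg a b = nth x0 J a :: seg a.+1 b.
Proof. by move=> ab as'; rewrite /seg (drop_nth x0 as') subnS -{1}(prednK (n := b - a)) ?subn_gt0. Qed.

Lemma segE : seg 0 s = J.
Proof. by rewrite /seg subn0 drop0 take_size. Qed.

Lemma mem_seg x0 (a b d : nat) : (a <= d)%N -> (d < b)%N -> (d < s)%N -> nth x0 J d \in seg a b.
Proof.
move=> ad db ds; rewrite (seg_cat ad (ltnW db)) mem_cat (seg_cons x0 db ds) inE eqxx.
by rewrite orbT.
Qed.

Section Entries.
Variable N : 'I_n -> mx.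
Hypothesis N1 : forall x, ftri 1 (N x).
Hypothesis N_next : forall x a b, b = a.+1 :> nat -> N x a b = (nth x J a == x)%:R.

(** On the first superdiagonal, row [a] of [N x] is nonzero only for the letter [x] of [J] at place
    [a]. The hypothesis disposes of the entries further to the right. *)
Lemma theta_step k f a b x0 : (a < b)%N ->
  (forall x c, N x a c != 0 -> (c > a.+1)%N -> theta N k (fun w => f (x :: w)) c b = 0) ->
  theta N k.+1 f a b = theta N k (fun w => f (nth x0 J a :: w)) (inord a.+1) b.
Proof.
move=> ab far; have as' : (a < s)%N by rewrite (leq_trans ab) // -ltnS ltn_ord.
have a1 : (inord a.+1 : 'I_s.+1) = a.+1 :> nat by rewrite inordK.
rewrite /= mxE int_mxE (negbTE (_ : a != b)) ?mulr0n ?add0r; last by rewrite -val_eqE /= ltn_eqF.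
have E x : (N x * theta N k (fun w => f (x :: w))) a b =
    (nth x0 J a == x)%:R * theta N k (fun w => f (x :: w)) (inord a.+1) b.
  rewrite mxE (bigD1 (inord a.+1)) //= N_next // (set_nth_default x0) //.
  rewrite big1 ?addr0 // => c /negbTE ca; case: (ltngtP c a.+1) => [lt|gt|e].
  - by rewrite N1 ?mul0r // addn1.
  - by have [->|nz] := eqVneq (N x a c) 0; [rewrite mul0r|rewrite (far x c nz gt) mulr0].
  - by move: ca; rewrite -val_eqE /= a1 e eqxx.
rewrite summxE (eq_bigr _ (fun x _ => E x)) (bigD1 (nth x0 J a)) //= eqxx mul1r.
by rewrite big1 ?addr0 // => x /negbTE; rewrite eq_sym => ->; rewrite mul0r.
Qed.

(* Only the adjacent factorization of J[a..b) contributes: the other products of the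
   N x in the entry (a, b) come from words in which f vanishes. *)
Lemma theta_corner k f a b : (forall x a c, N x a c != 0 -> x \in seg a c) ->
  (b - a <= k)%N -> (a < b)%N ->
  (forall u, u != [::] -> subseq u (seg a b) -> (size u < b - a)%N -> (f u)%:~R = 0 :> K) ->
  theta N k f a b = (f (seg a b))%:~R.
Proof.
move=> Nseg; elim: k f a b => [|k IH] f a b; first by rewrite leqn0 subn_eq0 leqNgt => /negP.
move=> bak ab van; have as' : (a < s)%N by rewrite (leq_trans ab) // -ltnS ltn_ord.
have x0 : 'I_n by move: (leq_ltn_trans (leq0n a) as'); clear; case: J.
have a1 : (inord a.+1 : 'I_s.+1) = a.+1 :> nat by rewrite inordK.
rewrite (@theta_step k f a b x0 ab); last first.
  move=> x c nz ac; have xac := Nseg _ _ _ nz.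
  have [bc|cb|e] := ltngtP b c.
  - by apply: (theta_upper N1); rewrite addn0.
  (* Going from [a] to [c] with one letter skips at least one place, so the word read is a shorter
     subsequence, on which [f] vanishes. *)
  - have sz : (size (x :: seg c b) < b - a)%N.
      by rewrite /= size_seg ltn_subRL -addnS; have := ltnW cb; move: ac cb; lia.
    have sub : subseq (x :: seg c b) (seg a b).
      rewrite (seg_cat (ltnW (ltnW ac)) (ltnW cb)).
      by rewrite -cat1s; apply: cat_subseq => //; rewrite sub1seq.
    rewrite IH //; first by rewrite (van _ _ sub sz).
      by move: bak ac; lia.
    move=> u u0 su szu; apply: van => //.
      by apply: subseq_trans sub; rewrite /= eqxx.
    by apply: leq_ltn_trans sz; rewrite /= size_seg ltnS ltnW.
  - have {e}e : b = c by apply/val_inj.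
    subst c; rewrite (theta_diag N1); apply: van => //; first by rewrite sub1seq.
    by rewrite /= ltn_subRL addn1.
rewrite (seg_cons x0 ab as').
have [ltb|] := ltnP a.+1 b; last first.
  move=> ba; have e : b = inord a.+1 by apply/val_inj; rewrite /= a1; apply/eqP; rewrite eqn_leq ba.
  by rewrite {1}e (theta_diag N1) /seg e a1 subnn take0.
rewrite IH ?a1 //; first by move: bak ab; lia.
move=> u u0 su szu; apply: van => //; first by rewrite (seg_cons x0 ab as') /= eqxx.
by move: szu; rewrite /=; lia.
Qed.

End Entries.

(** The path of length [size J] whose steps are labelled by [J], with the steps labelled [x] as
    matrix units. A product of such matrices has a nonzero entry (a, b) only for the word
    J[a..b). *)
Definition elem_mx (x : 'I_n) : mx := \matrix_(a, b) ((b == a.+1 :> nat) && (nth x J a == x))%:R.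

Lemma elem_next x a b : b = a.+1 :> nat -> elem_mx x a b = (nth x J a == x)%:R.
Proof. by move=> e; rewrite mxE e eqxx. Qed.

Lemma ftri_elem x : ftri 1 (elem_mx x).
Proof. by move=> a b; rewrite addn1 mxE => ab; rewrite ltn_eqF. Qed.

Lemma theta_elem k f a b : (b - a <= k)%N -> (a < b)%N ->
  theta elem_mx k f a b = (f (seg a b))%:~R.
Proof.
elim: k f a b => [|k IH] f a b; first by rewrite leqn0 subn_eq0 leqNgt => /negP.
move=> bak ab; have as' : (a < s)%N by rewrite (leq_trans ab) // -ltnS ltn_ord.
have x0 : 'I_n by move: (leq_ltn_trans (leq0n a) as'); clear; case: J.
have a1 : (inord a.+1 : 'I_s.+1) = a.+1 :> nat by rewrite inordK.
rewrite (@theta_step _ ftri_elem elem_next k f a b x0 ab); last first.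
  by move=> x c; rewrite mxE; case e : (c == a.+1 :> nat); rewrite ?(eqP e) ?ltnn ?eqxx.
rewrite (seg_cons x0 ab as').
have [ltb|ba] := ltnP a.+1 b; last first.
  have e : b = inord a.+1 by apply/val_inj; rewrite /= a1; apply/eqP; rewrite eqn_leq ba.
  by rewrite {1}e (theta_diag ftri_elem) /seg e a1 subnn take0.
by rewrite IH ?a1 //; move: bak ab; lia.
Qed.

Fact elem_subproof x : is_unitri (1 + elem_mx x).
Proof. by apply/is_unitriP; rewrite addrAC subrr add0r; apply: ftri_elem. Qed.

Definition elem x : unitri K s := Unitri (elem_subproof x).

Lemma conj_elem_mx x (g : unitri K s) :
  unitri_mx (elem x ^ g)%g - 1 = unitri_mx g^-1%g * (elem_mx x * unitri_mx g).
Proof.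
rewrite conjgE !unitri_mxM /= mulrDl mul1r mulrDr (unitri_mxV g).1.
by rewrite addrAC subrr add0r.
Qed.

(** By [cong_conj] and [cong1], conjugation leaves the first superdiagonal alone. *)
Lemma conj_elem_next x (g : unitri K s) a b : b = a.+1 :> nat ->
  (unitri_mx (elem x ^ g)%g - 1) a b = (nth x J a == x)%:R.
Proof.
move=> e; have := cong_conj (elem x) (cong1 g 1%g); rewrite conjg1 => /(_ a b).
rewrite e addn2 ltnSn => /(_ isT); rewrite mxE [X in _ + X]mxE => /subr0_eq E.
by rewrite mxE E -[RHS](elem_next x e) /= !mxE addrC addKr.
Qed.

(** By triangularity of the outer factors, a nonzero term contains a step labelled [x] between [a]
    and [c]. *)
Lemma conj_elem_seg x (g : unitri K s) a c :
  (unitri_mx (elem x ^ g)%g - 1) a c != 0 -> x \in seg a c.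
Proof.
apply: contraR => xac; rewrite conj_elem_mx mxE big1 // => d _.
have [da|ad] := ltnP d a; first by rewrite (unitri_upper g^-1%g) ?mul0r // addn0.
rewrite mxE big1 ?mulr0 // => e _; rewrite mxE; case: eqP => [ed|]; last by rewrite mul0r.
have [ce|ec] := ltnP c e; first by rewrite (unitri_upper g) ?mulr0 // addn0.
case: eqP => [xe|]; last by rewrite mul0r.
case/negP: xac; rewrite -xe; apply: mem_seg => //; first by rewrite -ed.
by rewrite -ltnS -ed ltn_ord.
Qed.

End Corner.

Section Representation.
Variables (K : comNzRingType) (s n : nat) (g : 'I_n -> unitri K s).
Hypothesis s0 : (0 < s)%N.

Definition gen_mx (x : 'I_n) : 'M[K]_s.+1 := unitri_mx (g x) - 1.

Lemma ftri_gen x : ftri 1 (gen_mx x).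
Proof. exact: unitri_sub1. Qed.

Lemma lift_magnus (w : freeGroup 'I_n) : unitri_mx (fg_lift g w) = theta gen_mx s (magnus w).
Proof.
rewrite /fg_lift /magnus; elim: (fgword w) => [|x l IH]; first by rewrite !big_nil theta1.
rewrite !big_cons unitri_mxM IH (theta_topM ftri_gen); congr (_ * _).
have E : theta gen_mx s (1 + nc_var x.1) = unitri_mx (g x.1).
  by rewrite (theta_gen _ _ s0) addrC subrK.
rewrite /magnus_letter; case: x.2; last by rewrite E.
have T := theta_topM ftri_gen (1 + nc_var x.1) (1 + nc_var x.1)^-1.
rewrite mulrV ?nc_1DX_unit // theta1 E in T.
by rewrite -[LHS]mulr1 T mulrA (unitri_mxV _).1 mul1r.
Qed.

End Representation.

(** * Milnor numbers and colourings *)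

Section StepCount.
Variables (R : realType) (G : groupType).
Implicit Types (us : seq (R * G)).

Lemma stepf_count (c : G) us t : sorted (@before R G) us ->
  stepf c us t = (c * \prod_(x <- take (count (fun x => (x.1 < t)%R) us) us) x.2)%g.
Proof.
elim: us c => [|[u d] us IH] c /=; first by rewrite big_nil mulg1.
move=> srt; have all_us := before_all srt; case: leP => [tu|ut] /=; last first.
  by rewrite IH ?(path_sorted srt) // big_cons mulgA.
rewrite (eqP (_ : count _ us == 0%N)) /= ?big_nil ?mulg1 //.
rewrite -leqn0 leqNgt -has_count; apply/hasPn => x /(allP all_us) /= ux.
by rewrite -leNgt (le_trans tu) // ltW.
Qed.

Lemma stepf_nth (c : G) (l : seq R) (F : nat -> G) t : sorted <%R l ->
  stepf c (mkseq (fun k => (nth 0 l k, F k)) (size l)) t =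
  (c * \prod_(k < count (fun u => (u < t)%R) l) F k)%g.
Proof.
move=> srt; set us := mkseq _ _; have fst_us : [seq x.1 | x <- us] = l.
  by rewrite /us -map_comp -[RHS](mkseq_nth 0).
rewrite stepf_count; last by move: srt; rewrite -[in X in X -> _]fst_us sorted_map.
congr (_ * _)%g; have -> : count (fun x : R * G => x.1 < t) us = count (fun u => u < t) l.
  by rewrite -[in RHS]fst_us [RHS]count_map.
have := count_size (fun u => u < t) l; set j := count _ _ => js.
rewrite /us /mkseq -map_take take_iota (minn_idPl js) big_map.
by rewrite -[in RHS](big_mkord xpredT F) /index_iota subn0.
Qed.

Lemma jumpf_mem us t d : sorted (@before R G) us -> (t, d) \in us -> jumpf us t = d.
Proof.
elim: us => //= -[u e] us IH srt; rewrite inE => /orP[/eqP[-> ->]|tus]; first by rewrite eqxx.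
have := allP (before_all srt) _ tus => /= ut; rewrite gt_eqF //.
by apply: IH => //; apply: path_sorted srt.
Qed.

Lemma jumpf_notin us t : t \notin [seq x.1 | x <- us] -> jumpf us t = 1%g.
Proof.
by elim: us => //= -[u e] us IH; rewrite inE negb_or => /andP[/negbTE-> /IH].
Qed.

End StepCount.

(** * From solutions of the arc recursion to colourings *)

Section UnderCrossings.
Variables (R : realType) (n : nat) (D : vdiagram R n) (p : 'I_n -> R).
Hypothesis bp : base_point_system D p.

Lemma finite_under i : finite_set [set t | p i < t < p i + 1 /\ info D i t = Under].
Proof.
pose z := Num.floor (p i); have /andP[z1 z2] := floor_itv (p i); have F := curve_finite D i.
set A := [set s | _] in F.
apply: (@sub_finite_set _ _ (((fun s => s + z%:~R) @` A) `|` ((fun s => s + (z + 1)%:~R) @` A))); last first.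
  by rewrite finite_setU; split; apply: finite_image.
move=> t [/andP[t1 t2] it].
have X (w : int) : w%:~R <= t < w%:~R + 1 -> A (t - w%:~R).
  move=> /andP[w1 w2]; split; first by apply/andP; split; lra.
  by apply/info_plain; rewrite -mulrNz info_shift it.
rewrite -/z intrD in z1 z2.
have [tz|zt] := ltP t (z%:~R + 1).
  by left; exists (t - z%:~R); [apply: X; rewrite tz andbT; lra|rewrite subrK].
right; exists (t - (z + 1)%:~R); [apply: X; rewrite intrD|by rewrite subrK].
by apply/andP; split; lra.
Qed.

Lemma mem_unders i t : t \in unders D p i <-> p i < t < p i + 1 /\ info D i t = Under.
Proof.
rewrite /unders mem_sort; set A := [set t | _].
have -> : (t \in finmap.enum_fset (fset_set A)) = (t \in A) by exact: (in_fset_set (finite_under i)).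
by rewrite inE.
Qed.

Lemma unders_sorted i : sorted <%R (unders D p i).
Proof.
rewrite lt_sorted_uniq_le sort_uniq finmap.fset_uniq /=.
exact: sort_le_sorted.
Qed.

Lemma path_unders i : path <%R (p i) (unders D p i).
Proof.
rewrite path_sortedE; last by move=> x y z; apply: lt_trans.
by rewrite unders_sorted andbT; apply/allP => t /mem_unders[/andP[]].
Qed.

Lemma count_unders i (t : R) : (count (fun u => (u < t)%R) (unders D p i) <= size (unders D p i))%N.
Proof. exact: count_size. Qed.

(** The over-passage has a translate in the window closed on the right; it is not the right end,
    since base points are plain. *)
Lemma over_siteP i u : u \in unders D p i ->
  [/\ p (over_site D p i u).1 < (over_site D p i u).2 < p (over_site D p i u).1 + 1 &
      crosses (curve D) i u (over_site D p i u).1 (over_site D p i u).2].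
Proof.
move=> /mem_unders[_ iu].
have [k [v [X kv]]] := under_site iu; have [z /andP[z1 z2]] := int_window' (p k) v.
have [|x1 e x3] := @xgetPex _ (i, u) [set x | [/\ p x.1 < x.2 < p x.1 + 1,
    curve D x.1 x.2 = curve D i u & info D x.1 x.2 = Over]].
  exists (k, v + z%:~R) => /=; split.
  - rewrite z1 /= lt_neqAle z2 andbT; apply/eqP => e.
    have := bp k; have := kv; rewrite -(info_shift D k v z) e.
    by have := info_shift D k (p k) 1 => /= ->  ->.
  - by rewrite curve_shift; case: X.
  - by rewrite info_shift.
split=> //; split=> // -[/= e1 [w ew]].
move: x3; rewrite -/(over_site D p i u) -e1 ew info_shift iu.
by [].
Qed.

Definition arc_longitude (G : groupType) (y : diagram_arc D p -> G) i j : G :=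
  (\prod_(k < j) expgz (y (over_arc D p i k)) (under_sign D p i k))%g.

(* y solves the limit of the recursion which defines the eta_q. *)
Definition arc_system (G : groupType) (m : 'I_n -> G) (y : diagram_arc D p -> G) : Prop :=
  forall a, y a = (m (tag a) ^ arc_longitude y (tag a) (tagged a))%g.

Lemma arc_atE (G : groupType) (m : 'I_n -> G) y i (t : R) : arc_system m y ->
  y (arc_at D p i t) = (m i ^ arc_longitude y i (count (fun u => (u < t)%R) (unders D p i)))%g.
Proof.
by move=> ys; rewrite ys /arc_at /mk_arc /= inordK // ltnS count_unders.
Qed.

Section ArcSteps.
Variables (G : groupType) (m : 'I_n -> G) (y : diagram_arc D p -> G).

Definition arc_steps i : seq (R * G) := mkseq (fun k =>
  (nth 0 (unders D p i) k, expgz (y (over_arc D p i k)) (under_sign D p i k))) (size (unders D p i)).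

Lemma arc_steps_fst i : [seq x.1 | x <- arc_steps i] = unders D p i.
Proof. by rewrite /arc_steps -map_comp -[RHS](mkseq_nth 0). Qed.

Lemma arc_steps_sorted i : sorted (@before R G) (arc_steps i).
Proof. by have := unders_sorted i; rewrite -[in X in X -> _]arc_steps_fst sorted_map. Qed.

Lemma stepf_arc c i (t : R) : stepf c (arc_steps i) t =
  (c * arc_longitude y i (count (fun u => (u < t)%R) (unders D p i)))%g.
Proof. by rewrite /arc_steps stepf_nth //; apply: unders_sorted. Qed.

Lemma arc_steps_jump i k : (k < size (unders D p i))%N ->
  jumpf (arc_steps i) (nth 0 (unders D p i) k) = expgz (y (over_arc D p i k)) (under_sign D p i k).
Proof.
move=> ks; apply: jumpf_mem; first exact: arc_steps_sorted.
by apply/(nthP (0, 1%g)); exists k; rewrite ?size_mkseq // nth_mkseq.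
Qed.

Hypothesis ys : arc_system m y.

Definition arc_monodromy i : G := arc_longitude y i (size (unders D p i)).
Hypothesis c : forall i, commute (m i) (arc_monodromy i).

(** [t - z] lies in the window from [p i] to [p i + 1], open on the left and closed on the right;
    this makes the function left-continuous at the base point. *)
Definition arc_coloring i t : G :=
  let z := laps (p i) t - 1 in
  (expgz (arc_monodromy i) z * stepf 1 (arc_steps i) (t - z%:~R))%g.

Lemma arc_coloring1 i t : arc_coloring i (t + 1) = (arc_monodromy i * arc_coloring i t)%g.
Proof.
rewrite /arc_coloring laps1 /= mulgA.
have E : (arc_monodromy i * expgz (arc_monodromy i) (laps (p i) t - 1))%g =
    expgz (arc_monodromy i) (laps (p i) t + 1 - 1).
  by rewrite -[X in (X * _)%g]expgz1 -expgzD; congr expgz; lia.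
rewrite E; congr (_ * stepf _ _ _)%g.
by rewrite !intrB intrD; lra.
Qed.

Lemma arc_coloring_window i (t : R) : p i < t <= p i + 1 ->
  arc_coloring i t = arc_longitude y i (count (fun u => (u < t)%R) (unders D p i)).
Proof.
move=> /andP[t1 t2]; rewrite /arc_coloring (@lapsE _ _ _ 1); last first.
  by apply/andP; split; lra.
by rewrite subrr subr0 mul1g stepf_arc mul1g.
Qed.

Lemma arc_jump i t : p i < t < p i + 1 ->
  jump D m arc_coloring i t = jumpf (arc_steps i) t.
Proof.
move=> t12; have [tu|tu] := boolP (t \in unders D p i); last first.
  rewrite jumpf_notin ?arc_steps_fst // jump_not_under // => it.
  by case/negP: tu; apply/mem_unders.
have [xp X] := over_siteP tu; have [_ it] := (mem_unders i t).1 tu.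
have k_lt : (index t (unders D p i) < size (unders D p i))%N by rewrite index_mem.
have J := arc_steps_jump k_lt; rewrite /over_arc /under_sign (nth_index 0 tu) in J.
rewrite (jumpE c arc_coloring1 it X) J.
set x := over_site D p i t in xp X *.
have -> : ((x.1, x.2) = x) by case: (x).
congr (expgz _ _).
rewrite (arc_atE _ _ ys) /meridian arc_coloring_window //.
by move: xp => /andP[-> /ltW->].
Qed.

Lemma arc_coloringP : coloring D m arc_monodromy arc_coloring.
Proof.
split=> [|i t]; first exact: arc_coloring1.
set z := laps (p i) t - 1; have /andP[z1 z2] := laps_itv (p i) t.
rewrite -/z in z1; have z2' : t - p i <= z%:~R + 1 by rewrite /z intrB subrK.
split.
  have L := laps_left (p i) t.
  have S := @left_shift R G (stepf 1%g (arc_steps i)) t (- z%:~R) (stepf_left _ _ _).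
  rewrite /left_const /arc_coloring -/z; near=> s.
  have -> : laps (p i) s = laps (p i) t by near: s.
  by rewrite -/z; congr (_ * _)%g; near: s; exact: S.
(* At a translate of the base point the step function has passed all under-crossings; its total is
   the monodromy with which the next window starts. *)
have [sp|nsp] := pselect (same_point (p i) t).
  have pt : t - z%:~R = p i + 1.
    have [w tw] := sp; have ww : w = z + 1.
      apply: (@int_close R); rewrite intrD; rewrite tw in z1 z2'.
      by rewrite ltr_norml; apply/andP; split; lra.
    by rewrite ww intrD in tw; lra.
  have Rt : right_jump (stepf 1%g (arc_steps i)) (p i) (jumpf (arc_steps i) (p i)).
    by apply: stepf_right; apply: arc_steps_sorted.
  have allp : all (fun x => p i < x.1) (arc_steps i).
    rewrite -(all_map fst (fun u => p i < u)) arc_steps_fst.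
    by apply/allP => u /mem_unders[/andP[]].
  rewrite jumpf1 // in Rt.
  rewrite jump_not_under; last first.
    by move: sp => [w ->]; rewrite info_shift bp.
  rewrite /right_jump /arc_coloring -/z pt mulg1.
  have Z := laps_right1 sp.
  have tp : t + - (z + 1)%:~R = p i by move: pt; rewrite intrD; lra.
  rewrite -tp in Rt; have S := right_shift Rt.
  near=> s; have -> : laps (p i) s = laps (p i) t + 1 by near: s.
  have -> : laps (p i) t + 1 - 1 = z + 1 by rewrite /z; lia.
  rewrite expgzD -mulgA; congr (_ * _)%g; rewrite expgz1.
  have -> : stepf 1%g (arc_steps i) (s - (z + 1)%:~R) = 1%g.
    rewrite (near S s) // mulg1 stepf_before // tp.
    by apply: sub_all allp => u /=; exact: ltW.
  rewrite mulg1 stepf_arc mul1g /arc_monodromy; congr (arc_longitude y i _).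
  apply/esym/eqP; rewrite -all_count; apply/allP => u /mem_unders[/andP[]] //.
have lt_t : p i < t - z%:~R < p i + 1.
  apply/andP; split; first by lra.
  rewrite lt_neqAle; apply/andP; split; last by lra.
  by apply/eqP => e; apply: nsp; exists (z + 1); rewrite intrD; lra.
have J := jump_shift D c arc_coloring1 i t (- z).
rewrite mulrNz (arc_jump lt_t) in J; rewrite -J.
have L := laps_right nsp.
have S := right_shift (stepf_right 1%g (t - z%:~R) (arc_steps_sorted i)).
rewrite /right_jump /arc_coloring -/z; near=> s.
have -> : laps (p i) s = laps (p i) t by near: s.
by rewrite -/z -mulgA; congr (_ * _)%g; near: s; exact: S.
Unshelve. all: by end_near. Qed.

End ArcSteps.
End UnderCrossings.

(** * From colourings back to the arc recursion *)

Section ColoringSystem.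
Variables (R : realType) (n : nat) (D : vdiagram R n) (p : 'I_n -> R).
Hypothesis bp : base_point_system D p.
Variables (G : groupType) (m lam : 'I_n -> G) (h : 'I_n -> R -> G).
Hypothesis c : forall i, commute (m i) (lam i).
Hypothesis hh : coloring D m lam h.
Local Open Scope group_scope.

Definition walk_longitude i j : G := \prod_(k < j) jump D m h i (nth 0%R (unders D p i) k).

Lemma coloring_window i t : (p i <= t <= p i + 1)%R ->
  h i t = h i (p i) * walk_longitude i (count (fun u => (u < t)%R) (unders D p i)).
Proof.
move=> ti; have Jp : jump D m h i (p i) = 1 by apply: jump_not_under; rewrite bp.
rewrite (steps_walk (proj2 hh i) Jp (path_unders D p i) (b := (p i + 1)%R) _ ti); last first.
  move=> u up uu; apply: jump_not_under => iu.
  by case/negP: uu; apply/mem_unders.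
have S := stepf_nth (h i (p i)) (fun k => jump D m h i (nth 0%R (unders D p i) k)) t
  (unders_sorted D p i).
rewrite -[RHS]S; congr (stepf _ _ t).
by rewrite -{1}(mkseq_nth 0%R (unders D p i)) -map_comp.
Qed.

Definition walk_system (a : diagram_arc D p) : G :=
  (m (tag a) ^ h (tag a) (p (tag a))) ^ walk_longitude (tag a) (tagged a).

Lemma walk_longitudeE i j : (j <= size (unders D p i))%N ->
  walk_longitude i j = arc_longitude walk_system i j.
Proof.
move=> js; apply: eq_bigr => k _; have ks := leq_trans (ltn_ord k) js.
have uk : nth 0%R (unders D p i) k \in unders D p i by apply: mem_nth.
have [xp X] := over_siteP bp uk; have [_ iu] := (mem_unders D p _ _).1 uk.
rewrite (jumpE c (proj1 hh) iu X) /over_arc /under_sign.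
set x := over_site D p i _ in xp X *.
have -> : ((x.1, x.2) = x) by case: (x).
congr (expgz _ _); rewrite /walk_system /arc_at /mk_arc /= inordK ?ltnS ?count_size //.
rewrite -conjgM -coloring_window //.
by move: xp => /andP[/ltW-> /ltW->].
Qed.

(** Reading a colouring from the base points replaces each [m i] by its conjugate under
    [h i (p i)]. *)
Lemma walk_systemP : arc_system (fun i => m i ^ h i (p i)) walk_system.
Proof.
by move=> a; rewrite -walk_longitudeE // -ltnS; case: a => i j; apply: (ltn_ord j).
Qed.

Lemma walk_total i : arc_longitude walk_system i (size (unders D p i)) = lam i ^ h i (p i).
Proof.
have W := @coloring_window i (p i + 1)%R; rewrite (proj1 hh) lerDl ler01 lexx in W.
have {}W := W isT; rewrite -walk_longitudeE // conjgE W mulKg; congr walk_longitude.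
apply/esym/eqP; rewrite -all_count; apply/allP => u /mem_unders[/andP[]] //.
Qed.

End ColoringSystem.

Lemma morph_expgz (G H : groupType) (f : G -> H) x a : {morph f : x y / (x * y)%g} ->
  f (expgz x a) = expgz (f x) a.
Proof.
move=> fM; have f1 : f 1%g = 1%g by apply: (mulgI (f 1%g)); rewrite -fM !mulg1.
have fX k : f (x ^+ k)%g = (f x ^+ k)%g.
  by elim: k => [|k IH]; rewrite ?f1 // !expgS fM IH.
case: a => k /=; first exact: fX.
by apply: (mulgI (f (x ^+ k.+1)%g)); rewrite -fM !mulgV f1 fX mulgV.
Qed.

Lemma morph_inv (G H : groupType) (f : G -> H) x : {morph f : x y / (x * y)%g} ->
  f x^-1%g = (f x)^-1%g.
Proof. by move=> fM; rewrite -[x^-1%g]/(expgz x (-1)) morph_expgz. Qed.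

(** * The recursion for eta in a unitriangular group *)

Section Eta.
Variables (R : realType) (n : nat) (D : vdiagram R n) (p : 'I_n -> R).
Variables (K : comNzRingType) (s : nat) (g : 'I_n -> unitri K s).
Local Notation G := (unitri K s).
Local Open Scope group_scope.

Definition eta_lift q (a : diagram_arc D p) : G := fg_lift g (eta_gen q a).

Lemma eta_partial q i j :
  fg_lift g (fg_lift (@eta_gen _ _ D p q) (partial_longitude D p i j)) =
  arc_longitude (eta_lift q) i j.
Proof.
pose f (w : freeGroup (diagram_arc D p)) := fg_lift g (fg_lift (@eta_gen _ _ D p q) w).
have fM : {morph f : x y / x * y} by move=> x y; rewrite /f !fg_liftM.
have f1 : f 1 = 1 by apply: (mulgI (f 1)); rewrite -fM !mulg1.
rewrite -[LHS]/(f _) /partial_longitude (big_morph f fM f1) /arc_longitude.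
by apply: eq_bigr => k _; rewrite morph_expgz // /f fg_lift_gen.
Qed.

Lemma eta_lift0 a : eta_lift 0 a = g (tag a).
Proof. by rewrite /eta_lift /= fg_lift_gen. Qed.

Lemma eta_liftS q a :
  eta_lift q.+1 a = g (tag a) ^ arc_longitude (eta_lift q) (tag a) (tagged a).
Proof.
rewrite /eta_lift /= !fg_liftM morph_inv; last exact: fg_liftM.
by rewrite fg_lift_gen eta_partial conjgE mulgA.
Qed.

Lemma cong_arc_longitude k (y y' : diagram_arc D p -> G) i j :
  (forall a, cong k (y a) (y' a)) -> cong k (arc_longitude y i j) (arc_longitude y' i j).
Proof. by move=> yy; apply: cong_prod => l; apply: cong_expgz. Qed.

(** Longitudes correct modulo level [q.+1] give conjugates correct modulo level [q.+2], by
    [cong_conj]. At level [s.+1] congruence is equality, whence the uniqueness of the solution. *)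
Lemma eta_cong (y : diagram_arc D p -> G) : arc_system g y ->
  forall q a, cong q.+1 (eta_lift q a) (y a).
Proof.
move=> ys; elim=> [|q IH] a; first exact: cong1.
by rewrite eta_liftS ys; apply/cong_conj/cong_arc_longitude.
Qed.

Lemma eta_cong_succ q a : cong q.+1 (eta_lift q a) (eta_lift q.+1 a).
Proof.
elim: q a => [|q IH] a; first exact: cong1.
by rewrite !eta_liftS; apply/cong_conj/cong_arc_longitude.
Qed.

Lemma eta_stable q : (s <= q)%N -> eta_lift q = eta_lift s.
Proof.
move=> sq; rewrite -(subnK sq); elim: (q - s)%N => [//|d IH].
rewrite addSn -IH; apply/funext => a; apply/esym/cong_top.
apply: (@cong_le _ _ (d + s).+1); first by rewrite ltnS leq_addl.
exact: eta_cong_succ.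
Qed.

Lemma eta_system : arc_system g (eta_lift s).
Proof. by move=> a; rewrite -eta_liftS eta_stable. Qed.

Lemma eta_uniq (y : diagram_arc D p -> G) : arc_system g y -> y = eta_lift s.
Proof. by move=> ys; apply/funext => a; apply/esym/cong_top/eta_cong. Qed.

Lemma eta_preferred q i : fg_lift g (@Defs.eta _ _ D p q.+1 (preferred_longitude D p i)) =
  expgz (g i) (- self_writhe D p i) * arc_longitude (eta_lift q) i (size (unders D p i)).
Proof.
pose f (w : freeGroup (diagram_arc D p)) := fg_lift g (fg_lift (@eta_gen _ _ D p q) w).
have fM : {morph f : x y / x * y} by move=> x y; rewrite /f !fg_liftM.
rewrite -[LHS]/(f _) /preferred_longitude fM morph_expgz // /f eta_partial fg_lift_gen.
congr (expgz _ _ * _); rewrite -/(eta_lift q (mk_arc D p i 0)).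
case: q {f fM} => [|q]; first by rewrite eta_lift0.
by rewrite eta_liftS /mk_arc /= inordK // /arc_longitude big_ord0 conjg1.
Qed.

End Eta.

Section Transfer.
Variables (R : realType) (n : nat).
Implicit Types (D : vdiagram R n) (p : 'I_n -> R).

Lemma gen_mx_elem (K : comNzRingType) (J : seq 'I_n) : gen_mx (elem K J) = elem_mx K J.
Proof. by apply/funext => x; rewrite /gen_mx /= addrAC subrr add0r. Qed.

Lemma elem_entry (K : comNzRingType) (J : seq 'I_n) w (a b : 'I_(size J).+1) : (a < b)%N ->
  unitri_mx (fg_lift (elem K J) w) a b = (magnus w (seg J a b))%:~R.
Proof.
move=> ab; have bs : (b <= size J)%N by rewrite -ltnS ltn_ord.
rewrite lift_magnus ?(leq_trans _ bs) ?(leq_ltn_trans _ ab) // gen_mx_elem.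
by rewrite theta_elem // (leq_trans (leq_subr _ _)).
Qed.

Lemma magnus_corner (J : seq 'I_n) w : (0 < size J)%N ->
  magnus w J = unitri_mx (fg_lift (elem int J) w) ord0 ord_max.
Proof. by move=> J0; rewrite elem_entry //= segE intz. Qed.

Lemma milnor_stable D p q J i : (0 < size J <= q)%N ->
  magnus (@Defs.eta _ _ D p q.+1 (preferred_longitude D p i)) J = milnor_number D p J i.
Proof.
move=> /andP[J0 Jq]; rewrite /milnor_number !magnus_corner // !eta_preferred.
by rewrite (eta_stable D p _ Jq).
Qed.

Definition longitude_rep D p (K : comNzRingType) (J : seq 'I_n) i : unitri K (size J) :=
  fg_lift (elem K J) (@Defs.eta _ _ D p (size J).+1 (preferred_longitude D p i)).

(** One matrix collects the Milnor numbers of all contiguous subwords of [J] followed by [i];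
    [milnor_stable] allows the common level [(size J).+1]. *)
Lemma longitude_entry D p (K : comNzRingType) J i (a b : 'I_(size J).+1) : (a < b)%N ->
  unitri_mx (longitude_rep D p K J i) a b = (milnor_number D p (seg J a b) i)%:~R.
Proof.
move=> ab; rewrite elem_entry // milnor_stable // size_seg subn_gt0 ab /=.
by rewrite (leq_trans (leq_subr _ _)) // -ltnS ltn_ord.
Qed.

Section Comparison.
Variables (D D' : vdiagram R n) (p p' : 'I_n -> R) (eps : 'I_n -> int).
Hypotheses (bp : base_point_system D p) (bp' : base_point_system D' p').
Hypothesis cmp : comparable D D' eps.

(** The exponent left over when both sides are normalised to preferred longitudes; [writhe_defect0]
    shows that it vanishes. *)
Definition writhe_defect i : int := eps i + self_writhe D p i - self_writhe D' p' i.

Lemma longitude_transfer (K : comNzRingType) (J : seq 'I_n) :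
  (forall i, commute (elem K J i) (longitude_rep D p K J i)) ->
  exists g : 'I_n -> unitri K (size J), forall i,
    fg_lift (fun k => elem K J k ^ g k)%g
      (@Defs.eta _ _ D' p' (size J).+1 (preferred_longitude D' p' i)) =
    ((expgz (elem K J i) (writhe_defect i) * longitude_rep D p K J i) ^ g i)%g.
Proof.
move=> cL; pose m := elem K J; pose y := @eta_lift _ _ D p K (size J) m (size J).
have ys : arc_system m y by apply: eta_system.
have yE i : arc_monodromy y i = (expgz (m i) (self_writhe D p i) * longitude_rep D p K J i)%g.
  by rewrite /longitude_rep eta_preferred mulgA -expgzD subrr mul1g.
have c i : commute (m i) (arc_monodromy y i).
  by rewrite yE; apply: commuteM; [apply: commute_expgz|apply: cL].
have [h' hh'] : colorable D' m (fun i => expgz (m i) (eps i) * arc_monodromy y i)%g.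
  by apply: (proj1 (cmp c)); exists (arc_coloring y); exact: (arc_coloringP bp ys c).
have c' i : commute (m i) (expgz (m i) (eps i) * arc_monodromy y i)%g.
  by apply: commuteM => //; apply: commute_expgz.
(* The conjugators are the values of the transferred colouring at the base points of [D']. By
   [eta_uniq] its arcs are those of the recursion for the conjugated generators. *)
exists (fun i => h' i (p' i)) => i; rewrite eta_preferred.
rewrite -(eta_uniq (walk_systemP bp' c' hh')) (walk_total bp' c' hh') -expgz_conj -conjMg.
by rewrite yE !mulgA -!expgzD /writhe_defect; congr ((expgz _ _ * _) ^ _)%g; lia.
Qed.

End Comparison.
End Transfer.

Lemma unitri1_abelian (K : comNzRingType) (x y : unitri K 1) : commute x y.
Proof.
apply/val_inj/subr0_eq/ftri_top => /=.
have E (c d : 'M[K]_2) : (c + 1) * (d + 1) = c * d + (c + d + 1).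
  by rewrite mulrDl mulrDr mulr1 mul1r !addrA.
rewrite -(subrK 1 (unitri_mx x)) -(subrK 1 (unitri_mx y)) !E opprD addrACA.
rewrite (addrC (unitri_mx y - 1)) subrr addr0.
by apply: ftriB; apply: (@ftriM _ _ 1 1); apply: unitri_sub1.
Qed.

(** * The change of framing, computed in 2 by 2 matrices *)

Section Writhe.
Variables (R : realType) (n : nat).
Local Notation u1 x := (unitri_mx x ord0 ord_max).

Lemma corner1M (K : comNzRingType) (x y : unitri K 1) : u1 (x * y)%g = u1 x + u1 y.
Proof.
have M : ftri 2 ((unitri_mx x - 1) * (unitri_mx y - 1)).
  by apply: (@ftriM _ _ 1 1); apply: unitri_sub1.
have := ftri_top M; rewrite mulrBl mulrBr mul1r mulr1 => E.
have {E}E : unitri_mx x * unitri_mx y = unitri_mx x + unitri_mx y - 1.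
  have := subr0_eq E; rewrite -/(_ - 1) => /eqP; rewrite subr_eq => /eqP ->.
  by rewrite addrC addrA.
by rewrite unitri_mxM E !mxE subr0.
Qed.

Lemma corner11 (K : comNzRingType) : u1 (1%g : unitri K 1) = 0.
Proof. by rewrite mxE. Qed.

Lemma corner1Z (K : comNzRingType) (x : unitri K 1) a : u1 (expgz x a) = u1 x *~ a.
Proof.
have S k : (k.+1%:Z = k%:Z + 1)%R by rewrite -addn1 PoszD.
elim/int_rect: a => [|k IH|k IH]; first by rewrite corner11.
  by rewrite S expgzS corner1M IH mulrzDr.
have := corner1M (expgz x (- k.+1%:Z)) x; rewrite -expgzS.
have E1 : - k.+1%:Z + 1 = - k%:Z by rewrite S opprD subrK.
rewrite E1 IH => E; apply: (addIr (u1 x)); rewrite -E -[X in _ = _ + X]mulr1z -mulrzDr.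
by rewrite E1.
Qed.

Lemma corner1_elem (i k : 'I_n) : u1 (elem int [:: i] k) = (i == k)%:R.
Proof. by rewrite /= !mxE /= add0r. Qed.

(** The corner entry is additive, so the unnormalised longitude contributes the signed number of
    passages of component [i] under itself; this is the self-writhe, which the preferred longitude
    subtracts. *)
Lemma milnor_ii (D : vdiagram R n) (p : 'I_n -> R) i : milnor_number D p [:: i] i = 0.
Proof.
have := @longitude_entry _ _ D p int [:: i] i ord0 ord_max isT; rewrite segE intz => <-.
rewrite /longitude_rep eta_preferred corner1M corner1Z corner1_elem eqxx mulr1n intz.
apply/eqP; rewrite addrC subr_eq0; apply/eqP; rewrite /arc_longitude.
rewrite (big_morph (fun x : unitri int 1 => u1 x) (@corner1M int) (corner11 int)).
rewrite /self_writhe [RHS]big_mkcond; apply: eq_bigr => k _.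
rewrite corner1Z eta_liftS (commute_conj (unitri1_abelian _ _)) corner1_elem /= eq_sym.
by case: eqP => _; rewrite ?mul0rz // intz.
Qed.

Variables (D D' : vdiagram R n) (p p' : 'I_n -> R) (eps : 'I_n -> int).
Hypotheses (bp : base_point_system D p) (bp' : base_point_system D' p').
Hypothesis cmp : comparable D D' eps.

(** For [J = [:: i]] the group is abelian and conjugation disappears. By [milnor_ii] both longitudes
    have corner entry 0, so the remaining power of the generator has corner entry 0 too. *)
Lemma writhe_defect0 i : writhe_defect D D' p p' eps i = 0.
Proof.
have [g /(_ i)] := @longitude_transfer _ _ D D' p p' eps bp bp' cmp int [:: i]
  (fun j => unitri1_abelian _ _).
rewrite (_ : (fun k => _) = elem int [:: i]); last first.
  by apply/funext => k; apply: commute_conj; apply: unitri1_abelian.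
rewrite (commute_conj (unitri1_abelian _ _)) => E.
have := congr1 (fun x : unitri int 1 => u1 x) E; rewrite /= -/(longitude_rep _ _ _ _ _) corner1M.
have L (E' : vdiagram R n) q : u1 (longitude_rep E' q int [:: i] i) = 0.
  have := @longitude_entry _ _ E' q int [:: i] i ord0 ord_max isT.
  by rewrite segE intz milnor_ii.
by rewrite !L addr0 corner1Z corner1_elem eqxx intz.
Qed.

End Writhe.

(** * Congruence and indeterminacy *)

Section CyclicSubsequences.
Variable T : eqType.
Implicit Types Q I : seq T.

Definition cyc_sub Q I := exists k, subseq (rot k Q) I.

(** The subsequence is cut at the seam of the rotation, and its two parts are exchanged. *)
Lemma subseq_rot u k I : subseq u (rot k I) -> exists j, subseq (rot j u) I.
Proof.
move=> h; have {h} : subseq u (drop k I ++ take k I) by exact: h.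
set x := drop k I; set y := take k I => /subseqP[m sm ->].
exists (size (mask (take (size x) m) x)).
have sx : size (take (size x) m) = size x.
  by rewrite size_takel // sm size_cat leq_addr.
rewrite -{2}(cat_take_drop (size x) m) mask_cat // rot_size_cat.
have -> : I = y ++ x by rewrite cat_take_drop.
by apply: cat_subseq; apply: mask_subseq.
Qed.

Lemma cyc_sub_trans Q' Q I : cyc_sub Q' Q -> cyc_sub Q I -> cyc_sub Q' I.
Proof.
move=> [k h] [l h']; have E : Q = rotr l (rot l Q) by rewrite rotK.
move: h; rewrite E /rotr => /subseq_rot[j h].
move: (subseq_trans h h'); rewrite (rot_minn k) (rot_minn j) rot_add_mod ?size_rot ?geq_minr //.
by move=> H; eexists; exact: H.
Qed.

End CyclicSubsequences.

(** * The congruence of Milnor numbers over a ring where the shorter ones vanish *)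

Section Congruence.
Variables (R : realType) (n : nat) (D D' : vdiagram R n) (p p' : 'I_n -> R) (eps : 'I_n -> int).
Hypotheses (bp : base_point_system D p) (bp' : base_point_system D' p').
Hypothesis cmp : comparable D D' eps.

Lemma mu_rcons (E : vdiagram R n) q J i : mu E q (rcons J i) = milnor_number E q J i.
Proof.
rewrite /mu; case e : (rcons J i) => [|x I']; first by case: J e.
by move: e; rewrite lastI => /rcons_inj[-> ->].
Qed.

Variables (K : comNzRingType) (J : seq 'I_n) (i0 : 'I_n).
Hypothesis J0 : (0 < size J)%N.
Definition vanishing (E : vdiagram R n) q := forall Q, (2 <= size Q < (size J).+1)%N ->
  cyc_sub Q (rcons J i0) -> (mu E q Q)%:~R = 0 :> K.
Hypotheses (van : vanishing D p) (van' : vanishing D' p').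

Local Notation s := (size J).
Local Notation m := (elem K J).
Local Notation L := (longitude_rep D p K J).

Lemma seg_subseq a b : subseq (seg J a b) J.
Proof. exact: subseq_trans (take_subseq _ _) (drop_subseq _ _). Qed.

Lemma subseq_rcons_r (u : seq 'I_n) : subseq u J -> subseq u (rcons J i0).
Proof. by move=> h; apply: subseq_trans h (subseq_rcons _ _). Qed.

(** In the entry (a, b), multiplication by [elem_mx] on the right gives the number of J[a..b) if
    this word ends in [i]. Multiplication on the left, if the word begins with [i], gives the number
    of the word with that letter moved to the end, a cyclic permutation. Both vanish by [van]; near
    the diagonal the difference is a combination of products of two strictly triangular matrices. *)
Lemma longitude_commute i : commute (m i) (L i).
Proof.
apply/val_inj => /=; rewrite mulrDl mulrDr mul1r mulr1; congr (_ + _).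
have elemE (a b : 'I_s.+1) : elem_mx K J i a b != 0 -> b = a.+1 :> nat /\ nth i J a = i.
  rewrite mxE; case e : (b == a.+1 :> nat); last by rewrite eqxx.
  by case e' : (nth i J a == i); [rewrite (eqP e) (eqP e')|rewrite eqxx].
apply/matrixP => a b; apply/eqP; rewrite -subr_eq0; apply/eqP.
have [ba|ab] := ltnP b a.+2.
  have F : ftri 2 (elem_mx K J i * unitri_mx (L i) - unitri_mx (L i) * elem_mx K J i).
    have -> : elem_mx K J i * unitri_mx (L i) - unitri_mx (L i) * elem_mx K J i =
        elem_mx K J i * (unitri_mx (L i) - 1) - (unitri_mx (L i) - 1) * elem_mx K J i.
      by rewrite mulrBr mulrBl mulr1 mul1r opprB addrA subrK.
    by apply: ftriB; apply: (@ftriM _ _ 1 1); (try exact: ftri_elem); apply: unitri_sub1.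
  by have := F a b; rewrite addn2 => /(_ ba); rewrite mxE [X in _ + X]mxE.
have bs : (b <= s)%N by rewrite -ltnS ltn_ord.
have seg0 (Q : seq 'I_n) : size Q = (b - a)%N -> cyc_sub Q J -> (mu D p Q)%:~R = 0 :> K.
  move=> sQ [k kQ]; apply: van; first by rewrite sQ; move: ab bs; lia.
  by exists k; apply: subseq_rcons_r.
have as' : (a < s)%N by move: ab bs; lia.
rewrite !mxE !big1 ?subrr // => c _.
- have [->|/elemE[cb ci]] := eqVneq (elem_mx K J i c b) 0; first by rewrite mulr0.
  have ac : (a < c)%N by move: ab; rewrite cb.
  rewrite longitude_entry // -mu_rcons seg0 ?mul0r //.
    by rewrite size_rcons size_seg cb subSn // ltnW.
  exists 0%N; rewrite rot0 -{1}ci -cats1.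
  have cs : (c < s)%N by rewrite -cb.
  have -> : [:: nth i J c] = seg J c b by rewrite (@seg_cons _ J i c b) ?cb // /seg subnn take0.
  by rewrite -seg_cat ?seg_subseq // ?cb ltnW.
- have [->|/elemE[ca ai]] := eqVneq (elem_mx K J i a c) 0; first by rewrite mul0r.
  have cb : (c < b)%N by rewrite ca.
  rewrite longitude_entry // -mu_rcons seg0 ?mulr0 //.
    by rewrite size_rcons size_seg ca subnSK // ltnW.
  exists (size (seg J c b)); rewrite -cats1 rot_size_cat -[in X in X ++ _]ai /= ca.
  by rewrite -(@seg_cons _ J i a b) ?seg_subseq // ltnW.
Qed.

Lemma longitude_top : ftri s (unitri_mx (L i0) - 1).
Proof.
move=> a b ba; have [ab|ba'] := ltnP a b; last first.
  by apply: (unitri_sub1 (L i0)); rewrite addn1 ltnS.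
rewrite mxE longitude_entry // [X in _ + X]mxE [X in - X]mxE.
have -> : (a == b) = false by rewrite -val_eqE /= ltn_eqF.
rewrite subr0 -mu_rcons; apply: van.
  have bs : (b <= s)%N by rewrite -ltnS ltn_ord.
  by rewrite size_rcons size_seg; move: ab ba bs; lia.
by exists 0%N; rewrite rot0 -!cats1; apply: cat_subseq => //; apply: seg_subseq.
Qed.

(** [L i0 - 1] is concentrated in the corner and killed by strictly triangular factors. Thus [L i0]
    is central, and the unknown conjugator drops out. *)
Lemma longitude_conj g : (L i0 ^ g)%g = L i0.
Proof.
apply: commute_conj; apply/val_inj => /=; set A := unitri_mx (L i0); set B := unitri_mx g.
have top X : ftri 1 (X - 1) -> (A - 1) * X = A - 1 /\ X * (A - 1) = A - 1.
  move=> hX; split; apply/subr0_eq/ftri_top.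
    have -> : (A - 1) * X - (A - 1) = (A - 1) * (X - 1) by rewrite mulrBr mulr1.
    apply: (@ftri_le _ _ (s + 1)); first by rewrite addn1.
    exact: ftriM longitude_top hX.
  have -> : X * (A - 1) - (A - 1) = (X - 1) * (A - 1) by rewrite mulrBl mul1r.
  apply: (@ftri_le _ _ (1 + s)) => //; exact: ftriM hX longitude_top.
have [h1 h2] := top B (unitri_sub1 g).
transitivity (A - 1 + B); first by rewrite -[in RHS]h1 mulrBl mul1r subrK.
by rewrite -[in LHS]h2 mulrBr mulr1 subrK.
Qed.

Lemma milnor_congruence : (mu D p (rcons J i0))%:~R = (mu D' p' (rcons J i0))%:~R :> K.
Proof.
have [g G] := longitude_transfer bp bp' cmp longitude_commute.
have := G i0; rewrite (writhe_defect0 bp bp' cmp) mul1g longitude_conj => E.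
have := congr1 (fun x : unitri K s => unitri_mx x ord0 ord_max) E; rewrite /= longitude_entry //=.
rewrite segE -!mu_rcons => <-.
(* The generators on the side of [D'] are conjugated; [van'] suppresses the contributions of their
   entries beyond the first superdiagonal. *)
rewrite lift_magnus // (theta_corner (J := J)) /= ?segE ?subn0 //.
- by rewrite milnor_stable ?J0 ?leqnn // mu_rcons.
- by move=> x; apply: ftri_gen.
- by move=> x a b; apply: conj_elem_next.
- by move=> x a c; apply: conj_elem_seg.
- move=> u u0 su szu; rewrite milnor_stable -?mu_rcons.
    apply: van'; first by rewrite size_rcons; case: (u) u0 szu => //= *; lia.
    by exists 0%N; rewrite rot0 -!cats1; apply: cat_subseq.
  by rewrite (ltnW szu) andbT; case: (u) u0.
Qed.

End Congruence.

(** The ring is [int] for d = 0 and the integers modulo d for d > 1. The case d = 1 is separate, as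
    the zero ring is no [comNzRingType]. *)
Lemma int_mod_eq (d : nat) (a b : int) :
  (forall K : comNzRingType, (forall z : int, (d %| `|z|)%N -> z%:~R = 0 :> K) ->
     a%:~R = b%:~R :> K) -> (a = b %[mod d%:Z])%Z.
Proof.
case: d => [|[|d]] H.
- by have := H int; rewrite !intz => -> // z; rewrite dvd0n absz_eq0 intz => /eqP.
- by rewrite !modz1.
have zE (z : int) : ((z%:~R : 'Z_d.+2) == 0) = (d.+2 %| `|z|)%N.
  have N k : ((k%:R : 'Z_d.+2) == 0) = (d.+2 %| k)%N.
    by rewrite -val_eqE /= val_Zp_nat.
  by case: z => k; rewrite ?NegzE ?mulrNz ?oppr_eq0 N ?abszN.
apply/eqP; rewrite eqz_mod_dvd dvdzE absz_nat -zE intrB subr_eq0; apply/eqP.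
by apply: H => z; rewrite -zE => /eqP.
Qed.

(** * Divisibility by the indeterminacy and the conclusion *)

Section Indeterminacy.
Variables (R : realType) (n : nat).
Implicit Types (D : vdiagram R n) (p : 'I_n -> R) (I Q : seq 'I_n).

Definition proper_cyc Q I : Prop := (2 <= size Q < size I)%N /\ cyc_sub Q I.

Lemma dvdn_Delta D p (d : nat) I : (d %| Delta D p I)%N <->
  forall Q, proper_cyc Q I -> (d %| `|mu D p Q|)%N.
Proof.
split=> [/dvdn_biggcdP h Q [sQ [k /subseqP[b sb e]]]|h].
  have h1 := h (tcast sb (in_tuple b)).
  rewrite (_ : tval (tcast sb (in_tuple b)) = b) ?val_tcast // -e size_rot in h1.
  have /dvdn_biggcdP h' := h1 sQ.
  have Q0 : (0 < size Q)%N by case/andP: sQ => /ltnW.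
  (* The rotation by [j] undoes the one by [k], which is trivial unless 0 < k < size Q. *)
  pose j := (if (k < size Q)%N && (k != 0) then size Q - k else 0)%N.
  have js : (j < size Q)%N.
    by rewrite /j; case: ifP => // /andP[ks k0]; rewrite ltn_subrL lt0n k0.
  have := h' (Ordinal js) isT; rewrite /= (_ : rot j (rot k Q) = Q) //.
  rewrite /j; case: ifP => [/andP[ks k0]|/negbT].
    by rewrite -[RHS](rotK k Q) /rotr size_rot.
  rewrite negb_and negbK -leqNgt rot0 => /orP[ks|/eqP->]; last by rewrite rot0.
  by rewrite rot_oversize.
apply/dvdn_biggcdP => b sb; apply/dvdn_biggcdP => k _; apply: h; split.
  by rewrite size_rot.
have : subseq (rotr k (rot k (mask b I))) I by rewrite rotK mask_subseq.
by rewrite /rotr => h; eexists; exact: h.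
Qed.

Lemma proper_cyc_trans Q' Q I : proper_cyc Q' Q -> proper_cyc Q I -> proper_cyc Q' I.
Proof.
move=> [/andP[s1 s2] h1] [/andP[s3 s4] h2]; split; last exact: cyc_sub_trans h1 h2.
by rewrite s1 (ltn_trans s2).
Qed.

Variables (D D' : vdiagram R n) (p p' : 'I_n -> R) (eps : 'I_n -> int).
Hypotheses (bp : base_point_system D p) (bp' : base_point_system D' p').
Hypothesis cmp : comparable D D' eps.

Lemma mu_congruence (d : nat) I : (2 <= size I)%N ->
  (forall Q, proper_cyc Q I -> (d %| `|mu D p Q|)%N) ->
  (forall Q, proper_cyc Q I -> (d %| `|mu D' p' Q|)%N) ->
  (mu D p I = mu D' p' I %[mod d%:Z])%Z.
Proof.
case/lastP: I => [//|J i]; rewrite size_rcons ltnS => J0 h h'.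
apply: int_mod_eq => K dK; apply: (milnor_congruence bp bp' cmp J0) => Q sQ cQ; apply: dK.
  by apply: h; split; rewrite ?size_rcons.
by apply: h'; split; rewrite ?size_rcons.
Qed.

(** [Delta D p I] divides [Delta D p Q], modulo which the numbers of [Q] for the two diagrams agree.
    That congruence needs divisibility of the numbers of [D'] for sequences shorter than [Q], which
    is the induction hypothesis for [Q]. *)
Lemma Delta_dvd_mu N I : (size I <= N)%N ->
  forall Q, proper_cyc Q I -> (Delta D p I %| `|mu D' p' Q|)%N.
Proof.
elim: N I => [|N IH] I sI Q QI; have [/andP[s1 s2] _] := QI.
  by move: s2; rewrite ltnNge (leq_trans sI).
have DQ : (Delta D p I %| Delta D p Q)%N.
  apply/dvdn_Delta => Q' Q'Q; apply: (proj1 (dvdn_Delta D p _ I)) => //.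
  exact: proper_cyc_trans Q'Q QI.
have E : (mu D p Q = mu D' p' Q %[mod (Delta D p Q)%:Z])%Z.
  apply: mu_congruence => // [|Q' Q'Q]; first by apply/dvdn_Delta.
  by apply: (IH Q) Q'Q; rewrite -ltnS (leq_trans s2).
have dD : (Delta D p I %| `|mu D p Q|)%N by apply: (proj1 (dvdn_Delta D p _ I)).
move/eqP: E; rewrite eqz_mod_dvd => E.
have {}E : ((Delta D p I)%:Z %| mu D p Q - mu D' p' Q)%Z by apply: dvdz_trans E; rewrite dvdzE.
have : ((Delta D p I)%:Z %| mu D' p' Q)%Z by rewrite -[mu D' p' Q](subKr (mu D p Q)); apply: rpredB E; rewrite dvdzE.
by rewrite dvdzE.
Qed.

End Indeterminacy.

Theorem theorem5p2 (R : realType) (n : nat) (hn : (1 <= n)%N)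
    (D D' : vdiagram R n) (p p' : 'I_n -> R) (I : seq 'I_n) :
  welded_equivalent D D' ->
  base_point_system D p -> base_point_system D' p' ->
  (2 <= size I)%N ->
  (mu D p I = mu D' p' I %[mod (Delta D p I)%:Z])%Z /\
  Delta D p I = Delta D' p' I.
Proof.
move=> equiv bp bp' sI; have [eps cmp] := welded_comparable equiv.
have h := Delta_dvd_mu bp bp' cmp (leqnn (size I)).
have h' := Delta_dvd_mu bp' bp (comparable_sym cmp) (leqnn (size I)).
split; first by apply: (mu_congruence bp bp' cmp sI) => //; apply/dvdn_Delta.
by apply/eqP; rewrite eqn_dvd; apply/andP; split; apply/dvdn_Delta.
Qed.
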